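(* Let $\Omega\subset\mathbb R^n$ be a bounded domain satisfying the uniform exterior ball condition. Assume that $0<\sigma<2$, $b_{ab}\equiv0$ in $\Omega$ if $\sigma<1$, and $c_{ab}\ge\gamma$ in $\Omega$ for some $\gamma>0$ (for all $a\in\mathcal A,b\in\mathcal B$). Assume that $g$ is a bounded continuous function in $\mathbb R^n$, that $\{K_{ab}(\cdot,z)\}_{a,b,z}$, $\{b_{ab}\}_{a,b}$, $\{c_{ab}\}_{a,b}$, $\{f_{ab}\}_{a,b}$ are sets of uniformly bounded and continuous functions in $\Omega$, uniformly in $a\in\mathcal A$, $b\in\mathcal B$, and that $\{K_{ab}(x,\cdot):x\in\Omega,a\in\mathcal A,b\in\mathcal B\}$ are kernels satisfying the upper-bound conditions and the boundary nondegeneracy condition of the context. Then the Dirichlet problem $$\sup_{a\in\mathcal A}\inf_{b\in\mathcal B}\{-I_{ab}[x,u]+b_{ab}(x)\cdot\nabla u(x)+c_{ab}(x)u(x)+f_{ab}(x)\}=0\ \text{ in }\Omega,\qquad u=g\ \text{ in }\Omega^c$$ admits a discontinuous viscosity solution $u$.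
   Context: $B_\delta(x)$ is the open ball of radius $\delta$ centered at $x$, $B_\delta=B_\delta(0)$; $\mathcal A,\mathcal B$ are index sets; $b_{ab}$ is $\mathbb R^n$-valued, $c_{ab},f_{ab}$ are real-valued. $C_b^2(\mathbb R^n)$ is the set of bounded functions in $C^2(\mathbb R^n)$, with the convention $C^2=C^{1,1}$ (first partial derivatives locally Lipschitz). Uniform exterior ball condition: there is $r_\Omega>0$ (without loss of generality $r_\Omega<1$) such that for any $x\in\partial\Omega$ and $0<r\le r_\Omega$ there is a point $y_x^r\in\Omega^c$ with $\bar B_r(y_x^r)\cap\bar\Omega=\{x\}$. Operators: $I_{ab}[x,u]=\int_{\mathbb R^n}\delta_zu(x)K_{ab}(x,z)\,dz$, where $\delta_zu(x)$ equals $u(x+z)-u(x)$ if $\sigma<1$; $u(x+z)-u(x)-\mathbf 1_{B_1}(z)\nabla u(x)\cdot z$ if $\sigma=1$; $u(x+z)-u(x)-\nabla u(x)\cdot z$ if $\sigma>1$. Upper-bound conditions on a kernel $K:\mathbb R^n\to\mathbb R$ (with a fixed constant $\Lambda>0$): $K\ge0$ and, for every $\delta>0$, $\int_{B_{2\delta}\setminus B_\delta}K(z)\,dz\le(2-\sigma)\Lambda\delta^{-\sigma}$ and $\left|\int_{B_{2\delta}\setminus B_\delta}zK(z)\,dz\right|\le\Lambda|1-\sigma|\delta^{1-\sigma}$. Boundary nondegeneracy condition on the family of kernels: there exist $C_4>0$, $0<r_1<r_\Omega$, $\lambda>0$ and $\mu>0$ such that, for every kernel $K=K_{ab}$ of the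 family, any $x\in\partial\Omega$, $0<r<r_1$ and $y\in\Omega\cap B_{2r}(y_x^r)$, setting $\nu_y=\frac{y-y_x^r}{|y-y_x^r|}$ and $s_y=\frac{|y-y_x^r|}{r}-1$, there is a set $A\subset\{z: z\cdot\nu_y<-rs_y\}\cap(B_{C_4rs_y}\setminus B_{rs_y})$ with $|A|\ge\mu|B_{rs_y}|$ and $K(y,z)\ge(2-\sigma)\lambda(rs_y)^{-n-\sigma}$ for any $z\in A$. Viscosity notions: write $F(x,r,\varphi)=\sup_a\inf_b\{-I_{ab}[x,\varphi]+b_{ab}(x)\cdot\nabla\varphi(x)+c_{ab}(x)r+f_{ab}(x)\}$. A bounded upper (lower) semicontinuous function $u$ on $\mathbb R^n$ is a viscosity subsolution (supersolution) of the equation in $\Omega$ if whenever $u-\varphi$ has a maximum (minimum) over $\mathbb R^n$ at $x\in\Omega$ for $\varphi\in C_b^2(\mathbb R^n)$, then $F(x,u(x),\varphi)\le0$ ($\ge0$); it is a viscosity subsolution (supersolution) of the Dirichlet problem if moreover $u\le g$ ($u\ge g$) in $\Omega^c$. A bounded function $u$ on $\mathbb R^n$ is a discontinuous viscosity solution of the Dirichlet problem if its upper semicontinuous envelope $u^*$ is a viscosity subsolution and its lower semicontinuous envelope $u_*$ is a viscosity supersolution of the Dirichlet problem, where $u^*(x)=\lim_{r\to0}\sup\{u(y):|y-x|\le r\}$ and $u_*(x)=\lim_{r\to0}\inf\{u(y):|y-x|\le r\}$. *)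

(* Defs.v *)
From HB Require Import structures.
From mathcomp Require Import all_boot all_order all_algebra.
From mathcomp Require Import all_classical all_reals all_analysis.

Set Implicit Arguments.
Unset Strict Implicit.
Unset Printing Implicit Defensive.

Import Order.TTheory GRing.Theory Num.Theory.
Import numFieldNormedType.Exports.

Local Open Scope classical_set_scope.
Local Open Scope ring_scope.

(* Vectors of R^(n+1) are rows; the dimension is written n.+1 so that it is
   positive. The library topology of 'rV[R]_n.+1 comes from the sup norm, so
   the Euclidean norm and the Euclidean balls are defined here. *)
Section euclidean.
Context {R : realType} {n : nat}.
Implicit Types (x y z : 'rV[R]_n.+1) (r : R).

Definition dotp x y : R := \sum_i x ord0 i * y ord0 i.

Definition enorm x : R := Num.sqrt (dotp x x).

Definition eball x r : set 'rV[R]_n.+1 := [set z | enorm (z - x) < r].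

Definition ecball x r : set 'rV[R]_n.+1 := [set z | enorm (z - x) <= r].

Definition boundary (D : set 'rV[R]_n.+1) : set 'rV[R]_n.+1 :=
  closure D `\` interior D.

End euclidean.

(* n-dimensional Lebesgue measure: the outer measure given by countable covers
   by half-open boxes, restricted by Caratheodory's theorem to its measurable
   sets, which are exactly the Lebesgue measurable sets. *)
Section lebesgue_outer_measure.
Context (R : realType) (n : nat).
Implicit Types (p : 'rV[R]_n.+1 * 'rV[R]_n.+1) (X : set 'rV[R]_n.+1).

Definition box p : set 'rV[R]_n.+1 :=
  [set z | forall i, p.1 ord0 i <= z ord0 i < p.2 ord0 i].

Definition box_volume p : R := \prod_i (p.2 ord0 i - p.1 ord0 i).

Definition box_cover X : set (nat -> 'rV[R]_n.+1 * 'rV[R]_n.+1) :=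
  [set F : nat -> 'rV[R]_n.+1 * 'rV[R]_n.+1 |
    (forall k i, (F k).1 ord0 i <= (F k).2 ord0 i) /\
    X `<=` \bigcup_k box (F k)].

Definition lebesgue_outer X : \bar R :=
  ereal_inf [set (\sum_(k <oo) (box_volume (F k))%:E)%E | F in box_cover X].

Let vol_ge0 p : (forall i, p.1 ord0 i <= p.2 ord0 i) ->
  (0 <= (box_volume p)%:E)%E.
Proof.
by move=> h; rewrite lee_fin; apply: prodr_ge0 => i _; rewrite subr_ge0.
Qed.

Let outer_ge0 X : (0 <= lebesgue_outer X)%E.
Proof.
apply: le_ereal_inf_tmp => _ [F [F0 _] <-].
by apply: nneseries_ge0 => k _ _; exact: vol_ge0.
Qed.

Let outer_le : {homo lebesgue_outer : A B / A `<=` B >-> (A <= B)%E}.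
Proof.
move=> A B AB; apply/ereal_inf_le_tmp => _ [F [F0 BF] <-].
by exists F => //; split => //; exact: subset_trans BF.
Qed.

Let outer0 : lebesgue_outer set0 = 0%E.
Proof.
apply/eqP; rewrite eq_le outer_ge0 andbT.
apply: ereal_inf_lbound; exists (fun=> (0, 0)); first by split.
by apply: eseries0 => k _ _; rewrite /box_volume big_ord_recl/= mxE subrr mul0r.
Qed.

Let outer_sub : sigma_subadditive lebesgue_outer.
Proof.
move=> A; have [[i ioo]|] := pselect (exists i, lebesgue_outer (A i) = +oo%E).
  rewrite (eseries_pinfty _ _ ioo) ?leey// => k _.
  by rewrite -ltNye (lt_le_trans _ (outer_ge0 _)).
rewrite -forallNE => Aoo.
suff add2e (e : {posnum R}) : (lebesgue_outer (\bigcup_k A k) <=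
    \sum_(i <oo) lebesgue_outer (A i) + e%:num%:E)%E.
  by apply/lee_addgt0Pr => _/posnumP[].
rewrite (le_trans _ (epsilon_trick _ _ _))//.
pose P k (B : nat -> 'rV[R]_n.+1 * 'rV[R]_n.+1) := box_cover (A k) B /\
  (\sum_(j <oo) (box_volume (B j))%:E <=
   lebesgue_outer (A k) + (e%:num / (2 ^ k.+1)%:R)%:E)%E.
have [G PG] : {G : nat -> nat -> 'rV[R]_n.+1 * 'rV[R]_n.+1 &
    forall k, P k (G k)}.
  apply: (@choice _ _ P) => k; rewrite /P /lebesgue_outer.
  set S := (X in ereal_inf X); move infS : (ereal_inf S) => iS.
  case: iS infS => [r Sr|Soo|Soo].
  - have en1 : 0 < e%:num / (2 ^ k.+1)%:R by [].
    have /(lb_ereal_inf_adherent en1) : ereal_inf S \is a fin_num by rewrite Sr.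
    move=> [x [B [mB AnB muBx] xS]].
    by exists B; split => //; rewrite muBx -Sr; exact/ltW.
  - by have := Aoo k; rewrite /lebesgue_outer Soo.
  - by have := outer_ge0 (A k); rewrite /lebesgue_outer -/S Soo.
pose v (i : nat * nat) : \bar R := (box_volume (uncurry G i))%:E.
have leG i l : (uncurry G i).1 ord0 l <= (uncurry G i).2 ord0 l.
  by case: i => i j; exact: (PG i).1.1.
have v0 i : (0 <= v i)%E by apply: vol_ge0; exact: leG.
apply: (@le_trans _ _ (\esum_(i in setT) v i)%E).
  apply: ereal_inf_lbound => /=.
  have /card_esym/ppcard_eqP[f] := card_nat2.
  exists (uncurry G \o f).
    split=> [k i|]; first exact: leG.
    move=> t [i _ /(PG i).1.2[j _ Bijt]].
    by exists (f^-1%FUN (i, j)) => //=; rewrite invK ?inE.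
  rewrite -(esum_pred_image v _ xpredT) ?[fun=> _]set_true//.
  by rewrite image_eq.
rewrite (_ : esum _ _ = \sum_(i <oo) \sum_(j <oo) v (i, j))%E; last first.
  pose J : nat -> set (nat * nat) := fun i => [set (i, j) | j in setT].
  rewrite (_ : setT = \bigcup_k J k); last first.
    by rewrite predeqE => -[a b]; split => // _; exists a => //; exists b.
  rewrite esum_bigcupT //=; last first.
    apply/trivIsetP => i j _ _ ij.
    rewrite predeqE => -[k m] /=; split => //= -[] [_] _ [<-{k} _].
    by move=> [m' _] [] /esym/eqP; rewrite (negbTE ij).
  rewrite -(image_id [set: nat]) -fun_true esum_pred_image//; last first.
    by move=> k _; exact: esum_ge0.
  apply: eq_eseriesr => /= j _.
  rewrite -(esum_pred_image v (pair j) predT)//=; last first.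
    by move=> ? ? _ _; exact: (@can_inj _ _ _ snd).
  by congr esum; rewrite predeqE => -[a b]; split; move=> [i _ <-]; exists i.
apply: lee_nneseries => i _; last exact: (PG i).2.
by move=> _; apply: nneseries_ge0 => j _ _; exact: (v0 (i, j)).
Qed.

HB.instance Definition _ := isOuterMeasure.Build R 'rV[R]_n.+1 lebesgue_outer
  outer0 outer_ge0 outer_le outer_sub.

(* A copy of 'rV[R]_n.+1 carrying the Lebesgue sigma-algebra. *)
Definition lebesgue_space := caratheodory_type lebesgue_outer.

HB.instance Definition _ := Measurable.on lebesgue_space.

Definition lebesgue_rV : set lebesgue_space -> \bar R := lebesgue_outer.

HB.instance Definition _ := isMeasure.Build _ lebesgue_space R lebesgue_rV
  (@caratheodory_measure0 _ _ lebesgue_outer)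
  (@caratheodory_measure_ge0 _ _ lebesgue_outer)
  (@caratheodory_measure_sigma_additive _ _ lebesgue_outer).

End lebesgue_outer_measure.

Arguments lebesgue_rV : clear implicits.

Section domains.
Context {R : realType} {n : nat}.
Local Notation V := 'rV[R]_n.+1.
Implicit Types (Omega : set V).

Definition bounded_domain Omega :=
  [/\ open Omega, connected Omega, Omega !=set0 & bounded_set Omega].

(* y x r is the centre of the exterior ball of radius r touching the closure of
   Omega at x only. The centres need not be unique (at a convex corner, say),
   hence the explicit selection y, to which the nondegeneracy condition below
   refers. *)
Definition exterior_balls Omega (r_Omega : R) (y : V -> R -> V) :=
  0 < r_Omega < 1 /\
  forall x r, boundary Omega x -> 0 < r <= r_Omega ->
    ~ Omega (y x r) /\ ecball (y x r) r `&` closure Omega = [set x].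

(* Boundedness on Omega and continuity at each point of Omega, both uniform
   over the members h i, i in W, of the family. *)
Definition unif_bounded_continuous Omega {I : Type} {W : normedModType R}
    (D : set I) (h : I -> V -> W) :=
  (exists M : R, forall i, D i -> forall x, Omega x -> `|h i x| <= M) /\
  (forall x, Omega x -> forall e : R, 0 < e ->
    \forall y \near x, Omega y -> forall i, D i -> `|h i y - h i x| < e).

(* Uniformity over z is asked on each {rho <= |z| <= 1/rho} only: uniformity
   over all z would contradict the singularity at z = 0 that boundary
   nondegeneracy forces, while separate bounds and moduli for each z would allow
   operators that are not equicontinuous in x. *)
Definition unif_bounded_continuous_kernels Omega {A B : Type}
    (K : A -> B -> V -> V -> R) :=
  forall rho : R, 0 < rho ->
    unif_bounded_continuous Omega
      [set i : A * B * V | rho <= enorm i.2 <= rho^-1]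
      (fun i x => K i.1.1 i.1.2 x i.2).

Definition annulus (delta : R) : set (lebesgue_space R n) :=
  eball (0 : V) (2 * delta) `\` eball (0 : V) delta.

Definition upper_bounds (sigma Lambda : R) (k : V -> R) :=
  [/\ measurable_fun [set: lebesgue_space R n] k,
      forall z, 0 <= k z,
      forall delta : R, 0 < delta ->
        (\int[lebesgue_rV R n]_(z in annulus delta) (k z)%:E <=
         ((2 - sigma) * Lambda * delta `^ (- sigma))%:E)%E &
      forall delta : R, 0 < delta ->
        enorm (\row_i \int[lebesgue_rV R n]_(z in annulus delta)
                        ((z : V) ord0 i * k z)) <=
        Lambda * `|1 - sigma| * delta `^ (1 - sigma)].

Definition boundary_nondegenerate Omega (r_Omega : R) (y : V -> R -> V)
    (sigma : R) {A B : Type} (K : A -> B -> V -> V -> R) :=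
  exists C4 r1 lambda mu : R,
    [/\ 0 < C4, 0 < r1 < r_Omega, 0 < lambda & 0 < mu] /\
    forall (a : A) (b : B) (x : V) (r : R) (p : V),
      boundary Omega x -> 0 < r < r1 -> Omega p -> eball (y x r) (2 * r) p ->
      let d := enorm (p - y x r) in
      let nu := d^-1 *: (p - y x r) in
      let s := d / r - 1 in
      exists S : set (lebesgue_space R n),
        [/\ measurable S,
            S `<=` [set z : V | dotp z nu < - (r * s)] `&`
                   (eball (0 : V) (C4 * (r * s)) `\` eball (0 : V) (r * s)),
            (mu%:E * lebesgue_rV R n (eball (0 : V) (r * s)) <=
             lebesgue_rV R n S)%E &
            forall z, S z ->
              (2 - sigma) * lambda * (r * s) `^ (- n.+1%:R - sigma) <=
              K a b p z].

End domains.

Section operators.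
Context {R : realType} {n : nat}.
Local Notation V := 'rV[R]_n.+1.
Implicit Types (u phi : V -> R) (x z : V) (sigma : R).

Definition grad u x : V := \row_i 'D_(delta_mx ord0 i) u x.

(* C^2 stands for C^{1,1}: first partial derivatives locally Lipschitz. *)
Definition C2b phi :=
  [bounded phi x | x in setT] /\
  forall i : 'I_n.+1,
    (forall x, derivable phi x (delta_mx ord0 i)) /\
    (forall x, exists2 U : set V, nbhs x U &
       [lipschitz 'D_(delta_mx ord0 i) phi y | y in U]).

Definition increment sigma u x z : R :=
  if sigma < 1 then u (x + z) - u x
  else if sigma == 1 then
    u (x + z) - u x - \1_(eball (0 : V) 1) z * dotp (grad u x) z
  else u (x + z) - u x - dotp (grad u x) z.

Definition nonlocal sigma (k : V -> R) u x : \bar R :=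
  (\int[lebesgue_rV R n]_z (increment sigma u x z * k z)%:E)%E.

(* Extended real values make the sup and inf total; under the hypotheses of the
   theorem they are finite for phi in C2b. *)
Definition isaacs sigma {A B : Type} (K : A -> B -> V -> V -> R)
    (b : A -> B -> V -> V) (c f : A -> B -> V -> R)
    x (r : R) phi : \bar R :=
  ereal_sup [set ereal_inf [set
    (- nonlocal sigma (K i j x) phi x +
     (dotp (b i j x) (grad phi x) + c i j x * r + f i j x)%:E)%E
    | j in [set: B]] | i in [set: A]].

End operators.

Section viscosity.
Context {R : realType} {n : nat}.
Local Notation V := 'rV[R]_n.+1.
Variables (F : V -> R -> (V -> R) -> \bar R) (Omega : set V) (g : V -> R).
Implicit Types (u phi : V -> R) (x : V).

Definition viscosity_subsolution u :=
  [/\ [bounded u x | x in setT],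
      lower_semicontinuous (fun x => (- u x)%:E) &
      forall phi x, C2b phi -> Omega x ->
        (forall y, u y - phi y <= u x - phi x) -> (F x (u x) phi <= 0)%E].

Definition viscosity_supersolution u :=
  [/\ [bounded u x | x in setT],
      lower_semicontinuous (fun x => (u x)%:E) &
      forall phi x, C2b phi -> Omega x ->
        (forall y, u x - phi x <= u y - phi y) -> (0 <= F x (u x) phi)%E].

Definition dirichlet_subsolution u :=
  viscosity_subsolution u /\ forall x, ~ Omega x -> u x <= g x.

Definition dirichlet_supersolution u :=
  viscosity_supersolution u /\ forall x, ~ Omega x -> g x <= u x.

Definition usc_envelope u x : R := lim (sup (u @` ecball x r) @[r --> 0^'+]).

Definition lsc_envelope u x : R := lim (inf (u @` ecball x r) @[r --> 0^'+]).

Definition discontinuous_viscosity_solution u :=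
  [/\ [bounded u x | x in setT],
      dirichlet_subsolution (usc_envelope u) &
      dirichlet_supersolution (lsc_envelope u)].

End viscosity.

(* Main.v *)
(* Perron's method without a comparison principle. Let u be the supremum of the
   subsolutions lying below every continuous supersolution that dominates g.
   Then u^* is again such a subsolution, and if u_* failed to be a
   supersolution at a point, lifting a test function there would give a larger
   competitor. Both envelopes take the boundary values as soon as every point x
   outside Omega has, for each e > 0, a continuous supersolution w >= g with
   w x <= g x + e, and symmetrically from below.
   For x in the boundary, w is the minimum of a constant and
     g x + e + N * bump + M * P,   P y = ((|y - c| / r - 1)^+)^a,
   c being the centre of the exterior ball of radius r at x. At a point y at
   distance d from that ball the nonlocal operator applied to P is at most
   P y * d^(-sigma) * (O(a) - G), where G > 0 comes from the kernel mass that
   boundary nondegeneracy places behind y, where P <= P y / 2. The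
   O(a) part comes from the upper bounds through the weights
   (|z|/d)^p for |z| < d and (|z|/d)^q for |z| >= d, with p > sigma > q; for
   sigma = 1 the gradient term on the shell d <= |z| < 1 is handled by the
   vanishing first moments of the kernel on dyadic annuli. Choose a small, then
   M large. *)
Require Import Defs.
From HB Require Import structures.
From mathcomp Require Import all_boot all_order all_algebra.
From mathcomp Require Import all_classical all_reals all_analysis.
From mathcomp Require Import measurable_realfun.
From mathcomp Require Import ring lra.

Set Implicit Arguments.
Unset Strict Implicit.
Unset Printing Implicit Defensive.

Import Order.TTheory GRing.Theory Num.Theory.
Import numFieldNormedType.Exports.

Local Open Scope classical_set_scope.
Local Open Scope ring_scope.

(** * Lebesgue measure *)

(** Domination by barriers is imposed through continuous functions because a continuous upper bound
    passes to the upper envelope. The price is that a lifted competitor must again lie below every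
    barrier. It does, since a barrier coming too close to the lower envelope at the bad point would
    itself touch a perturbed test function where the operator is negative. The argument runs for an
    abstract sup-inf of a real family [X i j] with a modulus uniform in the indices; this modulus
    comes from the uniform continuity of the kernels away from 0 and infinity, the remaining ranges
    being small by the weights. Each barrier satisfies its inequality for every pair of indices
    separately. Hence lower barriers arise from upper ones by changing the signs of [f] and [g],
    although this exchanges sup and inf. A test function touches a barrier from one side only, so
    its gradient has to be recovered from a one-sided quadratic bound. Finally, the measure is
    defined through covers, so the lower volume bound for balls, which turns nondegeneracy into
    kernel mass, has to be proved from boxes. *)

Section lebesgue_boxes.
Context {R : realType}.

(* Integrating the hypothesis in the last coordinate turns a weighted cover of
   an (m+1)-dimensional cube into a weighted cover of an m-dimensional one. *)
Lemma weighted_cover_volume (t : R) (m : nat) (a : R) (w : nat -> R)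
    (lo up : nat -> nat -> R) : 0 <= t -> 0 <= a -> (forall k, 0 <= w k) ->
  (forall k i, lo k i <= up k i) ->
  (forall z : nat -> R, (forall i, (i < m)%N -> 0 <= z i < t) ->
    (a%:E <= \sum_(k <oo)
      (w k * \prod_(i < m) (lo k i <= z i < up k i)%R%:R)%:E)%E) ->
  ((a * t ^+ m)%:E <= \sum_(k <oo)
      (w k * \prod_(i < m) (up k i - lo k i))%:E)%E.
Proof.
move=> t0; elim: m a w => [|m IH] a w a0 w0 lu h.
  have := h (fun=> 0) (fun i i0 => False_ind _ (notF i0)).
  rewrite expr0 mulr1 => /le_trans; apply; apply: lee_nneseries => k.
    by move=> _; rewrite big_ord0 mulr1 lee_fin.
  by move=> _; rewrite !big_ord0.
rewrite exprS mulrA.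
apply: (le_trans (IH (a * t) (fun k => w k * (up k m - lo k m)) _ _ _ _)).
- exact: mulr_ge0.
- by move=> k; rewrite mulr_ge0// subr_ge0.
- by [].
- move=> z zt.
  pose zz (s : R) (i : nat) := if (i == m)%N then s else z i.
  pose P k : R := w k * \prod_(i < m) (lo k i <= z i < up k i)%R%:R.
  have P0 k : 0 <= P k by rewrite mulr_ge0// prodr_ge0.
  have hs (s : R) : 0 <= s < t -> (a%:E <= \sum_(k <oo)
      (P k * \1_(`[lo k m, up k m[%classic) s)%:E)%E.
    move=> st; have {h} := h (zz s).
    rewrite (_ : (\sum_(k <oo) _)%E = (\sum_(k <oo)
      (P k * \1_(`[lo k m, up k m[%classic) s)%:E)%E); last first.
      apply: eq_eseriesr => k _; congr EFin; rewrite /P -mulrA; congr (_ * _).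
      rewrite big_ord_recr/= /zz eqxx; congr (_ * _); last first.
        by rewrite indicE mem_setE in_itv.
      by apply: eq_bigr => i _; rewrite ltn_eqF.
    apply=> i; rewrite ltnS leq_eqVlt /zz; case: eqP => // _ /=; exact: zt.
  have -> : ((a * t)%:E = \int[lebesgue_measure]_(s in [set` `[0%R, t[%R]) a%:E)%E.
    rewrite integral_cst//= lebesgue_measure_itv/= lte_fin.
    case: ltgtP t0 => //= [t0 _|<- _]; last by rewrite mule0 mulr0.
    by rewrite oppr0 adde0 EFinM.
  apply: (@le_trans _ _ (\int[lebesgue_measure]_(s in [set` `[0%R, t[%R])
     \sum_(k <oo) (P k * \1_(`[lo k m, up k m[%classic) s)%:E)%E).
    apply: ge0_le_integral => //.
    - apply: ge0_emeasurable_sum => k.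
        by move=> x _ _; rewrite lee_fin mulr_ge0.
      move=> _; apply/measurable_EFinP; apply: measurable_funM => //.
  rewrite integral_nneseries//.
  - apply: lee_nneseries => k.
      by move=> _ _; apply: integral_ge0 => x _; rewrite lee_fin mulr_ge0.
    move=> _; under eq_integral do rewrite EFinM.
    rewrite ge0_integralZl_EFin//; last first.
      by apply/measurable_EFinP.
    rewrite integral_indic// -mulrA (mulrC (up k m - _)) mulrA -/(P k).
    rewrite [leRHS]EFinM; apply: lee_wpmul2l; first by rewrite lee_fin.
    apply: (@le_trans _ _ (lebesgue_measure `[lo k m, up k m[%classic)).
      by apply: le_measure; rewrite ?inE//; apply: measurableI.
    rewrite lebesgue_measure_itv/= lte_fin; case: ltP => //.
    by move=> _; rewrite lee_fin subr_ge0.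
  - by move=> k; apply/measurable_EFinP; apply: measurable_funM.
  - by move=> k x _; rewrite lee_fin mulr_ge0.
- apply: lee_nneseries => k.
    move=> _ _; rewrite lee_fin !mulr_ge0// ?prodr_ge0 ?subr_ge0//.
    by move=> i _; rewrite subr_ge0.
  by move=> _; rewrite big_ord_recr/= lee_fin -mulrA (mulrC (up k m - _)).
Qed.

Context {n : nat}.
Local Notation V := 'rV[R]_n.+1.
Local Notation L := (lebesgue_space R n).

(** The indicators of a cover sum to at least 1 on the cube, so [weighted_cover_volume] with unit
    weights bounds the total volume of any cover from below. *)
Lemma lebesgue_outer_cube (t : R) : 0 <= t ->
  ((t ^+ n.+1)%:E <= lebesgue_outer (box (0%R : V, const_mx t : V)))%E.
Proof.
move=> t0; apply: le_ereal_inf_tmp => _ [F [F0 XF] <-].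
pose e (p : V) (i : nat) := p ord0 (inord i).
have := @weighted_cover_volume t n.+1 1 (fun=> 1)
  (fun k => e (F k).1) (fun k => e (F k).2) t0 ler01 (fun=> ler01)
  (fun k i => F0 k (inord i)).
rewrite mul1r => /(_ _)/le_trans; apply.
  move=> z zt; pose p : V := \row_i z i.
  have [|k _ Fkp] := XF p.
    by move=> i /=; rewrite !mxE; apply: zt.
  apply: (@le_trans _ _ (\sum_(0 <= j < k.+1)
      (1 * \prod_(i < n.+1) (e (F j).1 i <= z i < e (F j).2 i)%R%:R)%:E)%E).
    rewrite big_nat_recr//=; apply: lee_paddl.
      by apply: sume_ge0 => j _; rewrite lee_fin mul1r prodr_ge0.
    rewrite lee_fin mul1r big1// => i _.
    by have := Fkp i; rewrite /p mxE /e inord_val => ->.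
  by apply: nneseries_lim_ge => j _ _; rewrite lee_fin mul1r prodr_ge0.
apply: lee_nneseries => k.
  move=> _; rewrite lee_fin mul1r prodr_ge0// => i _.
  by rewrite subr_ge0; exact: F0.
move=> _; rewrite lee_fin mul1r /box_volume le_eqVlt; apply/orP; left.
by apply/eqP; apply: eq_bigr => i _; rewrite /e inord_val.
Qed.

Lemma lebesgue_outer_box_le (p : V * V) : (forall i, p.1 ord0 i <= p.2 ord0 i) ->
  (lebesgue_outer (box p) <= (box_volume p)%:E)%E.
Proof.
move=> p12; apply: ereal_inf_lbound.
pose F k : V * V := if (k == 0)%N then p else (0, 0).
exists F.
  split=> [k i|x xp]; first by rewrite /F; case: ifP.
  by exists 0%N.
rewrite (nneseries_split 0%N 1%N)//.
  rewrite add0n big_nat1 eseries0 ?adde0// => k k0 _.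
  by rewrite /F gtn_eqF// /box_volume big_ord_recl/= mxE subrr mul0r.
move=> k _; rewrite lee_fin /F; case: ifP => _; apply: prodr_ge0 => i _.
  by rewrite subr_ge0.
by rewrite !mxE subrr.
Qed.

(* Cutting a box by a coordinate hyperplane splits its volume exactly. *)
Lemma measurable_coord_lt (j : 'I_n.+1) (a : R) :
  measurable ([set z : V | z ord0 j < a] : set L).
Proof.
apply: le_caratheodory_measurable => X.
apply: le_ereal_inf_tmp => _ [F [F0 XF] <-].
(* [m k] is [a] clamped to the [j]-th side of the box, so both pieces are boxes with ordered
   corners, one of them possibly empty. *)
pose m k := Order.min ((F k).2 ord0 j) (Order.max ((F k).1 ord0 j) a).
pose F1 k : V * V :=
  ((F k).1, \row_i (if i == j then m k else (F k).2 ord0 i)).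
pose F2 k : V * V :=
  (\row_i (if i == j then m k else (F k).1 ord0 i), (F k).2).
have m1 k : (F k).1 ord0 j <= m k by rewrite le_min F0 le_max lexx.
have m2 k : m k <= (F k).2 ord0 j by rewrite ge_min lexx.
have F10 k i : (F1 k).1 ord0 i <= (F1 k).2 ord0 i.
  by rewrite /= mxE; case: eqP => [->|_].
have F20 k i : (F2 k).1 ord0 i <= (F2 k).2 ord0 i.
  by rewrite /= mxE; case: eqP => [->|_].
have vol0 (p : V * V) : (forall i, p.1 ord0 i <= p.2 ord0 i) -> 0 <= box_volume p.
  by move=> h; apply: prodr_ge0 => i _; rewrite subr_ge0.
have -> : (\sum_(k <oo) (box_volume (F k))%:E = \sum_(k <oo)
    (box_volume (F1 k))%:E + \sum_(k <oo) (box_volume (F2 k))%:E)%E.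
  rewrite -nneseriesD; [|by move=> k _ _; rewrite lee_fin vol0..].
  apply: eq_eseriesr => k _; rewrite -EFinD; congr EFin.
  rewrite /box_volume (bigD1 j)// [X in _ = X + _](bigD1 j)//= [X in _ = _ + X](bigD1 j)//=.
  rewrite !mxE eqxx.
  pose G i := (F k).2 ord0 i - (F k).1 ord0 i.
  rewrite [X in _ = _ * X + _](eq_bigr G); last first.
    by move=> i /negbTE ij; rewrite mxE ij.
  rewrite [X in _ = _ + _ * X](eq_bigr G); last first.
    by move=> i /negbTE ij; rewrite mxE ij.
  by rewrite -mulrDl; congr (_ * _); ring.
apply: leeD; apply: ereal_inf_lbound.
- exists F1 => //; split=> // z [Xz /= za]; have [k _ Fz] := XF _ Xz.
  exists k => // i; rewrite /= mxE; case: eqP => [->|_]; last exact: Fz.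
  by have /andP[h1 h2] := Fz j; rewrite h1 lt_min h2 lt_max za orbT.
- exists F2 => //; split=> // z [Xz /= /negP]; rewrite -leNgt => za.
  have [k _ Fz] := XF _ Xz.
  exists k => // i; rewrite /= mxE; case: eqP => [->|_]; last exact: Fz.
  by have /andP[h1 h2] := Fz j; rewrite h2 ge_min ge_max h1 za orbT.
Qed.

(** A sup-norm ball is a finite intersection of slabs; the strict lower inequality is a countable
    union over [k] of complements of the half-spaces of [measurable_coord_lt]. *)
Lemma measurable_ball (x : V) (e : R) : measurable (ball x e : set L).
Proof.
have [e0|e0] := ltP 0 e; last first.
  suff -> : ball x e = set0 by exact: measurable0.
  by apply/seteqP; split=> // z [/lt_geF]; rewrite e0.
have -> : ball x e = \bigcap_(i in [set: 'I_n.+1])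
  ([set z : V | z ord0 i < x ord0 i + e] `&`
   \bigcup_k ~` [set z : V | z ord0 i < x ord0 i - e + k.+1%:R^-1]).
  apply/seteqP; split=> [z|z].
    move=> [_ xz] i _/=.
    have := xz ord0 i; rewrite /ball/= ltr_distlC => /andP[h1 h2].
    split => //; have /= d0 : 0 < z ord0 i - (x ord0 i - e) by lra.
    exists (Num.truncn (z ord0 i - (x ord0 i - e))^-1) => //=.
    apply/negP; rewrite -leNgt.
    have : (Num.truncn (z ord0 i - (x ord0 i - e))^-1).+1%:R^-1 <=
           z ord0 i - (x ord0 i - e).
      rewrite invf_ple ?posrE//; apply/ltW.
      exact: truncnS_gt.
    by rewrite lerBrDl.
  move=> h; split=> // i j; rewrite (ord1 i).
  have [h1 [k _ /= /negP]] := h j I.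
  rewrite -leNgt => h2; rewrite /ball/= ltr_distlC h1 andbT.
  by apply: lt_le_trans h2; rewrite ltrDl.
apply: (@fin_bigcap_measurable _ L) => // i _.
apply: (@measurableI _ L); first exact: measurable_coord_lt.
apply: (@bigcupT_measurable _ L) => k; apply: (@measurableC _ L).
exact: measurable_coord_lt.
Qed.

(** Among the countably many balls with rational centres and radii [1/(k+1)], those contained in [U]
    already cover it. *)
Lemma measurable_open (U : set V) : open U -> measurable (U : set L).
Proof.
move=> oU.
pose q (p : 'rV[rat]_n.+1) : V := map_mx ratr p.
pose B (pk : 'rV[rat]_n.+1 * nat) : set L :=
  if `[< ball (q pk.1) (pk.2.+1%:R^-1) `<=` U >] then
    ball (q pk.1) (pk.2.+1%:R^-1) else set0.
have -> : U = \bigcup_pk B pk; last first.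
  apply: countable_bigcupT_measurable => // pk; rewrite /B.
  by case: ifP => _; [exact: measurable_ball|exact: measurable0].
apply/seteqP; split=> [z Uz|z [pk _]]; last first.
  by rewrite /B; case: asboolP => [h|//] /h.
have /nbhs_ballP[e /= e0 eU] := open_nbhs_nbhs (conj oU Uz).
pose k := Num.truncn (2 / e).
have ke : k.+1%:R^-1 < e / 2.
  rewrite invf_plt ?posrE//; last by rewrite divr_gt0.
  by rewrite invf_div; exact: truncnS_gt.
have k0 : 0 < k.+1%:R^-1 :> R by [].
have [p pz] : {p : 'rV[rat]_n.+1 & forall i, `|z ord0 i - ratr (p ord0 i)| < k.+1%:R^-1}.
  have h i : {s : rat | `|z ord0 i - ratr s| < k.+1%:R^-1}.
    apply: cid; have [|s] := @rat_in_itvoo R (z ord0 i - k.+1%:R^-1) (z ord0 i + k.+1%:R^-1).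
      by rewrite ltrBlDr -addrA ltrDl addr_gt0.
    by rewrite in_itv/= => hs; exists s; rewrite distrC ltr_distl.
  exists (\row_i (projT1 (h i))) => i; rewrite mxE; exact: (projT2 (h i)).
have zp : ball (q p) k.+1%:R^-1 z.
  split=> // i j; rewrite (ord1 i) /q mxE.
  by rewrite /ball/= distrC.
exists (p, k) => //; rewrite /B/=; case: asboolP => //= -[] w pw.
apply: eU; apply: (@le_ball _ _ _ (k.+1%:R^-1 + k.+1%:R^-1)).
  by rewrite [leRHS]splitr lerD// ltW.
exact: ball_triangle (ball_sym zp) pw.
Qed.

Lemma continuous_measurable_rV (h : V -> R) : continuous h ->
  measurable_fun [set: L] h.
Proof.
move=> ch; apply: (measurability _ (RGenOpens.measurableE R)).
move=> _ [_ [a [b ->] <-]]; rewrite setTI; apply: measurable_open.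
by move/continuousP : ch; apply; exact: interval_open.
Qed.

End lebesgue_boxes.

(** * Euclidean norm and its comparison with the sup norm *)

Section euclidean_norm.
Context {R : realType} {n : nat}.
Local Notation V := 'rV[R]_n.+1.
Implicit Types (x y z : V) (a : R).

Lemma dotpC x y : dotp x y = dotp y x.
Proof. by apply: eq_bigr => i _; rewrite mulrC. Qed.

Lemma dotpDl x y z : dotp (x + y) z = dotp x z + dotp y z.
Proof. by rewrite -big_split; apply: eq_bigr => i _; rewrite mxE mulrDl. Qed.

Lemma dotpZl a x y : dotp (a *: x) y = a * dotp x y.
Proof. by rewrite /dotp mulr_sumr; apply: eq_bigr => i _; rewrite mxE mulrA. Qed.

Lemma dotpDr x y z : dotp z (x + y) = dotp z x + dotp z y.
Proof. by rewrite dotpC dotpDl !(dotpC z). Qed.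

Lemma dotpZr a x y : dotp y (a *: x) = a * dotp y x.
Proof. by rewrite dotpC dotpZl dotpC. Qed.

Lemma dotp0l x : dotp 0 x = 0.
Proof. by rewrite -(scale0r 0) dotpZl mul0r. Qed.

Lemma dotpNl x y : dotp (- x) y = - dotp x y.
Proof. by rewrite -scaleN1r dotpZl mulN1r. Qed.

Lemma dotpBl x y z : dotp (x - y) z = dotp x z - dotp y z.
Proof. by rewrite dotpDl dotpNl. Qed.

Lemma dotpNr x y : dotp y (- x) = - dotp y x.
Proof. by rewrite dotpC dotpNl dotpC. Qed.

Lemma dotpBr x y z : dotp z (x - y) = dotp z x - dotp z y.
Proof. by rewrite dotpDr dotpNr. Qed.

Lemma dotp_ge0 x : 0 <= dotp x x.
Proof. by apply: sumr_ge0 => i _; rewrite -expr2 sqr_ge0. Qed.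

Lemma enorm_ge0 x : 0 <= enorm x.
Proof. exact: sqrtr_ge0. Qed.
Hint Resolve enorm_ge0 : core.

Lemma sqr_enorm x : enorm x ^+ 2 = dotp x x.
Proof. by rewrite sqr_sqrtr// dotp_ge0. Qed.

Lemma enormZ a x : enorm (a *: x) = `|a| * enorm x.
Proof.
by rewrite /enorm dotpZl dotpZr mulrA -expr2 sqrtrM ?sqr_ge0// sqrtr_sqr.
Qed.

Lemma enormN x : enorm (- x) = enorm x.
Proof. by rewrite -scaleN1r enormZ normrN1 mul1r. Qed.

Lemma enorm0 : enorm (0 : V) = 0.
Proof. by rewrite -(scale0r 0) enormZ normr0 mul0r. Qed.

Lemma coord_le_enorm x i : `|x ord0 i| <= enorm x.
Proof.
rewrite -ler_sqr ?nnegrE// sqr_enorm real_normK ?num_real//.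
rewrite /dotp (bigD1 i)//= -expr2 lerDl.
by apply: sumr_ge0 => j _; rewrite -expr2 sqr_ge0.
Qed.

Lemma enorm_eq0 x : enorm x = 0 -> x = 0.
Proof.
move=> x0; apply/rowP => i; rewrite mxE; apply/eqP; rewrite -normr_le0.
by rewrite -x0 coord_le_enorm.
Qed.

(** Cauchy-Schwarz, from the nonnegative square of [|y|^2 x - (x.y) y]. *)
Lemma dotp_le x y : dotp x y <= enorm x * enorm y.
Proof.
have [->|y0] := eqVneq y 0; first by rewrite dotpC dotp0l enorm0 mulr0.
have ey0 : 0 < enorm y.
  by rewrite lt_neqAle enorm_ge0 andbT eq_sym; apply: contra y0 => /eqP/enorm_eq0->.
have /= := dotp_ge0 (enorm y ^+ 2 *: x + (- dotp x y) *: y).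
rewrite !(dotpDl, dotpDr, dotpZl, dotpZr) -!sqr_enorm (dotpC y x) => h.
have {}h : 0 <= enorm y ^+ 2 * (enorm x ^+ 2 * enorm y ^+ 2 - dotp x y ^+ 2).
  by apply: le_trans h _; rewrite le_eqVlt; apply/orP; left; apply/eqP; ring.
have [xy0|xy0] := leP (dotp x y) 0; first by rewrite (le_trans xy0)// mulr_ge0.
rewrite -ler_sqr ?nnegrE ?mulr_ge0 ?(ltW xy0)//.
by move: h; rewrite pmulr_rge0 ?exprn_gt0// subr_ge0 exprMn.
Qed.

Lemma normr_dotp x y : `|dotp x y| <= enorm x * enorm y.
Proof.
rewrite ler_norml dotp_le andbT lerNl -(enormN x).
by rewrite -dotpNl dotp_le.
Qed.

Lemma sqr_enormD x y :
  enorm (x + y) ^+ 2 = enorm x ^+ 2 + dotp x y *+ 2 + enorm y ^+ 2.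
Proof. by rewrite !sqr_enorm !(dotpDl, dotpDr) (dotpC y x); ring. Qed.

Lemma enormD x y : enorm (x + y) <= enorm x + enorm y.
Proof.
rewrite -ler_sqr ?nnegrE ?addr_ge0// sqr_enormD sqrrD lerD2r lerD2l lerMn2r.
by rewrite dotp_le orbT.
Qed.

Lemma enorm_sub x y : enorm x - enorm y <= enorm (x - y).
Proof. by rewrite lerBlDr (le_trans _ (enormD _ _))// subrK. Qed.

Lemma coord_le_norm x i : `|x ord0 i| <= `|x|.
Proof.
rewrite [leRHS]mx_normrE.
exact: (le_bigmax_cond _ (fun ij : 'I_1 * 'I_n.+1 => `|x ij.1 ij.2|)
  (j := (ord0, i))).
Qed.

Lemma norm_le_enorm x : `|x| <= enorm x.
Proof.
rewrite [leLHS]mx_normrE; apply: bigmax_le => //= -[i j] _ /=.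
by rewrite (ord1 i) coord_le_enorm.
Qed.

Lemma enorm_le_norm x : enorm x <= n.+1%:R * `|x|.
Proof.
rewrite -ler_sqr ?nnegrE ?mulr_ge0// sqr_enorm /dotp.
apply: (@le_trans _ _ (\sum_(i < n.+1) `|x| ^+ 2)).
  apply: ler_sum => i _; rewrite -expr2 -real_normK ?num_real//.
  by rewrite lerXn2r ?nnegrE// coord_le_norm.
rewrite [leLHS]sumr_const card_ord exprMn -[leLHS]mulr_natl ler_wpM2r ?sqr_ge0//.
by rewrite -natrX ler_nat leq_pmulr.
Qed.

Lemma nbhs_rVP x (P : set V) :
  nbhs x P <-> exists2 e : R, 0 < e & forall z, `|z - x| < e -> P z.
Proof.
split=> [/nbhs_ballP[e /= e0 eP]|[e e0 eP]].
  by exists e => // z zx; apply: eP; rewrite mx_norm_ball /ball_/= distrC.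
apply/nbhs_ballP; exists e => //= z.
by rewrite mx_norm_ball /ball_/= distrC; exact: eP.
Qed.

Lemma continuous_rVP (h : V -> R) : continuous h <->
  forall x (e : R), 0 < e ->
    exists2 r : R, 0 < r & forall z, `|z - x| < r -> `|h z - h x| < e.
Proof.
split=> [ch x e e0|ch x].
  apply/nbhs_rVP; have /(@cvgrPdist_lt _ _ _ _ (@nbhs_filter V x)) := ch x.
  by move=> /(_ e e0) /nbhs_rVP[r r0 rh]; apply/nbhs_rVP; exists r => // z /rh;
    rewrite distrC.
apply/(@cvgrPdist_lt _ _ _ _ (@nbhs_filter V x)) => e /(ch x)[r r0 rh].
by apply/nbhs_rVP; exists r => // z /rh; rewrite distrC.
Qed.

Lemma lipschitz_at_continuous (h : V -> R) :
  (forall x, exists C e : R, 0 < e /\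
    forall z, `|z - x| < e -> `|h z - h x| <= C * `|z - x|) ->
  continuous h.
Proof.
move=> lh; apply/continuous_rVP => x d d0; have [C [e [e0 he]]] := lh x.
have C0 : 0 < `|C| + 1 by rewrite ltr_wpDl.
exists (Num.min e (d / (`|C| + 1))); first by rewrite lt_min e0 divr_gt0.
move=> z; rewrite lt_min => /andP[ze zd].
apply: le_lt_trans (he _ ze) _; rewrite mulrC.
apply: (@le_lt_trans _ _ (`|z - x| * (`|C| + 1))).
  by rewrite ler_wpM2l// ler_wpDr// ler_norm.
by rewrite -ltr_pdivlMr.
Qed.

Lemma enorm_lipschitz x z : `|enorm z - enorm x| <= n.+1%:R * `|z - x|.
Proof.
rewrite (le_trans _ (enorm_le_norm _))// ler_norml enorm_sub andbT lerNl opprB.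
by rewrite -(enormN (z - x)) opprB enorm_sub.
Qed.

Lemma continuous_enormB y : continuous (fun z => enorm (z - y)).
Proof.
apply: lipschitz_at_continuous => x; exists n.+1%:R, 1; split=> // z _.
by apply: le_trans (enorm_lipschitz _ _) _; rewrite opprD addrACA subrr addr0.
Qed.

Lemma continuous_enorm : continuous (@enorm R n).
Proof.
by rewrite (_ : enorm = fun z => enorm (z - 0)); [exact: continuous_enormB|
  apply/funext => z; rewrite subr0].
Qed.

Lemma open_eball x a : open (eball x a).
Proof.
have -> : eball x a = (fun z => enorm (z - x)) @^-1` `]-oo, a[%classic.
  by apply/seteqP; split=> z; rewrite /= in_itv.
apply: open_comp; last exact: interval_open.
by move=> z _; exact: continuous_enormB.
Qed.

Lemma continuous_dotp x : continuous (dotp x : V -> R).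
Proof.
apply: lipschitz_at_continuous => y; exists (enorm x * n.+1%:R), 1.
split=> // z _; rewrite -dotpBr.
apply: le_trans (normr_dotp _ _) _; rewrite -mulrA ler_wpM2l//.
exact: enorm_le_norm.
Qed.

End euclidean_norm.
#[global] Hint Resolve enorm_ge0 : core.

(** * Integration of weights against kernels *)

Section kernel_weights.
Context {R : realType} {n : nat}.
Variables (sigma Lambda : R).
Hypothesis s02 : 0 < sigma < 2.
Hypothesis Lambda0 : 0 < Lambda.
Local Notation V := 'rV[R]_n.+1.
Local Notation L := (lebesgue_space R n).
Local Notation mu := (lebesgue_rV R n).

(** The order at which the increment of a smooth function vanishes at [z = 0]: 1 when no gradient is
    subtracted, 2 otherwise. It exceeds [sigma] in both cases. *)
Definition near_exponent : R := if sigma < 1 then 1 else 2.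

(** Positive and below [sigma]. For [sigma > 1] it must also be at least 1, since the gradient term
    of the increment then grows linearly at infinity. *)
Definition far_exponent : R := if sigma <= 1 then sigma / 2 else (1 + sigma) / 2.

Definition rweight (t : R) : R :=
  if t < 1 then t `^ near_exponent else t `^ far_exponent.

(* Up to constants, the largest increment at scale d against which the upper
   bounds on the kernels make the singular integral converge. *)
Definition weight (d : R) (z : V) : R := rweight (enorm z / d).

(** The sums of two geometric series, over the dyadic annuli outside and inside the ball of radius
    [d]. On each annulus the weight is replaced by its value at the outer radius and the kernel mass
    is governed by the inner one, which produces the extra factors [2^q] and [2^sigma]. *)
Definition kernel_const : R :=
  (2 - sigma) * Lambda * 2 `^ far_exponent / (1 - 2 `^ (far_exponent - sigma)) +
  (2 - sigma) * Lambda * 2^-1 `^ (- sigma) / (1 - 2^-1 `^ (near_exponent - sigma)).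

Lemma sigma_gt0 : 0 < sigma.
Proof. by case/andP: s02. Qed.

Lemma sigma_lt2 : sigma < 2.
Proof. by case/andP: s02. Qed.

Lemma near_exponent_gt : sigma < near_exponent.
Proof. by rewrite /near_exponent; case: ifP => // _; exact: sigma_lt2. Qed.

Lemma near_exponent_gt0 : 0 < near_exponent.
Proof. exact: lt_trans sigma_gt0 near_exponent_gt. Qed.

Lemma far_exponent_gt0 : 0 < far_exponent.
Proof.
by rewrite /far_exponent; case: ifP => _; have := sigma_gt0; lra.
Qed.

Lemma far_exponent_lt : far_exponent < sigma.
Proof.
rewrite /far_exponent; case: (leP sigma 1) => h; have := sigma_gt0; lra.
Qed.

Lemma pow1R (x : R) : 1 `^ x = 1.
Proof. by rewrite powR1. Qed.

Lemma powR_lt1 (a x : R) : 0 < a < 1 -> 0 < x -> a `^ x < 1.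
Proof.
move=> /andP[a0 a1] x0; rewrite -[ltRHS](pow1R x) gt0_ltr_powR ?nnegrE//.
exact: ltW.
Qed.

Lemma powRX (a x : R) k : 0 <= a -> (a ^+ k) `^ x = (a `^ x) ^+ k.
Proof. by move=> a0; rewrite -[a ^+ k]powR_mulrn// powRAC powR_mulrn// powR_ge0. Qed.

Lemma far_ratio : 0 < (2 : R) `^ (far_exponent - sigma) < 1.
Proof.
rewrite powR_gt0//= -opprB powRN invf_lt1 ?powR_gt0//.
rewrite -[ltLHS](pow1R (sigma - far_exponent)) gt0_ltr_powR ?nnegrE ?ltr1n//.
by rewrite subr_gt0 far_exponent_lt.
Qed.

Lemma near_ratio : 0 < (2^-1 : R) `^ (near_exponent - sigma) < 1.
Proof.
rewrite powR_gt0//= powR_lt1 ?subr_gt0 ?near_exponent_gt// invr_gt0 ltr0n/=.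
by rewrite invf_lt1// ltr1n.
Qed.

Lemma kernel_const_gt0 : 0 < kernel_const.
Proof.
have s2 : 0 < (2 - sigma) * Lambda by rewrite mulr_gt0// subr_gt0 sigma_lt2.
have /andP[_ h1] := far_ratio; have /andP[_ h2] := near_ratio.
by apply: addr_gt0; apply: divr_gt0; rewrite ?subr_gt0//;
  apply: mulr_gt0 => //; apply: powR_gt0.
Qed.

Lemma rweight_ge0 t : 0 <= rweight t.
Proof. by rewrite /rweight; case: ifP => _; exact: powR_ge0. Qed.

Lemma weight_ge0 d z : 0 <= weight d z.
Proof. exact: rweight_ge0. Qed.

Lemma weight_ge1 d z : 0 < d -> d <= enorm z -> 1 <= weight d z.
Proof.
move=> d0 dz; have h : 1 <= enorm z / d by rewrite ler_pdivlMr// mul1r.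
by rewrite /weight /rweight ltNge h/= -[leLHS](powRr0 (enorm z / d)) ler_powR// ltW ?far_exponent_gt0.
Qed.

Lemma weight_near d z : 0 < d -> enorm z < d ->
  weight d z = enorm z `^ near_exponent * d `^ (- near_exponent).
Proof.
move=> d0 dz; rewrite /weight /rweight ltr_pdivrMr// mul1r dz.
by rewrite powRM ?invr_ge0 ?(ltW d0)// -powR_inv1 ?(ltW d0)// -powRrM mulN1r.
Qed.

Lemma weight_far d z : 0 < d -> d <= enorm z ->
  weight d z = enorm z `^ far_exponent * d `^ (- far_exponent).
Proof.
move=> d0 dz; rewrite /weight /rweight ltr_pdivrMr// mul1r ltNge dz/=.
by rewrite powRM ?invr_ge0 ?(ltW d0)// -powR_inv1 ?(ltW d0)// -powRrM mulN1r.
Qed.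

Lemma measurable_weight d : measurable_fun [set: L] (weight d).
Proof.
apply: (@measurableT_comp _ _ _ _ _ _ rweight _ (fun z : L => enorm (z : V) / d)).
  apply: measurable_fun_ifT; [|exact: measurable_powR|exact: measurable_powR].
  by apply: measurable_fun_ltr; [exact: measurable_id|exact: measurable_cst].
apply: measurable_funM; last exact: measurable_cst.
by apply: continuous_measurable_rV; exact: continuous_enorm.
Qed.

Lemma measurable_annulus d : measurable (annulus d : set L).
Proof. by apply: measurableD; apply: measurable_open; exact: open_eball. Qed.

Lemma dyadic_far (t : R) : 1 <= t -> exists k, 2 ^+ k <= t < 2 ^+ k.+1.
Proof.
move=> t1; have h : exists k, t < 2 ^+ k.+1.
  exists (Num.truncn t).+1; apply: lt_trans (truncnS_gt t) _.
  by rewrite -natrX ltr_nat (ltn_trans (ltn_expl _ (ltnSn 1)))// ltn_exp2l.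
have := ex_minnP h; case=> k tk kmin; exists k; rewrite tk andbT.
case: k tk kmin => [|k] _ kmin; first by rewrite expr0.
by rewrite leNgt; apply/negP => /kmin; rewrite ltnn.
Qed.

Lemma dyadic_near (t : R) : 0 < t < 1 -> exists k, 2^-1 ^+ k.+1 <= t < 2^-1 ^+ k.
Proof.
move=> /andP[t0 t1]; have h : exists k, 2^-1 ^+ k.+1 <= t.
  have [|k /andP[_ tk]] := @dyadic_far t^-1.
    by rewrite invf_ge1// ltW.
  by exists k; rewrite exprVn invf_ple ?posrE ?exprn_gt0// ltW.
have := ex_minnP h; case=> k tk kmin; exists k; rewrite tk/=.
case: k tk kmin => [|k] _ kmin; first by rewrite expr0.
by rewrite ltNge; apply/negP => /kmin; rewrite ltnn.
Qed.

Lemma nneseries_geometric_le (c q : R) : 0 <= c -> 0 < q < 1 ->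
  (\sum_(k <oo) (c * q ^+ k)%:E <= (c / (1 - q))%:E)%E.
Proof.
move=> c0 /andP[q0 q1]; apply: lime_le.
  by apply: is_cvg_nneseries => k _ _; rewrite lee_fin mulr_ge0// exprn_ge0// ltW.
apply: nearW => m; rewrite sumEFin lee_fin.
by apply: geometric_le_lim => //; rewrite ger0_norm// ltW.
Qed.

Lemma nneseries_ge_term (u : nat -> \bar R) k : (forall j, (0 <= u j)%E) ->
  (u k <= \sum_(j <oo) u j)%E.
Proof.
move=> u0; apply: le_trans (nneseries_lim_ge k.+1 _) => //.
by rewrite big_nat_recr//=; apply: lee_paddl => //; exact: sume_ge0.
Qed.

Lemma nneseries_geometric_dom (c q : R) (u : nat -> \bar R) :
  0 < q < 1 -> 0 <= c -> (forall j, (0 <= u j)%E) ->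
  (forall j, (u j <= (c * q ^+ j)%:E)%E) ->
  (\sum_(j <oo) u j <= (c / (1 - q))%:E)%E.
Proof.
move=> q01 c0 u0 uq; apply: le_trans (nneseries_geometric_le c0 q01).
by apply: lee_nneseries.
Qed.

Let far_term d k (z : V) : \bar R :=
  (\1_(annulus (2 ^+ k * d)) z * (2 `^ far_exponent) ^+ k.+1)%:E.
Let near_term d k (z : V) : \bar R :=
  (\1_(annulus (2^-1 ^+ k.+1 * d)) z * (2^-1 `^ near_exponent) ^+ k)%:E.

Let far_term_ge0 d k z : (0 <= far_term d k z)%E.
Proof. by rewrite lee_fin mulr_ge0// exprn_ge0// powR_ge0. Qed.

Let near_term_ge0 d k z : (0 <= near_term d k z)%E.
Proof. by rewrite lee_fin mulr_ge0// exprn_ge0// powR_ge0. Qed.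

(** Every [z] other than 0 lies in one of the annuli, where the weight is at most its value at the
    outer radius; at [z = 0] the weight vanishes. *)
Let weight_le_dyadic d z : 0 < d ->
  ((weight d z)%:E <= \sum_(k <oo) far_term d k z + \sum_(k <oo) near_term d k z)%E.
Proof.
move=> d0.
have f0 : (0 <= \sum_(k <oo) far_term d k z)%E by apply: nneseries_ge0.
have n0 : (0 <= \sum_(k <oo) near_term d k z)%E by apply: nneseries_ge0.
have [z0|z0] := eqVneq (enorm z) 0.
  rewrite /weight z0 mul0r /rweight ltr01 powR0; first exact: adde_ge0.
  by rewrite gt_eqF// near_exponent_gt0.
have {}z0 : 0 < enorm z by rewrite lt_neqAle eq_sym z0 enorm_ge0.
have t0 : 0 < enorm z / d by rewrite divr_gt0.
have [t1|t1] := ltP (enorm z / d) 1.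
- have [|k /andP[k1 k2]] := @dyadic_near (enorm z / d); first by rewrite t0.
  apply: lee_paddl => //.
  apply: le_trans (nneseries_ge_term k (near_term_ge0 d ^~ z)).
  rewrite lee_fin indicE mem_set ?mul1r; last first.
    rewrite /annulus /eball; split => /=; rewrite subr0.
      by rewrite exprS !mulrA mulfV// mul1r -ltr_pdivrMr.
    by apply/negP; rewrite -leNgt -ler_pdivlMr.
  rewrite /weight /rweight t1 -powRX// ge0_ler_powR ?nnegrE ?(ltW t0) ?(ltW k2)//.
  exact: ltW near_exponent_gt0.
- have [k /andP[k1 k2]] := dyadic_far t1.
  apply: lee_paddr => //.
  apply: le_trans (nneseries_ge_term k (far_term_ge0 d ^~ z)).
  rewrite lee_fin indicE mem_set ?mul1r; last first.
    rewrite /annulus /eball; split => /=; rewrite subr0.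
      by rewrite mulrA -exprS -ltr_pdivrMr.
    by apply/negP; rewrite -leNgt -ler_pdivlMr.
  rewrite /weight /rweight ltNge t1/= -powRX//.
  rewrite ge0_ler_powR ?nnegrE ?(ltW t0) ?(ltW k2)//.
  exact: ltW far_exponent_gt0.
Qed.

Variable k : V -> R.
Hypothesis ubk : upper_bounds sigma Lambda k.

Lemma measurable_kernel : measurable_fun [set: L] k.
Proof. by case: ubk. Qed.

Lemma kernel_ge0 z : 0 <= k z.
Proof. by case: ubk => _ ->. Qed.

Let annulus_term (d c : R) : 0 < d -> 0 <= c ->
  (\int[mu]_z ((\1_(annulus d) z * c)%:E * (k z)%:E) <=
   (c * ((2 - sigma) * Lambda * d `^ (- sigma)))%:E)%E.
Proof.
move=> d0 c0; have [_ _ /(_ d d0) h _] := ubk.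
rewrite EFinM (le_trans _ (lee_wpmul2l _ h)) ?lee_fin// -ge0_integralZl_EFin//.
- rewrite [leRHS]integral_mkcond le_eqVlt; apply/orP; left; apply/eqP.
  apply: eq_integral => z _; rewrite patchE indicE.
  by case: (z \in _); rewrite ?mul1r// mul0r mul0e.
- exact: measurable_annulus.
- by move=> z _; rewrite lee_fin kernel_ge0.
- apply: measurable_funTS; apply/measurable_EFinP; exact: measurable_kernel.
Qed.

Let measurable_term d (c : R) : measurable_fun [set: L]
  (fun z => (\1_(annulus d) z * c)%:E * (k z)%:E)%E.
Proof.
under eq_fun do rewrite -EFinM; apply/measurable_EFinP.
apply: measurable_funM; last exact: measurable_kernel.
apply: measurable_funM; last exact: measurable_cst.
exact: measurable_indic (measurable_annulus d).
Qed.

(** Here the mass bound on annuli enters. The later integrability statements and upper estimates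
    compare an integrand with this weight, and the power [d^(-sigma)] is the scaling of the
    operator. *)
Lemma integral_weight_le d : 0 < d ->
  (\int[mu]_z (weight d z * k z)%:E <= (kernel_const * d `^ (- sigma))%:E)%E.
Proof.
move=> d0.
pose F j z := (far_term d j z * (k z)%:E)%E.
pose N j z := (near_term d j z * (k z)%:E)%E.
have F0 j z : (0 <= F j z)%E by rewrite mule_ge0// lee_fin kernel_ge0.
have N0 j z : (0 <= N j z)%E by rewrite mule_ge0// lee_fin kernel_ge0.
have mF j : measurable_fun [set: L] (F j) by exact: measurable_term.
have mN j : measurable_fun [set: L] (N j) by exact: measurable_term.
have mFs : measurable_fun [set: L] (fun z => \sum_(j <oo) F j z)%E.
  by apply: ge0_emeasurable_sum.
have mNs : measurable_fun [set: L] (fun z => \sum_(j <oo) N j z)%E.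
  by apply: ge0_emeasurable_sum.
apply: (@le_trans _ _
  (\int[mu]_z (\sum_(j <oo) F j z + \sum_(j <oo) N j z))%E).
  apply: ge0_le_integral; first exact: measurableT.
  - by move=> z _; rewrite lee_fin mulr_ge0 ?weight_ge0 ?kernel_ge0.
  - apply/measurable_EFinP; apply: measurable_funM; last exact: measurable_kernel.
    exact: measurable_weight.
  - exact: emeasurable_funD.
  - move=> z _; rewrite EFinM /F /N.
    under eq_eseriesr do rewrite muleC.
    rewrite nneseriesZl//.
    under [X in (_ + X)%E]eq_eseriesr do rewrite muleC.
    rewrite nneseriesZl// -ge0_muleDr ?nneseries_ge0// muleC lee_wpmul2l//.
      by rewrite lee_fin kernel_ge0.
    exact: weight_le_dyadic.
rewrite ge0_integralD//; [|by move=> z _; apply: nneseries_ge0..].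
rewrite !integral_nneseries// /kernel_const mulrDl EFinD.
apply: leeD.
- rewrite [X in (_ <= X%:E)%E]mulrAC; apply: (nneseries_geometric_dom far_ratio).
  + by rewrite !mulr_ge0 ?powR_ge0 ?(ltW Lambda0)// subr_ge0 ltW ?sigma_lt2.
  + by move=> j; apply: integral_ge0.
  + move=> j; rewrite (le_trans (annulus_term _ _))//.
    * by rewrite mulr_gt0// exprn_gt0.
    rewrite lee_fin powRM ?exprn_ge0 ?(ltW d0)// powRX// powRD ?pnatr_eq0 ?implybT//.
    by rewrite exprMn exprS le_eqVlt; apply/orP; left; apply/eqP; ring.
- rewrite [X in (_ <= X%:E)%E]mulrAC; apply: (nneseries_geometric_dom near_ratio).
  + by rewrite !mulr_ge0 ?powR_ge0 ?(ltW Lambda0)// subr_ge0 ltW ?sigma_lt2.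
  + by move=> j; apply: integral_ge0.
  + move=> j; rewrite (le_trans (annulus_term _ _))//.
    * by rewrite mulr_gt0// exprn_gt0// invr_gt0.
    rewrite lee_fin powRM ?exprn_ge0 ?invr_ge0 ?(ltW d0)// powRX ?invr_ge0//.
    rewrite powRD ?invr_eq0 ?pnatr_eq0 ?implybT//.
    by rewrite exprMn exprS le_eqVlt; apply/orP; left; apply/eqP; ring.
Qed.

Lemma integrable_weight d : 0 < d ->
  mu.-integrable [set: L] (EFin \o (fun z => weight d z * k z)).
Proof.
move=> d0; apply/integrableP; split.
  apply/measurable_EFinP; apply: measurable_funM; first exact: measurable_weight.
  exact: measurable_kernel.
rewrite (eq_integral (fun z : L => (weight d z * k z)%:E)); last first.
  by move=> z _; rewrite gee0_abs// lee_fin mulr_ge0 ?weight_ge0 ?kernel_ge0.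
by rewrite (le_lt_trans (integral_weight_le d0))// ltry.
Qed.

Lemma kernel_integrable (h : V -> R) (C d : R) : 0 < d ->
  measurable_fun [set: L] h -> (forall z, `|h z| <= C * weight d z) ->
  mu.-integrable [set: L] (EFin \o (fun z => h z * k z)).
Proof.
move=> d0 mh hC.
apply: (le_integrable measurableT _ _
  (integrableZl measurableT `|C| (integrable_weight d0))).
  by apply/measurable_EFinP; apply: measurable_funM => //; exact: measurable_kernel.
move=> z _; rewrite /= lee_fin normrM [leRHS]ger0_norm; last first.
  by rewrite !mulr_ge0 ?weight_ge0 ?kernel_ge0.
rewrite (ger0_norm (kernel_ge0 z)) mulrA ler_wpM2r ?kernel_ge0//.
by rewrite (le_trans (hC z))// ler_wpM2r ?weight_ge0// ler_norm.
Qed.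

Lemma kernel_Rintegral_le (h : V -> R) (C d : R) : 0 < d -> 0 <= C ->
  mu.-integrable [set: L] (EFin \o (fun z => h z * k z)) ->
  (forall z, h z <= C * weight d z) ->
  \int[mu]_z (h z * k z) <= C * (kernel_const * d `^ (- sigma)).
Proof.
move=> d0 C0 ih hC; have iw := integrable_weight d0.
apply: (@le_trans _ _ (\int[mu]_z (C * (weight d z * k z)))).
  apply: le_Rintegral => //; first exact: (integrableZl measurableT C iw).
  by move=> z _; rewrite mulrA ler_wpM2r ?kernel_ge0.
rewrite RintegralZl// ler_wpM2l// -lee_fin fineK ?integral_weight_le//.
exact: integrable_fin_num iw.
Qed.

End kernel_weights.

(** * Test functions *)

Section calculus.
Context {R : realType} {n : nat}.
Local Notation V := 'rV[R]_n.+1.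
Local Notation e_ i := (delta_mx ord0 i : V).
Implicit Types (phi : V -> R) (x y z p : V).

Lemma boundedP (T : Type) (u : T -> R) :
  [bounded u x | x in setT] <-> exists2 M, 0 < M & forall i, `|u i| <= M.
Proof.
split=> [/pinfty_ex_gt0[M M0 uM]|[M M0 uM]].
  by exists M => // x; exact: uM.
exists M; split; first exact: gtr0_real.
by move=> N MN x _ /=; rewrite (le_trans (uM x))// ltW.
Qed.

Lemma lipschitz_inP (U : set V) (u : V -> R) :
  [lipschitz u y | y in U] <->
  exists2 M, 0 < M & forall x y, U x -> U y -> `|u x - u y| <= M * `|x - y|.
Proof.
split=> [/pinfty_ex_gt0[M M0 uM]|[M M0 uM]].
  by exists M => // x y Ux Uy; exact: (uM (x, y)).
exists M; split; first exact: gtr0_real.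
move=> N MN [x y] [/= Ux Uy] /=; rewrite (le_trans (uM x y Ux Uy))//.
by rewrite ler_wpM2r// ltW.
Qed.

Lemma is_derive_quadratic (W : normedModType R) (f : W -> R) (x v : W) (a C : R) :
  (forall s, `|s| <= 1 -> `|f (x + s *: v) - f x - a * s| <= C * s ^+ 2) ->
  is_derive x v f a.
Proof.
move=> h; have C0 : 0 <= C.
  by have := le_trans (normr_ge0 _) (h 1 _); rewrite normr1 expr1n mulr1; apply.
suff cv : (fun s => s^-1 *: ((f \o shift x) (s *: v) - f x)) @ 0^' --> a.
  by split; [apply/cvg_ex; exists a|apply/cvg_lim].
apply/cvgrPdist_le => e e0; have C1 : 0 < C + 1 by rewrite ltr_wpDl.
near=> s.
have s0 : s != 0 by near: s; exact: nbhs_dnbhs_neq.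
have s1 : `|s| <= 1 by near: s; exact: dnbhs0_le.
have sC : `|s| <= e / (C + 1) by near: s; apply: dnbhs0_le; rewrite divr_gt0.
have ns : 0 < `|s| by rewrite normr_gt0.
rewrite /= distrC -(ler_pM2l ns) -normrM mulrBr [s *: v + x]addrC.
rewrite /GRing.scale/= mulrA mulfV// mul1r (mulrC s a) (le_trans (h _ s1))//.
rewrite -real_normK ?num_real// expr2 mulrA mulrC ler_wpM2l//.
rewrite (@le_trans _ _ ((C + 1) * `|s|))// ?ler_wpM2r ?lerDl//.
by rewrite mulrC -ler_pdivlMr.
Unshelve. all: by end_near. Qed.

Lemma mvt_line phi y (v : V) (s : R) : (forall x, derivable phi x v) ->
  exists2 t, `|t| <= `|s| & phi (y + s *: v) - phi y = 'D_v phi (y + t *: v) * s.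
Proof.
move=> dphi; pose F (t : R) := phi (y + t *: v).
have dF (t : R) : is_derive t (1 : R) F ('D_v phi (y + t *: v)).
  have E : (fun h => h^-1 *: ((F \o shift t) (h *: (1 : R)) - F t)) =
      (fun h => h^-1 *: ((phi \o shift (y + t *: v)) (h *: v) - phi (y + t *: v))).
    apply/funext => h; rewrite /F/=; congr (_ *: (phi _ - _)).
    by rewrite [h%:A]mulr1 scalerDl addrCA.
  by split; rewrite /derivable /derive E //; exact: dphi.
have cF a b : {within `[a, b], continuous F}.
  by apply: derivable_within_continuous => t _; exact: ex_derive.
have F0 : F 0 = phi y by rewrite /F scale0r addr0.
have [s0|s0] := leP 0 s.
  have [t] := MVT_segment s0 (fun t _ => dF t) (cF 0 s).
  rewrite in_itv/= => /andP[t0 ts]; rewrite F0 subr0 => h; exists t => //.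
  by rewrite !ger0_norm.
have [t] := MVT_segment (ltW s0) (fun t _ => dF t) (cF s 0).
rewrite in_itv/= => /andP[t0 ts]; rewrite F0 sub0r mulrN => h; exists t => //.
  by rewrite !ler0_norm ?(ltW s0)// lerN2.
by rewrite -opprB h opprK.
Qed.

Lemma dotp_le_norm x y : `|dotp x y| <= n.+1%:R * `|x| * `|y|.
Proof.
apply: le_trans (ler_norm_sum _ _ _) _.
rewrite (@le_trans _ _ (\sum_(i < n.+1) (`|x| * `|y|)))//.
  by apply: ler_sum => i _; rewrite normrM ler_pM// coord_le_norm.
by rewrite sumr_const card_ord mulr_natl mulrnAl.
Qed.

(* Moving one coordinate at a time only needs the partial derivatives on the
   sup-norm ball of radius |z|. *)
Lemma taylor_le phi x z (C : R) : 0 <= C ->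
  (forall i y, derivable phi y (e_ i)) ->
  (forall i y, `|y - x| <= `|z| ->
     `|'D_(e_ i) phi y - 'D_(e_ i) phi x| <= C * `|y - x|) ->
  `|phi (x + z) - phi x - dotp (grad phi x) z| <= n.+1%:R * C * `|z| ^+ 2.
Proof.
move=> C0 dphi lphi.
pose w (k : nat) : V := \row_i (if (i < k)%N then z ord0 i else 0).
have w0 : w 0%N = 0 by apply/rowP => i; rewrite !mxE.
have wn : w n.+1 = z by apply/rowP => i; rewrite mxE ltn_ord.
have wS (k : 'I_n.+1) : w k.+1 = w k + z ord0 k *: e_ k.
  apply/rowP => i; rewrite !mxE eqxx/= ltnS leq_eqVlt.
  have [->|ik] := eqVneq i k; first by rewrite eqxx ltnn mulr1 add0r.
  rewrite (_ : (i == k :> nat) = false) ?mulr0 ?addr0//.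
  by apply/negbTE; apply: contra ik.
have -> : phi (x + z) - phi x - dotp (grad phi x) z = \sum_(k < n.+1)
    (phi (x + w k.+1) - phi (x + w k) - 'D_(e_ k) phi x * z ord0 k).
  rewrite sumrB; congr (_ - _); last by apply: eq_bigr => i _; rewrite mxE.
  rewrite -(big_mkord xpredT (fun k => phi (x + w k.+1) - phi (x + w k))).
  by rewrite telescope_sumr// wn w0 addr0.
apply: le_trans (ler_norm_sum _ _ _) _.
rewrite (@le_trans _ _ (\sum_(k < n.+1) (C * `|z| ^+ 2)))//; last first.
  by rewrite sumr_const card_ord mulr_natl mulrnAl.
apply: ler_sum => k _; rewrite wS addrA.
have [t tz ->] := @mvt_line phi (x + w k) (e_ k) (z ord0 k) (dphi k).
rewrite -mulrBl normrM expr2 mulrA ler_pM//; last exact: coord_le_norm.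
have le_z : `|x + w k + t *: e_ k - x| <= `|z|.
  rewrite -(addrA x) (addrC x) addrK [leLHS]mx_normrE; apply: bigmax_le => //= -[i j] _ /=.
  rewrite (ord1 i) !mxE eqxx/=.
  have [->|jk] := eqVneq j k.
    by rewrite ltnn add0r mulr1 (le_trans tz)// coord_le_norm.
  by rewrite mulr0 addr0; case: ifP => _; rewrite ?normr0// coord_le_norm.
by rewrite (le_trans (lphi _ _ le_z))// ler_wpM2l.
Qed.

(** Induction over the coordinates: monotonicity in both parameters allows the smaller radius and
    the larger constant to be taken. *)
Lemma finite_radius_const m (P : 'I_m -> R -> R -> Prop) :
  (forall i e e' C C', e' <= e -> C <= C' -> P i e C -> P i e' C') ->
  (forall i, exists e C, 0 < e /\ P i e C) ->
  exists e C, [/\ 0 < e, 0 <= C & forall i, P i e C].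
Proof.
move=> mono; elim: m P mono => [|m IH] P mono h.
  by exists 1, 0; split=> // -[].
have [e [C [e0 C0 eC]]] := IH (fun i => P (lift ord0 i)) (fun i => mono _)
  (fun i => h _).
have [e' [C' [e'0 e'C']]] := h ord0.
exists (Num.min e e'), (Num.max C C'); split.
- by rewrite lt_min e0.
- by rewrite le_max C0.
- move=> i; case: (unliftP ord0 i) => [j|] ->.
    by apply: mono (eC j); rewrite ?ge_min ?le_max lexx.
  by apply: mono e'C'; rewrite ?ge_min ?le_max lexx orbT.
Qed.

Lemma C2b_derivable phi : C2b phi -> forall i y, derivable phi y (e_ i).
Proof. by move=> [_ h] i y; case: (h i). Qed.

Lemma C2b_local phi x : C2b phi -> exists r C, [/\ 0 < r, 0 <= C,
  forall y z, `|y - x| < r -> `|z| < r ->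
    `|phi (y + z) - phi y - dotp (grad phi y) z| <= C * `|z| ^+ 2 &
  forall y, `|y - x| < r -> `|grad phi y - grad phi x| <= C * `|y - x|].
Proof.
move=> C2; have [_ h] := C2.
have [e [C [e0 C0 eC]]] := @finite_radius_const n.+1
    (fun i e C => forall y y', `|y - x| < e -> `|y' - x| < e ->
       `|'D_(e_ i) phi y - 'D_(e_ i) phi y'| <= C * `|y - y'|)
    (fun i e e' C C' ee' CC' H y y' ye y'e => le_trans
      (H y y' (lt_le_trans ye ee') (lt_le_trans y'e ee'))
      (ler_wpM2r (normr_ge0 _) CC'))
    (fun i => let: conj _ hi := h i in
      let: ex_intro2 U Ux lU := hi x in
      let: ex_intro2 e e0 eU := (nbhs_rVP x U).1 Ux in
      let: ex_intro2 C C0 CU := (lipschitz_inP U _).1 lU in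
      ex_intro _ e (ex_intro _ C (conj e0
        (fun y y' ye y'e => CU _ _ (eU _ ye) (eU _ y'e))))).
(* With half the radius, points within [|z|] of [y] stay in the ball of radius [e] about [x], where
   the Lipschitz bounds hold. *)
exists (e / 2), (n.+1%:R * C); split.
- by rewrite divr_gt0.
- by rewrite mulr_ge0.
- move=> y z yx ze; apply: taylor_le => //; first exact: C2b_derivable.
  have e2 : e / 2 <= e by rewrite ler_pdivrMr// ler_peMr ?ler1n// ltW.
  move=> i y' y'z; apply: eC; last exact: lt_le_trans e2.
  rewrite -(subrK y y') -addrA (le_lt_trans (ler_normD _ _))//.
  by rewrite [ltRHS]splitr ltrD// (le_lt_trans y'z).
- move=> y yx; have e2 : e / 2 <= e by rewrite ler_pdivrMr// ler_peMr ?ler1n// ltW.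
  rewrite (@le_trans _ _ (C * `|y - x|))//; last first.
    by rewrite ler_wpM2r// ler_peMl// ler1n.
  rewrite [leLHS]mx_normrE; apply: bigmax_le; first by rewrite mulr_ge0.
  move=> [i j] _ /=; rewrite !mxE; apply: eC; last by rewrite subrr normr0.
  exact: lt_le_trans e2.
Qed.

Lemma C2b_continuous phi : C2b phi -> continuous phi.
Proof.
move=> C2; apply: lipschitz_at_continuous => x.
have [r [C [r0 C0 h _]]] := C2b_local x C2.
exists (C + n.+1%:R * `|grad phi x|), (Num.min r 1); split.
  by rewrite lt_min r0 ltr01.
move=> z; rewrite lt_min => /andP[zr z1].
have := h x (z - x); rewrite subrr normr0 (addrC x) subrK => /(_ r0 zr) h'.
rewrite -(subrK (dotp (grad phi x) (z - x)) (phi z - phi x)).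
rewrite (le_trans (ler_normD _ _))// mulrDl lerD ?dotp_le_norm//.
by rewrite (le_trans h')// ler_wpM2l// expr2 ler_piMr// ltW.
Qed.

Lemma C2b_bounded phi : C2b phi -> exists2 M, 0 < M & forall x, `|phi x| <= M.
Proof. by move=> [/boundedP]. Qed.

(** One side suffices: moving from [x] by [t] times [v = grad phi x - p], the bound and the Taylor
    expansion give [t (v.v) = O(t^2)], which forces [v = 0]. *)
Lemma grad_of_upper_bound phi x p (r C : R) : C2b phi -> 0 < r ->
  (forall z, `|z| < r -> phi (x + z) - phi x <= dotp p z + C * `|z| ^+ 2) ->
  grad phi x = p.
Proof.
move=> C2 r0 hp; have [r' [C' [r'0 C'0 h _]]] := C2b_local x C2.
set v := grad phi x - p.
apply/eqP; rewrite -subr_eq0 -/v; apply/negP => /negP v0.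
have nv : 0 < `|v| by rewrite normr_gt0.
have ev : 0 < dotp v v.
  rewrite -sqr_enorm exprn_gt0// lt_neqAle enorm_ge0 andbT eq_sym.
  by apply: contra v0 => /eqP/enorm_eq0->.
have key t : 0 < t -> t * `|v| < r -> t * `|v| < r' ->
    dotp v v <= (`|C| + C') * `|v| ^+ 2 * t.
  move=> t0 tr tr'.
  have nz : `|t *: v| = t * `|v| by rewrite normrZ gtr0_norm.
  have := hp (t *: v); rewrite nz => /(_ tr) h1.
  have := h x (t *: v); rewrite subrr normr0 nz => /(_ r'0 tr').
  rewrite ler_norml => /andP[h2 _].
  have h3 : t * dotp v v <= (C + C') * (t * `|v|) ^+ 2.
    have -> : t * dotp v v = dotp (grad phi x) (t *: v) - dotp p (t *: v).
      by rewrite !dotpZr -mulrBr -dotpBl.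
    lra.
  rewrite -(ler_pM2l t0) (le_trans h3)//.
  rewrite exprMn (_ : t * _ = (`|C| + C') * (t ^+ 2 * `|v| ^+ 2)); last by ring.
  by apply: ler_wpM2r; [rewrite mulr_ge0 ?sqr_ge0|rewrite lerD2r ler_norm].
pose D := (`|C| + C') * `|v| ^+ 2 + 1.
have D0 : 0 < D by rewrite ltr_wpDl// mulr_ge0 ?sqr_ge0// addr_ge0.
(* The factors 2 make [D * t] at most half of [dotp v v], against [key], and keep [t * |v|] strictly
   below both radii. *)
pose t := Num.min (dotp v v / (2 * D)) (Num.min (r / (2 * `|v|)) (r' / (2 * `|v|))).
have t0 : 0 < t by rewrite !lt_min !divr_gt0 ?mulr_gt0.
have tr : t * `|v| < r.
  rewrite -ltr_pdivlMr// (@le_lt_trans _ _ (r / (2 * `|v|)))//.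
    by rewrite !ge_min lexx orbT.
  by rewrite ltr_pM2l// ltf_pV2 ?posrE ?mulr_gt0// ltr_pMl// ltr1n.
have tr' : t * `|v| < r'.
  rewrite -ltr_pdivlMr// (@le_lt_trans _ _ (r' / (2 * `|v|)))//.
    by rewrite !ge_min lexx !orbT.
  by rewrite ltr_pM2l// ltf_pV2 ?posrE ?mulr_gt0// ltr_pMl// ltr1n.
have := key t t0 tr tr'; apply/negP; rewrite -ltNge.
rewrite (@le_lt_trans _ _ (D * t))//; first by rewrite ler_wpM2r ?lerDl// ltW.
rewrite (@le_lt_trans _ _ (D * (dotp v v / (2 * D))))//.
  by rewrite ler_wpM2l ?ge_min ?lexx// ltW.
rewrite (_ : D * _ = dotp v v / 2); first by lra.
by field; rewrite gt_eqF.
Qed.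

Lemma is_derive_lincomb phi psi (a c : R) y (v : V) :
  derivable phi y v -> derivable psi y v ->
  is_derive y v (fun x => phi x + a * psi x + c)
    ('D_v phi y + a * 'D_v psi y).
Proof.
move=> dphi dpsi; have dZ := @derivableZ _ _ _ psi a y v dpsi.
have dD := @derivableD _ _ _ phi (a *: psi) y v dphi dZ.
have dC : derivable (cst c : V -> R) y v by exact: derivable_cst.
have -> : (fun x => phi x + a * psi x + c) = phi + (a *: psi) + cst c by [].
split; first exact: derivableD.
rewrite (deriveD dD dC) (deriveD dphi dZ) (deriveZ _ dpsi) derive_cst addr0.
by [].
Qed.

Lemma C2b_lincomb phi psi (a c : R) : C2b phi -> C2b psi ->
  C2b (fun x => phi x + a * psi x + c) /\
  forall x, grad (fun x => phi x + a * psi x + c) x = grad phi x + a *: grad psi x.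
Proof.
move=> C2 C2'.
have dl i y := is_derive_lincomb a c (@C2b_derivable _ C2 i y) (@C2b_derivable _ C2' i y).
split; last first.
  by move=> x; apply/rowP => i; rewrite !mxE (derive_val (is_derive := dl i x)).
have [M M0 hM] := C2b_bounded C2; have [M' M'0 hM'] := C2b_bounded C2'.
split.
  apply/boundedP; exists (M + `|a| * M' + `|c|).
    by rewrite ltr_wpDr// ltr_wpDr// mulr_ge0// ltW.
  move=> x; rewrite (le_trans (ler_normD _ _))// lerD2r.
  by rewrite (le_trans (ler_normD _ _))// lerD// normrM ler_wpM2l.
move=> i; split; first by move=> x; exact: (@ex_derive _ _ _ _ _ _ _ (dl i x)).
move=> x; have [_ /(_ i)[_ /(_ x)]] := C2; have [_ /(_ i)[_ /(_ x)]] := C2'.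
move=> [U Ux /lipschitz_inP[C C0 lC]] [U' U'x /lipschitz_inP[C' C'0 lC']].
exists (U `&` U'); first exact: filterI.
apply/lipschitz_inP; exists (C' + `|a| * C); first by rewrite ltr_wpDr// mulr_ge0// ltW.
move=> y z [Uy U'y] [Uz U'z].
rewrite (derive_val (is_derive := dl i y)) (derive_val (is_derive := dl i z)) opprD addrACA -mulrBr.
rewrite (le_trans (ler_normD _ _))// mulrDl lerD ?lC'// normrM -mulrA.
by rewrite ler_wpM2l// lC.
Qed.

Lemma C2bN phi : C2b phi ->
  C2b (\- phi) /\ forall x, grad (\- phi) x = - grad phi x.
Proof.
move=> C2; have [C2' gE] := C2b_lincomb (-2) 0 C2 C2.
(* The negative is written as [phi - 2 phi], so the result on linear combinations covers it. *)
have E : (fun x => phi x + -2 * phi x + 0) = \- phi by apply/funext => x /=; ring.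
rewrite E in C2' gE; split=> // x; rewrite gE.
by apply/rowP => i; rewrite !mxE; ring.
Qed.

Lemma continuousN_rV (u : V -> R) : continuous u -> continuous (\- u).
Proof.
move=> /continuous_rVP cu; apply/continuous_rVP => x e /(cu x)[r r0 hr].
by exists r => // z /hr; rewrite /= -opprD normrN.
Qed.

(** * Smooth bump functions from a rational profile *)

Definition hump (t : R) : R := t ^+ 2 / (1 + t ^+ 2).

Definition dhump (t : R) : R := 2 * t / (1 + t ^+ 2) ^+ 2.

Let den_gt0 (t : R) : 0 < 1 + t ^+ 2.
Proof. by rewrite ltr_pwDl// sqr_ge0. Qed.

(** Naming the inverse of [1 + t^2] and listing its bounds turns the estimates below into polynomial
    ones. *)
Let den_inv (t : R) : exists a, [/\ a = (1 + t ^+ 2)^-1, 0 < a, a <= 1 &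
  [/\ a * (1 + t ^+ 2) = 1, `|t| * a <= 1 & t ^+ 2 * a <= 1]].
Proof.
exists (1 + t ^+ 2)^-1; have d0 := den_gt0 t; split=> //.
- by rewrite invr_gt0.
- by rewrite invf_le1// lerDl sqr_ge0.
split; first by rewrite mulVf// gt_eqF.
- rewrite ler_pdivrMr// mul1r; have := sqr_ge0 (1 - `|t|).
  by rewrite -[t ^+ 2]real_normK ?num_real//; have := normr_ge0 t; nra.
- by rewrite ler_pdivrMr// mul1r lerDr.
Qed.

(** With [a], [b] the inverses of [1 + t^2] and [1 + (t + s)^2], [hump] equals [1 - a] at [t] and
    [1 - b] at [t + s]. The difference [a - b] is of order [s] because [|t| * a] and [|t + s| * b]
    are at most 1. *)
Lemma hump_quadratic (t s : R) :
  `|hump (t + s) - hump t - dhump t * s| <= 5 * s ^+ 2.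
Proof.
rewrite /hump /dhump -exprVn.
have [a [<- a0 a1 [ae ta _]]] := den_inv t.
have [b [<- b0 b1 [be sb _]]] := den_inv (t + s).
have -> : (t + s) ^+ 2 * b = 1 - b by lra.
have -> : t ^+ 2 * a = 1 - a by lra.
have ab : a - b = a * b * (2 * t * s + s ^+ 2).
  have : a - b = a * (b * (1 + (t + s) ^+ 2)) - b * (a * (1 + t ^+ 2)).
    by rewrite be ae !mulr1.
  by move=> ->; ring.
have -> : 1 - b - (1 - a) - 2 * t * a ^+ 2 * s =
    - (2 * ((t * a) * (s * (a - b)))) + a * b * s ^+ 2.
  by rewrite (_ : 1 - b - (1 - a) = a - b); [rewrite {1}ab; ring|ring].
have nab : `|a - b| <= 2 * `|s|.
  have -> : a - b = s * (t * a * b + (t + s) * b * a) by rewrite ab; ring.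
  rewrite normrM mulrC ler_wpM2r// (le_trans (ler_normD _ _))//.
  rewrite !normrM (ger0_norm (ltW a0)) (ger0_norm (ltW b0)).
  have := mulr_ge0 (normr_ge0 t) (ltW a0); have := mulr_ge0 (normr_ge0 (t + s)) (ltW b0).
  nra.
have h1 : `|s * (a - b)| <= 2 * s ^+ 2.
  by rewrite normrM -[s ^+ 2]real_normK ?num_real// expr2 mulrCA ler_wpM2l.
have : `|t * a * (s * (a - b))| <= 1 * (2 * s ^+ 2).
  by rewrite normrM ler_pM// normrM (gtr0_norm a0).
have h2 : 0 <= a * b * s ^+ 2 <= s ^+ 2.
  rewrite mulr_ge0 ?sqr_ge0 ?mulr_ge0 ?(ltW a0) ?(ltW b0)//=.
  by rewrite ler_piMl ?sqr_ge0// mulr_ile1 ?(ltW a0) ?(ltW b0).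
move: h2; rewrite !ler_norml => /andP[h2 h3] /andP[h4 h5].
by apply/andP; split; lra.
Qed.

Lemma dhump_lipschitz (t s : R) : `|dhump t - dhump s| <= 10 * `|t - s|.
Proof.
rewrite /dhump -!exprVn.
have [a [<- a0 a1 [ae ta _]]] := den_inv t.
have [b [<- b0 b1 [be sb sb2]]] := den_inv s.
have ab : a - b = (s - t) * (s * b * a + t * a * b).
  have -> : a - b = a * (b * (1 + s ^+ 2)) - b * (a * (1 + t ^+ 2)).
    by rewrite be ae !mulr1.
  by ring.
have -> : 2 * t * a ^+ 2 - 2 * s * b ^+ 2 = 2 * (t - s) *
    (a ^+ 2 - (s ^+ 2 * b * a + s * b * (t * a)) * (a + b)).
  rewrite (_ : 2 * t * a ^+ 2 - 2 * s * b ^+ 2 =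
    2 * (t - s) * a ^+ 2 + 2 * s * (a - b) * (a + b)); last by ring.
  by rewrite ab; ring.
have : `|s * b * (t * a)| <= 1.
  by rewrite normrM mulr_ile1// normrM (gtr0_norm a0, gtr0_norm b0).
have h0 : 0 <= s ^+ 2 * b by rewrite mulr_ge0 ?sqr_ge0// ltW.
rewrite ler_norml => /andP[h1 h2].
have h : `|a ^+ 2 - (s ^+ 2 * b * a + s * b * (t * a)) * (a + b)| <= 5.
  rewrite ler_norml; move: h0 h1 h2 sb2; set X := s ^+ 2 * b; set Y := s * b * _.
  move=> h0 h1 h2 h3.
  have h4 : 0 <= X * a by rewrite mulr_ge0// ltW.
  have h5 : X * a <= 1 by rewrite mulr_ile1// ltW.
  by apply/andP; split; nra.
rewrite !normrM [`|2|]ger0_norm//.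
have := ler_wpM2r (normr_ge0 (t - s)) h; lra.
Qed.

Lemma dhump_le (t : R) : `|dhump t| <= 2.
Proof.
rewrite /dhump -exprVn; have [a [<- a0 a1 [_ ta _]]] := den_inv t.
rewrite (_ : 2 * t * a ^+ 2 = 2 * (t * a * a)); last by ring.
rewrite !normrM (gtr0_norm a0) [`|2|]ger0_norm// ler_piMr//.
by rewrite mulr_ile1// ?mulr_ge0// ltW.
Qed.

Lemma hump_ge0 t : 0 <= hump t.
Proof. by rewrite divr_ge0 ?sqr_ge0// ltW. Qed.

Lemma hump_le1 t : hump t <= 1.
Proof. by rewrite ler_pdivrMr// mul1r lerDr. Qed.

Lemma hump_ge_half t : 1 <= `|t| -> 2^-1 <= hump t.
Proof.
move=> t1; rewrite ler_pdivlMr// -[t ^+ 2]real_normK ?num_real//.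
have : 1 <= `|t| ^+ 2 by rewrite exprn_ege1.
by lra.
Qed.

(** Summing over coordinates keeps each partial derivative equal to one rescaled [dhump], and at
    sup-norm distance [r] from [x] a single summand already reaches 1/2. *)
Definition bumpV x (r : R) y : R := \sum_i hump ((y ord0 i - x ord0 i) / r).

Lemma bump_center x r : bumpV x r x = 0.
Proof. by apply: big1 => i _; rewrite subrr mul0r /hump expr0n/= mul0r. Qed.

Lemma bump_ge0 x r y : 0 <= bumpV x r y.
Proof. by apply: sumr_ge0 => i _; exact: hump_ge0. Qed.

Lemma bump_le x r y : bumpV x r y <= n.+1%:R.
Proof.
rewrite (@le_trans _ _ (\sum_(i < n.+1) 1))//; last by rewrite sumr_const card_ord.
by apply: ler_sum => i _; exact: hump_le1.
Qed.

Lemma bump_ge_half x r y : 0 < r -> r <= `|y - x| -> 2^-1 <= bumpV x r y.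
Proof.
move=> r0 yx; have [i ri] : exists i, r <= `|y ord0 i - x ord0 i|.
  apply: contrapT => h; move: yx; apply/negP; rewrite -ltNge.
  rewrite [ltLHS]mx_normrE; apply: bigmax_lt => //= -[i j] _ /=.
  rewrite (ord1 i) !mxE ltNge; apply/negP => rj; apply: h; exists j.
  by move: rj.
rewrite (@le_trans _ _ (hump ((y ord0 i - x ord0 i) / r)))//.
  by rewrite hump_ge_half// normrM normfV (gtr0_norm r0) ler_pdivlMr// mul1r.
rewrite /bumpV (bigD1 i)//= lerDl; apply: sumr_ge0 => j _; exact: hump_ge0.
Qed.

Lemma is_derive_bump x r i y : 0 < r ->
  is_derive y (e_ i) (bumpV x r) (dhump ((y ord0 i - x ord0 i) / r) / r).
Proof.
move=> r0; apply: (@is_derive_quadratic _ _ _ _ _ (5 / r ^+ 2)) => s _.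
have -> : bumpV x r (y + s *: e_ i) - bumpV x r y =
    hump ((y ord0 i - x ord0 i) / r + s / r) - hump ((y ord0 i - x ord0 i) / r).
  rewrite /bumpV (bigD1 i)//= [X in _ - X](bigD1 i)//= opprD addrACA.
  rewrite [X in _ + X](_ : _ = 0) ?addr0.
    by rewrite !mxE !eqxx mulr1 -mulrDl addrAC.
  apply/eqP; rewrite subr_eq0; apply/eqP; apply: eq_bigr => j ji.
  by rewrite !mxE (negbTE ji) andbF mulr0 addr0.
rewrite -mulrA (mulrC _ s) -/(s / r).
by rewrite (le_trans (hump_quadratic _ _))// exprMn exprVn mulrCA mulrC mulrAC.
Qed.

Lemma derive_bump_lipschitz x r i y z : 0 < r ->
  `|'D_(e_ i) (bumpV x r) y - 'D_(e_ i) (bumpV x r) z| <= 10 / r ^+ 2 * `|y - z|.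
Proof.
move=> r0; rewrite (derive_val (is_derive := is_derive_bump x i y r0)).
rewrite (derive_val (is_derive := is_derive_bump x i z r0)) -mulrBl normrM.
rewrite normfV (gtr0_norm r0) ler_pdivrMr//.
rewrite (le_trans (dhump_lipschitz _ _))// -mulrBl opprB addrA subrK.
rewrite normrM normfV (gtr0_norm r0).
rewrite (_ : 10 / r ^+ 2 * `|y - z| * r = 10 * (`|y - z| / r)); last first.
  by field; rewrite gt_eqF.
rewrite ler_wpM2l// ler_wpM2r ?invr_ge0 ?(ltW r0)//.
by have := coord_le_norm (y - z) i; rewrite !mxE.
Qed.

Lemma C2b_bump x r : 0 < r -> C2b (bumpV x r).
Proof.
move=> r0; split.
  apply/boundedP; exists n.+1%:R => // y.
  by rewrite ger0_norm ?bump_ge0// bump_le.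
move=> i; split; first by move=> y; exact: (@ex_derive _ _ _ _ _ _ _ (is_derive_bump x i y r0)).
move=> y; exists setT; first exact: filterT.
apply/lipschitz_inP; exists (10 / r ^+ 2); first by rewrite divr_gt0// exprn_gt0.
by move=> *; exact: derive_bump_lipschitz.
Qed.

Lemma bump_taylor x r y z : 0 < r ->
  `|bumpV x r (y + z) - bumpV x r y - dotp (grad (bumpV x r) y) z| <=
    n.+1%:R * (10 / r ^+ 2) * `|z| ^+ 2.
Proof.
move=> r0; apply: taylor_le.
- by rewrite divr_ge0// exprn_ge0// ltW.
- exact: C2b_derivable (C2b_bump x r0).
- by move=> i y' _; exact: derive_bump_lipschitz.
Qed.

Lemma grad_bump_le x r y : 0 < r -> `|grad (bumpV x r) y| <= 2 / r.
Proof.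
move=> r0; rewrite [leLHS]mx_normrE; apply: bigmax_le; first by rewrite divr_ge0// ltW.
move=> [i j] _ /=; rewrite mxE (derive_val (is_derive := is_derive_bump x j y r0)).
rewrite normrM normfV (gtr0_norm r0) ler_wpM2r ?invr_ge0 ?(ltW r0)//.
exact: dhump_le.
Qed.

End calculus.

(** * The nonlocal operator *)

Section operator.
Context {R : realType} {n : nat}.
Variables (sigma Lambda : R).
Hypothesis s02 : 0 < sigma < 2.
Hypothesis Lambda0 : 0 < Lambda.
Local Notation V := 'rV[R]_n.+1.
Local Notation L := (lebesgue_space R n).
Local Notation mu := (lebesgue_rV R n).
Local Notation p := (near_exponent sigma).
Local Notation q := (far_exponent sigma).
Local Notation w := (weight sigma).
Local Notation CK := (kernel_const sigma Lambda).
Implicit Types (phi psi h k : V -> R) (x y z : V).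

Let p0 : 0 < p := near_exponent_gt0 s02.
Let q0 : 0 < q := far_exponent_gt0 s02.
Let CK0 : 0 < CK := kernel_const_gt0 s02 Lambda0.

Lemma weight_mid_le (rho : R) z : 0 < rho <= 1 -> enorm z <= rho^-1 ->
  w 1 z <= rho `^ (- q).
Proof.
move=> /andP[r0 r1] zr; have [z1|z1] := ltP (enorm z) 1.
  rewrite weight_near// powR1 mulr1 (@le_trans _ _ 1)//.
    rewrite -(pow1R p).
    by apply: (ge0_ler_powR (ltW p0)); rewrite ?nnegrE ?enorm_ge0 ?(ltW z1).
  rewrite powRN invf_ge1 ?powR_gt0// -[leRHS](pow1R q).
  by rewrite ge0_ler_powR ?nnegrE ?(ltW q0) ?(ltW r0).
rewrite weight_far// powR1 mulr1 powRN -powR_inv1 ?powR_ge0//.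
rewrite powRAC powR_inv1 ?(ltW r0)//.
by rewrite ge0_ler_powR ?nnegrE ?invr_ge0 ?(ltW q0) ?(ltW r0) ?enorm_ge0.
Qed.

(** Three ranges of [|z|]. Below [rho] the unit-scale weight is [rho^p] times the weight at scale
    [rho]; beyond [1/rho] it is [rho^(-q)] times the weight at scale [1/rho]; in between [e] is at
    most [e] times the weight at scale [rho]. Integrating both weights gives the stated powers. *)
Lemma tail_bound k h (C e rho : R) : upper_bounds sigma Lambda k ->
  measurable_fun [set: L] h -> 0 < rho <= 1 -> 0 <= C -> 0 <= e ->
  (forall z, `|h z| <= C * w 1 z) ->
  (forall z, rho <= enorm z <= rho^-1 -> `|h z| <= e) ->
  `|\int[mu]_z (h z * k z)| <=
    CK * (C * (rho `^ (p - sigma) + rho `^ (sigma - q)) + e * rho `^ (- sigma)).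
Proof.
move=> ubk mh /andP[r0 r1] C0 e0 hC he.
have ih := kernel_integrable s02 Lambda0 ubk (ltr01 : 0 < 1 :> R) mh hC.
have rV0 : 0 < rho^-1 by rewrite invr_gt0.
have iw1 := integrable_weight s02 Lambda0 ubk r0.
have iw2 := integrable_weight s02 Lambda0 ubk rV0.
have pt z : `|h z| <= (C * rho `^ p + e) * w rho z + C * rho `^ (- q) * w rho^-1 z.
  have [zr|rz] := ltP (enorm z) rho.
    rewrite (le_trans (hC z))// (@le_trans _ _ (C * rho `^ p * w rho z))//.
      rewrite -mulrA ler_wpM2l// !weight_near ?(lt_le_trans zr)// powR1 mulr1.
      by rewrite mulrCA powRN mulfV ?mulr1// gt_eqF// powR_gt0.
    rewrite mulrDl -addrA lerDl addr_ge0// !mulr_ge0 ?powR_ge0 ?weight_ge0//.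
  have [zr|rz'] := leP (enorm z) rho^-1.
    rewrite (le_trans (he z _)) ?rz// (@le_trans _ _ (e * w rho z))//.
      by rewrite ler_peMr// weight_ge1.
    rewrite mulrDl -addrA addrCA lerDl addr_ge0// !mulr_ge0 ?powR_ge0 ?weight_ge0//.
  rewrite (le_trans (hC z))// (@le_trans _ _ (C * rho `^ (- q) * w rho^-1 z))//.
    rewrite -mulrA ler_wpM2l// !weight_far ?(ltW rz')//; last first.
      by rewrite (le_trans _ (ltW rz'))// invf_ge1.
    rewrite powR1 mulr1 mulrCA -[rho^-1]powR_inv1 ?(ltW r0)// -powRrM mulN1r opprK.
    by rewrite powRN mulVf ?mulr1// gt_eqF// powR_gt0.
  rewrite lerDr !mulr_ge0 ?addr_ge0 ?mulr_ge0 ?powR_ge0 ?weight_ge0//.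
apply: le_trans (le_normr_Rintegral measurableT ih) _.
set c1 := C * rho `^ p + e in pt *; set c2 := C * rho `^ (- q) in pt *.
have c10 : 0 <= c1 by rewrite addr_ge0// mulr_ge0// powR_ge0.
have c20 : 0 <= c2 by rewrite mulr_ge0// powR_ge0.
apply: (@le_trans _ _ (\int[mu]_z (c1 * (w rho z * k z) + c2 * (w rho^-1 z * k z)))).
  apply: le_Rintegral => //.
  - exact: integrable_abse ih.
  - have := integrableD measurableT (integrableZl measurableT c1 iw1)
      (integrableZl measurableT c2 iw2).
    by apply: eq_integrable.
  - move=> z _; rewrite normrM (ger0_norm (kernel_ge0 ubk z)) !mulrA -mulrDl.
    by rewrite ler_wpM2r// (kernel_ge0 ubk).
rewrite RintegralD//; [|exact: (integrableZl measurableT c1 iw1)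
  |exact: (integrableZl measurableT c2 iw2)].
rewrite !RintegralZl//.
have wle d z : w d z <= 1 * w d z by rewrite mul1r.
have b1 := kernel_Rintegral_le s02 Lambda0 ubk r0 ler01 iw1 (wle rho).
have b2 := kernel_Rintegral_le s02 Lambda0 ubk rV0 ler01 iw2 (wle rho^-1).
rewrite mul1r in b1; rewrite mul1r in b2.
apply: (le_trans (lerD (ler_wpM2l c10 b1) (ler_wpM2l c20 b2))).
rewrite -[rho^-1]powR_inv1 ?(ltW r0)// -powRrM mulN1r opprK.
rewrite /c1 /c2 (powRD (r := p)) ?(gt_eqF r0) ?implybT// (powRD (r := sigma)) ?(gt_eqF r0) ?implybT//.
by rewrite le_eqVlt; apply/orP; left; apply/eqP; ring.
Qed.

Lemma tail_small (C : R) : 0 < C ->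
  exists2 rho, 0 < rho <= 1 & rho `^ (p - sigma) + rho `^ (sigma - q) <= C.
Proof.
move=> C0; have C2 : 0 < C / 2 by rewrite divr_gt0.
have small (a : R) : 0 < a -> \forall r \near (0 : R)^'+, r `^ a <= C / 2.
  move=> a0; have /cvgrPdist_le /(_ _ C2) := powR_cvg0 a0.
  by apply: filterS => r; rewrite sub0r normrN ger0_norm// powR_ge0.
near (0 : R)^'+ => rho; exists rho.
  apply/andP; split; near: rho; first exact: nbhs_right_gt.
  exact: nbhs_right_le.
rewrite [leRHS]splitr lerD//; near: rho; apply: small; rewrite subr_gt0.
  exact: near_exponent_gt.
exact: far_exponent_lt.
Unshelve. all: by end_near. Qed.

Lemma finite_ball (T : R) : exists2 M, 0 <= M &
  (mu (eball (0 : V) T) <= M%:E)%E.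
Proof.
have T0 : 0 <= `|T| + 1 by rewrite addr_ge0.
pose b : V * V := (const_mx (- (`|T| + 1)), const_mx (`|T| + 1)).
have b12 i : b.1 ord0 i <= b.2 ord0 i by rewrite !mxE ge0_cp.
exists (box_volume b); first by apply: prodr_ge0 => i _; rewrite subr_ge0.
apply: le_trans (lebesgue_outer_box_le b12).
apply: (@le_outer_measure _ _ (@lebesgue_outer R n)).
move=> z; rewrite /eball /= subr0 => zT i; rewrite !mxE.
have : `|z ord0 i| < `|T| + 1.
  rewrite (le_lt_trans (coord_le_enorm _ _))// (lt_trans zT)//.
  by rewrite (le_lt_trans (ler_norm _))// ltrDl.
by rewrite ltr_norml => /andP[/ltW -> ->].
Qed.

(** The kernels are compared only where [rho <= |z| <= 1/rho], a set of finite measure; the singular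
    part and the far part are bounded by [tail_bound] for each kernel separately. *)
Lemma kernel_difference k1 k2 h (C e rho M : R) :
  upper_bounds sigma Lambda k1 -> upper_bounds sigma Lambda k2 ->
  measurable_fun [set: L] h -> 0 < rho <= 1 -> 0 <= C -> 0 <= e -> 0 <= M ->
  (mu (eball (0 : V) (2 / rho)) <= M%:E)%E ->
  (forall z, `|h z| <= C * w 1 z) ->
  (forall z, rho <= enorm z <= rho^-1 -> `|k1 z - k2 z| <= e) ->
  `|\int[mu]_z (h z * k1 z) - \int[mu]_z (h z * k2 z)| <=
    2 * (CK * (C * (rho `^ (p - sigma) + rho `^ (sigma - q)))) +
    C * rho `^ (- q) * e * M.
Proof.
move=> ub1 ub2 mh r01 C0 e0 M0 muM hC ke; have /andP[r0 r1] := r01.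
pose D : set L := [set z : V | rho <= enorm z <= rho^-1].
have mD : measurable D.
  have := continuous_measurable_rV (@continuous_enorm R n) measurableT
    (measurable_itv `[rho, rho^-1]).
  by rewrite setTI; congr measurable.
pose hm z := \1_D z * h z; pose ho z := h z - hm z.
have mhm : measurable_fun [set: L] hm.
  by apply: measurable_funM => //; exact: measurable_indic.
have mho : measurable_fun [set: L] ho by exact: measurable_funB.
have hm0 z : z \in D \/ hm z = 0.
  rewrite /hm indicE; case: (boolP (z \in D)); first by left.
  by right; rewrite mul0r.
have hmC z : `|hm z| <= C * w 1 z.
  rewrite normrM (le_trans _ (hC z))// ler_piMl// indicE.
  by case: (z \in D); rewrite ?normr1 ?normr0.
have hoC z : `|ho z| <= C * w 1 z.
  rewrite /ho /hm indicE; case: (z \in D); rewrite ?mul1r ?mul0r ?subr0// subrr.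
  by rewrite normr0 mulr_ge0// weight_ge0.
have ho0 z : rho <= enorm z <= rho^-1 -> `|ho z| <= 0.
  by move=> zD; rewrite /ho /hm indicE mem_set// mul1r subrr normr0.
have I k (ub : upper_bounds sigma Lambda k) (g : V -> R)
    (mg : measurable_fun [set: L] g) (gC : forall z, `|g z| <= C * w 1 z) :=
  kernel_integrable s02 Lambda0 ub (ltr01 : 0 < 1 :> R) mg gC.
have split_int k (ub : upper_bounds sigma Lambda k) :
    \int[mu]_z (h z * k z) = \int[mu]_z (ho z * k z) + \int[mu]_z (hm z * k z).
  rewrite -RintegralD//; [|exact: I ub _ mho hoC|exact: I ub _ mhm hmC].
  by apply: eq_Rintegral => z _; rewrite -mulrDl /ho subrK.
rewrite (split_int _ ub1) (split_int _ ub2) opprD addrACA.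
have t1 := tail_bound ub1 mho r01 C0 (lexx 0) hoC ho0.
have t2 := tail_bound ub2 mho r01 C0 (lexx 0) hoC ho0.
rewrite mul0r addr0 in t1; rewrite mul0r addr0 in t2.
apply: le_trans (ler_normD _ _) _; apply: lerD.
  by apply: le_trans (ler_normB _ _) _; rewrite mulr2n mulrDl mul1r lerD.
have i1 := I _ ub1 _ mhm hmC; have i2 := I _ ub2 _ mhm hmC.
have ciq : 0 <= C * rho `^ (- q) * e by rewrite !mulr_ge0// powR_ge0.
(* The radius [2 / rho] makes the open ball contain the closed one of radius [1/rho]. *)
have muD : (mu D <= M%:E)%E.
  apply: le_trans muM; apply: (@le_outer_measure _ _ (@lebesgue_outer R n)).
  move=> z /= /andP[_ zr]; rewrite /eball /= subr0 (le_lt_trans zr)//.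
  by rewrite ltr_pMl ?ltr1n// invr_gt0.
have fD : mu D \is a fin_num by rewrite ge0_fin_numE// (le_lt_trans muD)// ltry.
have iI : mu.-integrable [set: L] (EFin \o \1_D).
  apply/integrableP; split; first by apply/measurable_EFinP; exact: measurable_indic.
  rewrite (eq_integral (fun z : L => (\1_D z)%:E)); last first.
    by move=> z _; rewrite gee0_abs// lee_fin.
  by rewrite integral_indic// setIT (le_lt_trans muD)// ltry.
have iD : mu.-integrable [set: L] (EFin \o (fun z => C * rho `^ (- q) * e * \1_D z)).
  exact: (integrableZl measurableT (C * rho `^ (- q) * e) iI).
rewrite -RintegralB//; apply: le_trans (le_normr_Rintegral measurableT _) _.
  exact: (integrableB measurableT i1 i2).
apply: (@le_trans _ _ (\int[mu]_z (C * rho `^ (- q) * e * \1_D z))).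
  apply: le_Rintegral => //.
    exact: integrable_abse (integrableB measurableT i1 i2).
  move=> z _; rewrite -mulrBr normrM; case: (hm0 z) => [zD|->]; last first.
    by rewrite normr0 mul0r mulr_ge0.
  rewrite indicE zD mulr1; apply: ler_pM => //; last by apply: ke; rewrite inE in zD.
  rewrite (le_trans (hmC z))// ler_wpM2l// weight_mid_le//.
  by move: zD; rewrite inE => /andP[].
rewrite RintegralZl//.
rewrite ler_wpM2l// /Rintegral integral_indic// setIT.
by rewrite -lee_fin fineK.
Qed.

Lemma measurable_increment phi y : C2b phi ->
  measurable_fun [set: L] (increment sigma phi y).
Proof.
move=> C2; have cphi := C2b_continuous C2.
have m1 : measurable_fun [set: L] (fun z : V => phi (y + z) - phi y).
  apply: measurable_funB; last exact: measurable_cst.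
  apply: continuous_measurable_rV; apply/continuous_rVP => x e e0.
  have [r r0 rh] := (continuous_rVP phi).1 cphi (y + x) e e0.
  by exists r => // z zr; apply: rh; rewrite opprD addrACA subrr add0r.
have m2 : measurable_fun [set: L] (dotp (grad phi y)).
  by apply: continuous_measurable_rV; exact: continuous_dotp.
have [s1|s1] := boolP (sigma < 1).
  rewrite (_ : increment _ _ _ = fun z => phi (y + z) - phi y)//.
  by apply/funext => z; rewrite /increment s1.
have [s2|s2] := boolP (sigma == 1).
  rewrite (_ : increment _ _ _ = fun z => phi (y + z) - phi y -
      \1_(eball (0 : V) 1) z * dotp (grad phi y) z); last first.
    by apply/funext => z; rewrite /increment (negbTE s1) s2.
  have mI : measurable_fun [set: L] (\1_(eball (0 : V) 1) : L -> R).
    by apply: measurable_indic; apply: measurable_open; exact: open_eball.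
  exact: (measurable_funB m1 (measurable_funM mI m2)).
rewrite (_ : increment _ _ _ = fun z => phi (y + z) - phi y - dotp (grad phi y) z).
  exact: (measurable_funB m1 m2).
by apply/funext => z; rewrite /increment (negbTE s1) (negbTE s2).
Qed.

(** For [|z| < r] the Taylor bound applies. For [r <= |z| < 1] the increment is merely bounded, but
    the weight is at least [r^p]. For [|z| >= 1] the weight is at least 1, and at least [|z|] when
    [sigma > 1], which absorbs the gradient term. *)
Lemma increment_le_weight phi y (r C G M : R) : 0 < r <= 1 -> 0 <= C -> 0 <= G ->
  0 <= M -> (forall z, enorm z < r ->
    `|phi (y + z) - phi y - dotp (grad phi y) z| <= C * enorm z ^+ 2) ->
  enorm (grad phi y) <= G -> (forall x, `|phi x| <= M) ->
  forall z, `|increment sigma phi y z| <=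
    (C + G + (2 * M + G) / r `^ p) * w 1 z.
Proof.
move=> /andP[r0 r1] C0 G0 M0 hC hG hM z.
have rp : 0 < r `^ p by rewrite powR_gt0.
have rp1 : r `^ p <= 1.
  by rewrite -(pow1R p); apply: (ge0_ler_powR (ltW p0)); rewrite ?nnegrE ?(ltW r0).
have MG : 0 <= 2 * M + G by rewrite addr_ge0// mulr_ge0.
have hz : `|dotp (grad phi y) z| <= G * enorm z.
  by apply: le_trans (normr_dotp _ _) _; rewrite ler_wpM2r// enorm_ge0.
have h2M : `|phi (y + z) - phi y| <= 2 * M.
  by rewrite mulr2n mulrDl mul1r (le_trans (ler_normB _ _))// lerD.
have [zr|rz] := ltP (enorm z) r.
- have z1 : enorm z < 1 by exact: lt_le_trans r1.
  have h := hC z zr; have z0 := enorm_ge0 z.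
  apply: (@le_trans _ _ ((C + G) * w 1 z)); last first.
    by rewrite ler_wpM2r ?weight_ge0// lerDl divr_ge0// ltW.
  rewrite weight_near// powR1 mulr1 /increment /near_exponent.
  case: ifP => s1.
    rewrite powRr1// mulrDl.
    rewrite -(subrK (dotp (grad phi y) z) (phi (y + z) - phi y)).
    rewrite (le_trans (ler_normD _ _))// lerD// (le_trans h)// ler_wpM2l//.
    by rewrite expr2 ler_piMl// ltW.
  rewrite powR_mulrn// indicE mem_set ?mul1r; last by rewrite /eball/= subr0.
  rewrite mulrDl (le_trans (y := C * enorm z ^+ 2))//; first by case: ifP.
  by rewrite lerDl mulr_ge0// sqr_ge0.
- apply: (@le_trans _ _ ((2 * M + G) / r `^ p * w 1 z)); last first.
    by rewrite ler_wpM2r ?weight_ge0// lerDr addr_ge0.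
  have [z1|z1] := ltP (enorm z) 1.
    have rw : r `^ p <= w 1 z.
      rewrite weight_near// powR1 mulr1; apply: (ge0_ler_powR (ltW p0)) => //.
        by rewrite nnegrE ltW.
      by rewrite nnegrE enorm_ge0.
    apply: (@le_trans _ _ (2 * M + G)); last first.
      by rewrite -mulrA ler_peMr// mulrC ler_pdivlMr// mul1r.
    have Gz : G * enorm z <= G by rewrite ler_piMr// ltW.
    rewrite /increment; case: ifP => _; first by rewrite (le_trans h2M)// lerDl.
    rewrite indicE mem_set ?mul1r; last by rewrite /eball/= subr0.
    have : `|phi (y + z) - phi y - dotp (grad phi y) z| <= 2 * M + G.
      by rewrite (le_trans (ler_normB _ _))// lerD// (le_trans hz).
    by case: ifP.
  apply: (@le_trans _ _ ((2 * M + G) * w 1 z)); last first.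
    by rewrite ler_wpM2r ?weight_ge0// ler_peMr// invf_ge1.
  have w1 := weight_ge1 s02 ltr01 z1.
  rewrite /increment; case: ifP => s1.
    rewrite (le_trans h2M)// (@le_trans _ _ (2 * M + G)) ?lerDl// ler_peMr//.
  case: eqP => [s1'|s1'].
    rewrite indicE memNset ?mul0r ?subr0; last first.
      by rewrite /eball/= subr0; apply/negP; rewrite -leNgt.
    by rewrite (le_trans h2M)// (@le_trans _ _ (2 * M + G)) ?lerDl// ler_peMr.
  have wz : enorm z <= w 1 z.
    rewrite weight_far// powR1 mulr1 le1r_powR// /far_exponent.
    move: s1 s1'; case: (ltgtP sigma 1) => // s1 _ _; lra.
  rewrite mulrDl (le_trans (ler_normB _ _))// lerD//.
    by rewrite (le_trans h2M)// ler_peMr// mulr_ge0.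
  by rewrite (le_trans hz)// ler_wpM2l.
Qed.

Lemma C2b_increment_bound phi x : C2b phi ->
  exists r C, [/\ 0 < r, 0 <= C & forall y, `|y - x| < r ->
    (forall z, `|increment sigma phi y z| <= C * w 1 z) /\
    enorm (grad phi y) <= C].
Proof.
move=> C2; have [r [C [r0 C0 h hg]]] := C2b_local x C2.
have [M M0 hM] := C2b_bounded C2.
pose s := Num.min r 1; have s0 : 0 < s by rewrite lt_min r0 ltr01.
pose G := n.+1%:R * (`|grad phi x| + C).
have G0 : 0 <= G by rewrite mulr_ge0// addr_ge0.
have sp : 0 < s `^ p by rewrite powR_gt0.
have MG : 0 <= (2 * M + G) / s `^ p.
  by rewrite divr_ge0 ?(ltW sp)// addr_ge0// mulr_ge0// ltW.
exists s, (C + G + (2 * M + G) / s `^ p); split=> //.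
  by rewrite addr_ge0// addr_ge0.
move=> y; rewrite lt_min => /andP[yr y1].
have hG : enorm (grad phi y) <= G.
  apply: le_trans (enorm_le_norm _) _; rewrite ler_wpM2l//.
  rewrite -(subrK (grad phi x) (grad phi y)) (le_trans (ler_normD _ _))//.
  by rewrite addrC lerD2l (le_trans (hg _ yr))// ler_piMr// ltW.
split; last by rewrite (le_trans hG)// addrAC lerDr addr_ge0.
apply: increment_le_weight => //; rewrite ?s0 ?ge_min ?lexx ?orbT//; first exact: ltW.
move=> z; rewrite lt_min => /andP[zr _].
have zr' : `|z| < r by rewrite (le_lt_trans (norm_le_enorm z)).
by rewrite (le_trans (h _ _ yr zr'))// ler_wpM2l// lerXn2r ?nnegrE ?enorm_ge0// norm_le_enorm.
Qed.

Definition nonlocalR k phi y : R := \int[mu]_z (increment sigma phi y z * k z).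

Lemma integrable_increment k phi y : upper_bounds sigma Lambda k -> C2b phi ->
  mu.-integrable [set: L] (EFin \o (fun z => increment sigma phi y z * k z)).
Proof.
move=> ubk C2; have [r [C [r0 C0 /(_ y)]]] := C2b_increment_bound y C2.
rewrite subrr normr0 => /(_ r0)[hC _].
exact: (kernel_integrable s02 Lambda0 ubk ltr01 (measurable_increment y C2) hC).
Qed.

Lemma nonlocalE k phi y : upper_bounds sigma Lambda k -> C2b phi ->
  nonlocal sigma k phi y = (nonlocalR k phi y)%:E.
Proof.
move=> ubk C2; rewrite /nonlocalR /Rintegral fineK//.
exact: integrable_fin_num (integrable_increment y ubk C2).
Qed.

(** Uniformity in [z] is the near-covering form of compactness of the ball, with [y] tending to [x]
    as the parameter. *)
Lemma uniformly_continuous_translates phi x (T e : R) : continuous phi -> 0 < e ->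
  exists2 r, 0 < r &
    forall y z, `|y - x| < r -> `|z| <= T -> `|phi (y + z) - phi (x + z)| < e.
Proof.
move=> /continuous_rVP cphi e0.
pose B : set V := [set z | `|z| <= T].
have cB : compact B.
  apply: bounded_closed_compact.
    exists T; split; first exact: num_real.
    by move=> N TN z /= zT; rewrite (le_trans zT)// ltW.
  have -> : B = (fun z : V => `|z|) @^-1` `]-oo, T]%classic.
    by apply/seteqP; split=> z; rewrite /= in_itv.
  apply: preimage_closed; last exact: interval_closed.
  by move=> z _; exact: norm_continuous.
have /compact_near_coveringP := cB.
move=> /(_ V (nbhs x) (fun y z => `|phi (y + z) - phi (x + z)| < e)).
have cover z0 : B z0 -> \forall z \near z0 & y \near nbhs x,
    `|phi (y + z) - phi (x + z)| < e.
  move=> _; have e2 : 0 < e / 2 by rewrite divr_gt0.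
  have [r r0 rh] := cphi (x + z0) _ e2.
  have r2 : 0 < r / 2 by rewrite divr_gt0.
  exists ([set z | `|z - z0| < r / 2], [set y | `|y - x| < r / 2]).
    by split; apply/nbhs_rVP; exists (r / 2).
  move=> [z y] [/= zz0 yx].
  rewrite -(subrK (phi (x + z0)) (phi (y + z))) -addrA.
  rewrite (le_lt_trans (ler_normD _ _))// [ltRHS]splitr ltrD//.
    apply: rh; rewrite opprD addrACA (le_lt_trans (ler_normD _ _))//.
    by rewrite [ltRHS]splitr ltrD.
  rewrite distrC; apply: rh; rewrite opprD addrACA subrr add0r.
  by rewrite (lt_trans zz0)// ltr_pdivrMr// ltr_pMr// ltr1n.
move=> /(_ _ cover) /nbhs_rVP[r r0 rh]; exists r => // y z yr zT.
exact: rh.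
Qed.

Lemma increment_equicontinuous phi x (T e : R) : C2b phi -> 0 < e ->
  exists2 r, 0 < r & forall y z, `|y - x| < r -> enorm z <= T ->
    `|increment sigma phi y z - increment sigma phi x z| <= e.
Proof.
move=> C2 e0; have cphi := C2b_continuous C2.
have e3 : 0 < e / 3 by rewrite divr_gt0.
have [r1 r10 h1] := uniformly_continuous_translates x T cphi e3.
have [r2 r20 h2] := (continuous_rVP phi).1 cphi x _ e3.
have [r3 [C [r30 C0 _ hg]]] := C2b_local x C2.
pose D := n.+1%:R * C * `|T| + 1.
have D0 : 0 < D by rewrite ltr_wpDl// !mulr_ge0.
exists (Num.min (Num.min r1 r2) (Num.min r3 (e / 3 / D))).
  by rewrite !lt_min r10 r20 r30 divr_gt0.
move=> y z; rewrite !lt_min => /andP[/andP[y1 y2] /andP[y3 y4]] zT.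
have zT' : `|z| <= T by rewrite (le_trans (norm_le_enorm z)).
have k1 := h1 _ _ y1 zT'; have k2 := h2 _ y2.
have k3 : `|dotp (grad phi y) z - dotp (grad phi x) z| <= e / 3.
  rewrite -dotpBl (le_trans (normr_dotp _ _))//.
  apply: (@le_trans _ _ (n.+1%:R * (C * `|y - x|) * `|T|)).
    rewrite ler_pM ?enorm_ge0//; last by rewrite (le_trans zT)// ler_norm.
    by rewrite (le_trans (enorm_le_norm _))// ler_wpM2l// hg.
  apply: (@le_trans _ _ (D * `|y - x|)).
    by rewrite mulrA mulrAC ler_wpM2r// lerDl.
  by rewrite mulrC -ler_pdivlMr// ltW.
have k12 : `|phi (y + z) - phi y - (phi (x + z) - phi x)| <= e / 3 + e / 3.
  have -> : phi (y + z) - phi y - (phi (x + z) - phi x) =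
    (phi (y + z) - phi (x + z)) - (phi y - phi x) by ring.
  by rewrite (le_trans (ler_normB _ _))// lerD// ltW.
have ee : e / 3 + e / 3 <= e by lra.
rewrite /increment; case: ifP => _; first exact: le_trans k12 ee.
(* The factor [c] treats both remaining cases at once: the indicator value for [sigma = 1], and 1
   for [sigma > 1]. *)
have key c : 0 <= c <= 1 -> `|phi (y + z) - phi y - c * dotp (grad phi y) z -
    (phi (x + z) - phi x - c * dotp (grad phi x) z)| <= e.
  move=> /andP[c0 c1].
  have -> : phi (y + z) - phi y - c * dotp (grad phi y) z -
    (phi (x + z) - phi x - c * dotp (grad phi x) z) =
    (phi (y + z) - phi y - (phi (x + z) - phi x)) -
    c * (dotp (grad phi y) z - dotp (grad phi x) z) by ring.
  rewrite (le_trans (ler_normB _ _))// (_ : e = e / 3 + e / 3 + e / 3); last by field.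
  rewrite lerD// normrM (ger0_norm c0) (le_trans _ k3)//.
  by rewrite ler_piMl.
case: ifP => _; last by have := key 1; rewrite !mul1r; apply; rewrite ler01 lexx.
by apply: key; rewrite indicE; case: (_ \in _); rewrite ?lexx ler01.
Qed.

(** The difference splits into a change of increment under the kernel at [y], handled by
    [tail_bound], and a change of kernel under the fixed increment at [x], handled by
    [kernel_difference]. *)
Lemma nonlocalR_equicontinuous (I : Type) (Omega : set V) (K : I -> V -> V -> R)
    phi x (e : R) :
  (forall i y, Omega y -> upper_bounds sigma Lambda (K i y)) ->
  (forall rho d : R, 0 < rho -> 0 < d -> exists2 r, 0 < r &
    forall y, Omega y -> `|y - x| < r -> forall i z, rho <= enorm z <= rho^-1 ->
      `|K i y z - K i x z| <= d) ->
  C2b phi -> Omega x -> 0 < e ->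
  exists2 r, 0 < r & forall y, Omega y -> `|y - x| < r ->
    forall i, `|nonlocalR (K i y) phi y - nonlocalR (K i x) phi x| <= e.
Proof.
move=> ub contK C2 Ox e0.
have [r1 [C [r10 C0 hC]]] := C2b_increment_bound x C2.
have C10 : 0 < C + 1 by rewrite ltr_wpDl.
(* Each of the two parts contributes two tails of size [e / 8]; the other half of [e] is shared by
   [e1] and [e2]. These depend on [rho], and [e2] also on [M], so [rho] is fixed first. *)
have e8 : 0 < e / (8 * CK * (C + 1)) by rewrite divr_gt0// !mulr_gt0.
have [rho rho01 rhoS] := tail_small e8.
have /andP[rho0 rho1] := rho01.
have [M M0 hM] := finite_ball (2 / rho).
set tt := rho `^ (p - sigma) + rho `^ (sigma - q) in rhoS.
have tt0 : 0 <= tt by rewrite addr_ge0 ?powR_ge0.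
have rs : 0 < rho `^ (- sigma) by rewrite powR_gt0.
have rq : 0 < rho `^ (- q) by rewrite powR_gt0.
have CKt : CK * (C * tt) <= e / 8.
  apply: (@le_trans _ _ (CK * ((C + 1) * tt))).
    by rewrite ler_wpM2l ?(ltW CK0)// ler_wpM2r// lerDl.
  rewrite mulrA mulrC -ler_pdivlMr ?mulr_gt0//.
  by apply: le_trans rhoS _; rewrite le_eqVlt; apply/orP; left; apply/eqP; field;
    rewrite !gt_eqF.
pose e1 := e / 4 / (CK * rho `^ (- sigma)).
have e10 : 0 < e1 by rewrite !divr_gt0// mulr_gt0.
pose e2 := e / 4 / ((C + 1) * rho `^ (- q) * (M + 1)).
have M10 : 0 < M + 1 by rewrite ltr_wpDl.
have e20 : 0 < e2 by rewrite !divr_gt0// !mulr_gt0.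
have [r2 r20 h2] := increment_equicontinuous x rho^-1 C2 e10.
have [r3 r30 h3] := contK rho e2 rho0 e20.
exists (Num.min r1 (Num.min r2 r3)); first by rewrite !lt_min r10 r20.
move=> y Oy; rewrite !lt_min => /andP[y1 /andP[y2 y3]] i.
have uby := ub i y Oy; have ubx := ub i x Ox.
have [hCy _] := hC y y1.
have [hCx _] : (forall z, `|increment sigma phi x z| <= C * w 1 z) /\
    enorm (grad phi x) <= C by apply: hC; rewrite subrr normr0.
have mx := measurable_increment x C2; have my := measurable_increment y C2.
have ixy := kernel_integrable s02 Lambda0 uby (ltr01 : 0 < 1 :> R) mx hCx.
have iyy := kernel_integrable s02 Lambda0 uby (ltr01 : 0 < 1 :> R) my hCy.
pose h z := increment sigma phi y z - increment sigma phi x z.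
have mh : measurable_fun [set: L] h by exact: (measurable_funB my mx).
have hh z : `|h z| <= (C + C) * w 1 z.
  by rewrite mulrDl (le_trans (ler_normB _ _))// lerD.
have he z : rho <= enorm z <= rho^-1 -> `|h z| <= e1.
  by move=> /andP[_ zr]; exact: h2.
have t1 := tail_bound uby mh rho01 (addr_ge0 C0 C0) (ltW e10) hh he.
have t2 := kernel_difference uby ubx mx rho01 C0 (ltW e20) M0 hM hCx
  (fun z zr => h3 y Oy y3 i z zr).
have E : nonlocalR (K i y) phi y - nonlocalR (K i x) phi x =
    \int[mu]_z (h z * K i y z) + (\int[mu]_z (increment sigma phi x z * K i y z) -
      \int[mu]_z (increment sigma phi x z * K i x z)).
  rewrite addrA; congr (_ - _).
  have ih := kernel_integrable s02 Lambda0 uby (ltr01 : 0 < 1 :> R) mh hh.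
  rewrite -(RintegralD measurableT ih ixy); apply: eq_Rintegral => z _.
  by rewrite /h mulrBl subrK.
rewrite E (le_trans (ler_normD _ _))//.
have b1 : CK * (e1 * rho `^ (- sigma)) = e / 4.
  by rewrite /e1; field; rewrite !gt_eqF.
have b2 : C * rho `^ (- q) * e2 * M <= e / 4.
  apply: (@le_trans _ _ ((C + 1) * rho `^ (- q) * e2 * (M + 1))).
    apply: ler_pM => //; last by rewrite lerDl.
      exact: mulr_ge0 (mulr_ge0 C0 (ltW rq)) (ltW e20).
    by rewrite ler_wpM2r ?(ltW e20)// ler_wpM2r ?(ltW rq)// lerDl.
  rewrite /e2 le_eqVlt; apply/orP; left; apply/eqP; field.
  by rewrite !gt_eqF.
have t3 : CK * ((C + C) * tt + e1 * rho `^ (- sigma)) = 2 * (CK * (C * tt)) + e / 4.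
  by rewrite -b1; ring.
rewrite -/tt t3 in t1; rewrite -/tt in t2; apply: le_trans (lerD t1 t2) _.
move: CKt b2; clear; set X := CK * _; set Y := _ * M; lra.
Qed.

End operator.

(** * Envelopes and Perron's method *)

Section envelopes.
Context {R : realType} {n : nat}.
Local Notation V := 'rV[R]_n.+1.
Implicit Types (u : V -> R) (x y : V).

Definition usc u := forall x (a : R), u x < a ->
  exists2 r, 0 < r & forall y, `|y - x| < r -> u y < a.

Lemma uscP u : usc u <-> lower_semicontinuous (fun x => (- u x)%:E).
Proof.
split=> h x a.
  rewrite lte_fin ltrNr => /h[r r0 rh].
  exists [set y | `|y - x| < r]; first by apply/nbhs_rVP; exists r.
  by move=> y /rh; rewrite lte_fin ltrNr.
move=> ua; have [|U /nbhs_rVP[r r0 rU] hU] := h x (- a).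
  by rewrite lte_fin ltrN2.
by exists r => // y /rU/hU; rewrite lte_fin ltrN2.
Qed.

(** The suprema are monotone in the radius and bounded below, so the [lim] defining the envelope is
    a genuine limit, equal to their infimum. *)
Lemma sup_ecball_cvg u x (M : R) : (forall y, `|u y| <= M) ->
  sup (u @` ecball x r) @[r --> 0^'+] -->
    inf [set sup (u @` ecball x r) | r in [set r : R | 0 < r]].
Proof.
move=> uM.
have xx (r : R) : 0 < r -> ecball x r x.
  by move=> r0; rewrite /ecball /= subrr enorm0 ltW.
have hs (r : R) : 0 < r -> has_sup (u @` ecball x r).
  move=> r0; split; first by exists (u x), x => //; exact: xx.
  by exists M => _ [y _ <-]; rewrite (le_trans (ler_norm _)).
have -> : [set r : R | 0 < r] = [set` `]0, +oo[%R].
  by apply/seteqP; split=> r /=; rewrite in_itv/= andbT.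
apply: (@nondecreasing_at_right_cvgr _ (fun r => sup (u @` ecball x r)) 0
  (BInfty _ false)) => //.
- move=> r s; rewrite !in_itv/= !andbT => r0 s0 rs.
  apply: ge_sup; first by exists (u x), x => //; exact: xx.
  move=> _ [y xy <-]; apply: sup_upper_bound; first exact: hs.
  by exists y => //; exact: le_trans rs.
- exists (- M) => _ [r /= rI <-]; have r0 : 0 < r by move: rI; rewrite in_itv/= andbT.
  apply: (@le_trans _ _ (u x)).
    by have := uM x; rewrite ler_norml => /andP[].
  by apply: sup_upper_bound; [exact: hs|exists x => //; exact: xx].
Qed.

Lemma usc_envelope_cvg u x (M : R) : (forall y, `|u y| <= M) ->
  usc_envelope u x = inf [set sup (u @` ecball x r) | r in [set r : R | 0 < r]].
Proof. by move=> uM; apply/cvg_lim => //; exact: (sup_ecball_cvg uM). Qed.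

Lemma usc_envelope_le u x (M e : R) : (forall y, `|u y| <= M) -> 0 < e ->
  exists2 r, 0 < r & forall y, `|y - x| < r -> u y < usc_envelope u x + e.
Proof.
move=> uM e0; rewrite (usc_envelope_cvg x uM).
have hs (r : R) : 0 < r -> has_sup (u @` ecball x r).
  move=> r0; split.
    by exists (u x), x => //; rewrite /ecball /= subrr enorm0 ltW.
  by exists M => _ [y _ <-]; rewrite (le_trans (ler_norm _)).
set E := [set _ | _ in _]; have hE : has_inf E.
  split; first by exists (sup (u @` ecball x 1)), 1 => /=.
  exists (- M) => _ [r r0 <-]; apply: (@le_trans _ _ (u x)).
    by have := uM x; rewrite ler_norml => /andP[].
  apply: sup_upper_bound; first exact: hs.
  by exists x => //; rewrite /ecball /= subrr enorm0 ltW.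
have [_ [r /= r0 <-] rE] := inf_adherent e0 hE.
(* The sup-norm ball of radius [r / (n + 1)] lies in the Euclidean ball of radius [r]. *)
exists (r / n.+1%:R); first by rewrite divr_gt0.
move=> y yr; apply: le_lt_trans rE; apply: sup_upper_bound; first exact: hs.
exists y => //; rewrite /ecball /= (le_trans (enorm_le_norm _))//.
by rewrite mulrC -ler_pdivlMr// ltW.
Qed.

Lemma usc_envelope_approx u x (M e r : R) : (forall y, `|u y| <= M) ->
  0 < e -> 0 < r -> exists2 y, `|y - x| < r & usc_envelope u x - e < u y.
Proof.
move=> uM e0 r0; rewrite (usc_envelope_cvg x uM).
have r2 : 0 < r / 2 by rewrite divr_gt0.
have hs : has_sup (u @` ecball x (r / 2)).
  split.
    by exists (u x), x => //; rewrite /ecball /= subrr enorm0 ltW.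
  by exists M => _ [y _ <-]; rewrite (le_trans (ler_norm _)).
have [_ [y /= xy <-] hy] := sup_adherent e0 hs.
exists y.
  rewrite (le_lt_trans (norm_le_enorm _))// (le_lt_trans xy)//.
  by rewrite ltr_pdivrMr// ltr_pMr// ltr1n.
apply: le_lt_trans hy; rewrite lerD2r; apply: ge_inf; last by exists (r / 2).
exists (- M) => _ [s /= s0 <-]; apply: (@le_trans _ _ (u x)).
  by have := uM x; rewrite ler_norml => /andP[].
apply: sup_upper_bound; last by exists x => //; rewrite /ecball /= subrr enorm0 ltW.
split; first by exists (u x), x => //; rewrite /ecball /= subrr enorm0 ltW.
by exists M => _ [y' _ <-]; rewrite (le_trans (ler_norm _)).
Qed.

Lemma le_usc_envelope u x (M : R) : (forall y, `|u y| <= M) -> u x <= usc_envelope u x.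
Proof.
move=> uM; apply/ler_addgt0Pr => e e0.
have [r r0 /(_ x)] := usc_envelope_le x uM e0.
by rewrite subrr normr0 => /(_ r0)/ltW.
Qed.

Lemma usc_usc_envelope u (M : R) : (forall y, `|u y| <= M) -> usc (usc_envelope u).
Proof.
move=> uM x a xa; pose e := (a - usc_envelope u x) / 2.
have e0 : 0 < e by rewrite divr_gt0// subr_gt0.
have [r r0 hr] := usc_envelope_le x uM e0.
have r2 : 0 < r / 2 by rewrite divr_gt0.
exists (r / 2); first exact: r2.
move=> y yr; have e2 : 0 < e / 2 := divr_gt0 e0 (ltr0Sn _ 1).
have [z zy hz] := usc_envelope_approx y uM e2 r2.
have : u z < usc_envelope u x + e.
  apply: hr; rewrite -(subrK y z) -addrA (le_lt_trans (ler_normD _ _))//.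
  by rewrite [ltRHS]splitr ltrD.
move: hz e0; rewrite /e; move: (usc_envelope u x) (usc_envelope u y) => A B.
lra.
Qed.

Lemma usc_envelope_bounded u (M : R) : (forall y, `|u y| <= M) ->
  forall x, `|usc_envelope u x| <= M.
Proof.
move=> uM x; rewrite ler_norml; apply/andP; split.
  apply: le_trans (le_usc_envelope x uM).
  by have := uM x; rewrite ler_norml => /andP[].
apply/ler_addgt0Pr => e e0; have [y _ hy] := usc_envelope_approx x uM e0 ltr01.
by have := uM y; rewrite ler_norml => /andP[_]; move: hy; lra.
Qed.

Lemma usc_envelope_le_continuous u (w : V -> R) (M : R) : (forall y, `|u y| <= M) ->
  continuous w -> (forall y, u y <= w y) -> forall x, usc_envelope u x <= w x.
Proof.
move=> uM /continuous_rVP cw uw x; apply/ler_addgt0Pr => e e0.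
have e2 : 0 < e / 2 by rewrite divr_gt0.
have [r r0 hr] := cw x _ e2.
have [y yr hy] := usc_envelope_approx x uM e2 r0.
have := hr y yr; rewrite ltr_norml => /andP[_]; have := uw y; move: hy; lra.
Qed.

Lemma lsc_envelopeE u x (M : R) : (forall y, `|u y| <= M) ->
  lsc_envelope u x = - usc_envelope (\- u) x.
Proof.
move=> uM; have NuM y : `|(\- u) y| <= M by rewrite /= normrN.
have /cvgN := @sup_ecball_cvg (\- u) x M NuM; rewrite -(usc_envelope_cvg x NuM) => h.
rewrite /lsc_envelope; have -> : (fun r : R => inf (u @` ecball x r)) =
    (fun r => - sup ((\- u) @` ecball x r)).
  by apply/funext => r; rewrite /inf image_comp.
exact/cvg_lim.
Qed.

Lemma usc_max (u w : V -> R) : usc u -> usc w -> usc (fun x => Num.max (u x) (w x)).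
Proof.
move=> uu uw x a; rewrite gt_max => /andP[ux wx].
have [r r0 hr] := uu x a ux; have [s s0 hs] := uw x a wx.
exists (Num.min r s); first by rewrite lt_min r0.
move=> y; rewrite lt_min gt_max => /andP[yr ys].
by rewrite (hr y yr) (hs y ys).
Qed.

(** If the supremum [S] were not attained, the sets [w < a] with [a < S] would cover [D];
    compactness then yields a single [a < S] bounding [w] on [D]. *)
Lemma usc_max_compact (w : V -> R) (D : set V) (M : R) : usc w -> compact D ->
  D !=set0 -> (forall y, w y <= M) -> exists2 x, D x & forall y, D y -> w y <= w x.
Proof.
move=> uw cD [x0 Dx0] wM; apply: contrapT => h.
have hs : has_sup (w @` D).
  by split; [exists (w x0), x0|exists M => _ [y _ <-]].
pose S := sup (w @` D).
have lt x : D x -> w x < S.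
  move=> Dx; rewrite lt_neqAle (sup_upper_bound hs) ?andbT; last by exists x.
  apply/eqP => wS; apply: h; exists x => // y Dy; rewrite wS.
  by apply: (sup_upper_bound hs); exists y.
have /compact_near_coveringP/(_ R (S^'-) (fun a y => w y < a)) := cD.
have cover x : D x -> \forall y \near x & a \near S^'-, w y < a.
  move=> /lt wS; pose m := (w x + S) / 2.
  have wm : w x < m by rewrite /m; lra.
  have mS : m < S by rewrite /m; lra.
  have [r r0 hr] := uw x m wm.
  exists ([set y | `|y - x| < r], [set a | m < a]).
    by split; [apply/nbhs_rVP; exists r|exact: nbhs_left_gt].
  by move=> [y a] [/= /hr wy ma]; exact: lt_trans ma.
move=> /(_ _ cover) near_a.
have [a [Da aS]] : exists a, (D `<=` (fun y => w y < a)) /\ a < S.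
  near S^'- => a; exists a; split; first by near: a.
  by near: a; exact: nbhs_left_lt.
suff : S <= a by rewrite leNgt aS.
apply: ge_sup; first by exists (w x0), x0.
by move=> _ [y Dy <-]; exact/ltW/Da.
Unshelve. all: by end_near. Qed.

End envelopes.

(** * Perron's method for a sup-inf of a real-valued family *)

Section perron.
Context {R : realType} {n : nat}.
Local Notation V := 'rV[R]_n.+1.
Implicit Types (u w phi chi : V -> R) (x y z : V).

Lemma bump_ge x y (rho : R) : 0 <= rho -> rho <= `|y - x| ->
  hump rho <= bumpV x 1 y.
Proof.
move=> r0 yx; have [i ri] : exists i, rho <= `|y ord0 i - x ord0 i|.
  apply: contrapT => h; move: yx; apply/negP; rewrite -ltNge.
  have [rho0|rho0] := ltP 0 rho; last first.
    by exfalso; apply: h; exists ord0; rewrite (le_trans rho0).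
  rewrite [ltLHS]mx_normrE; apply: bigmax_lt => //= -[i j] _ /=.
  rewrite (ord1 i) !mxE ltNge; apply/negP => rj; apply: h; exists j.
  by move: rj.
apply: (@le_trans _ _ (hump ((y ord0 i - x ord0 i) / 1))).
  rewrite divr1 /hump ler_pdivlMr ?ltr_pwDl ?sqr_ge0//.
  rewrite mulrAC ler_pdivrMr ?ltr_pwDl ?sqr_ge0//.
  have : rho ^+ 2 <= (y ord0 i - x ord0 i) ^+ 2.
    rewrite -[leRHS]real_normK ?num_real// lerXn2r ?nnegrE//.
  by nra.
rewrite /bumpV (bigD1 i)//= lerDl; apply: sumr_ge0 => j _; exact: hump_ge0.
Qed.

Lemma hump_gt0 (t : R) : 0 < t -> 0 < hump t.
Proof. by move=> t0; rewrite divr_gt0 ?ltr_pwDl ?sqr_ge0// exprn_gt0. Qed.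

(** The family of test functions along which continuity of [X] is required. The bump makes a maximum
    strict or lets a lift fade away from [x]; the shift [c] may be arbitrary because increments and
    gradients do not see constants. *)
Definition perturb phi x (k c : R) y : R := phi y + k * bumpV x 1 y + c.

Lemma C2b_perturb phi x k c : C2b phi -> C2b (perturb phi x k c).
Proof. by move=> C2; have [] := C2b_lincomb k c C2 (C2b_bump x ltr01). Qed.

(* If w nearly touches phi from above at x, then it exactly touches a small
   perturbation of phi, at a point near x. *)
Lemma perturbed_max phi x (s d : R) : C2b phi -> 0 < d ->
  exists t r, [/\ 0 < t, 0 < r & forall w, usc w ->
    (forall z, w z - phi z <= s - phi x) ->
    (exists2 y, `|y - x| < r & s - t < w y) ->
    exists y k, [/\ `|y - x| < d, `|w y - s| < d, 0 <= k <= d &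
      forall z, w z - perturb phi x k 0 z <= w y - perturb phi x k 0 y]].
Proof.
move=> C2 d0; have /continuous_rVP cphi := C2b_continuous C2.
have /continuous_rVP cb := C2b_continuous (C2b_bump x ltr01).
have d4 : 0 < d / 4 by rewrite divr_gt0.
have [r1 r10 h1] := cphi x _ d4.
pose rho := Num.min r1 d / 2.
have rd0 : 0 < Num.min r1 d by rewrite lt_min r10.
have rho0 : 0 < rho by rewrite divr_gt0.
have rhom : rho < Num.min r1 d by rewrite ltr_pdivrMr// ltr_pMr// ltr1n.
have /andP[rho1 rhod] : (rho < r1) && (rho < d) by rewrite -lt_min.
pose k := Num.min d (d / 4 / n.+1%:R).
have k0 : 0 < k by rewrite lt_min d0 divr_gt0.
have kd : k <= d by rewrite ge_min lexx.
have kn z : 0 <= k * bumpV x 1 z <= d / 4.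
  rewrite mulr_ge0 ?bump_ge0 ?(ltW k0)//=.
  rewrite (@le_trans _ _ (k * n.+1%:R))//.
    by rewrite ler_wpM2l ?(ltW k0)// bump_le.
  by rewrite -ler_pdivlMr// ge_min lexx orbT.
(* At [y1] at most three errors of size [t] occur, from [w], [phi] and the bump, while beyond
   distance [rho] the bump costs at least [4 t]. Hence the maximum over the compact [rho]-ball is
   global. *)
pose t := Num.min (d / 12) (k * hump rho / 4).
have t0 : 0 < t by rewrite lt_min !divr_gt0// mulr_gt0// hump_gt0.
have td : t <= d / 12 by rewrite ge_min lexx.
have tk : t <= k * hump rho / 4 by rewrite ge_min lexx orbT.
have [r2 r20 h2] := cphi x _ t0.
have tk0 : 0 < t / k by rewrite divr_gt0.
have [r3 r30 h3] := cb x _ tk0.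
exists t, (Num.min rho (Num.min r2 r3)); split=> //.
  by rewrite !lt_min rho0 r20.
move=> w uw wphi [y1]; rewrite !lt_min => /andP[y1r /andP[y12 y13]] wy1.
set psi := perturb phi x k 0.
have cpsi := C2b_continuous (C2b_perturb x k 0 C2).
have [M' M'0 hM'] := C2b_bounded (C2b_perturb x k 0 C2).
have y1m : s - phi x - 3 * t < w y1 - psi y1.
  have := h2 _ y12; rewrite ltr_norml => /andP[_ e1].
  have := h3 _ y13; rewrite bump_center subr0 ger0_norm ?bump_ge0//.
  rewrite ltr_pdivlMr// mulrC => e2.
  by rewrite /psi /perturb addr0; move: e1 e2 wy1; lra.
pose D : set V := [set z | `|z - x| <= rho].
have cD : compact D.
  apply: bounded_closed_compact.
    exists (`|x| + rho); split; first exact: num_real.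
    move=> N xN z /= zr; rewrite (le_trans _ (ltW xN))//.
    by rewrite -(subrK x z) addrC (le_trans (ler_normD _ _))// lerD2l.
  have -> : D = (fun z : V => `|z - x|) @^-1` `]-oo, rho]%classic.
    by apply/seteqP; split=> z; rewrite /= in_itv.
  apply: preimage_closed; last exact: interval_closed.
  move=> z _; apply: lipschitz_at_continuous => {}z.
  exists 1, 1; split=> // z' _; rewrite mul1r (le_trans (ler_dist_dist _ _))//.
  by rewrite opprB addrA subrK.
have uwp : usc (fun z => w z - psi z).
  move=> z a wa; pose e := (a - (w z - psi z)) / 2.
  have e0 : 0 < e by rewrite divr_gt0// subr_gt0.
  have [|ra ra0 ha] := uw z (w z + e); first by rewrite ltrDl.
  have [rb rb0 hb] := (continuous_rVP _).1 cpsi z _ e0.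
  exists (Num.min ra rb); first by rewrite lt_min ra0.
  move=> z'; rewrite lt_min => /andP[/ha e1 /hb].
  rewrite -/psi ltr_norml => /andP[e2 _].
  by move: e1 e2; rewrite /e; lra.
have [|z|y Dy ymax] := usc_max_compact (M := s - phi x + `|phi x| + 0) uwp cD.
- by exists y1; exact: ltW.
- have := wphi z; have /andP[] := kn z; rewrite /psi /perturb addr0.
  by have := normr_ge0 (phi x); lra.
have y1y : w y1 - psi y1 <= w y - psi y by apply: ymax; exact: ltW.
exists y, k; split.
- exact: le_lt_trans Dy rhod.
- have Dy' : `|y - x| < r1 := le_lt_trans Dy rho1.
  have := h1 _ Dy'; rewrite ltr_norml => /andP[e1 e2].
  have /andP[e3 e4] := kn y; have e5 := wphi y.
  have py : psi y = phi y + k * bumpV x 1 y by rewrite /psi /perturb addr0.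
  move: y1m y1y; rewrite py ltr_norml => e6 e7.
  by apply/andP; split; lra.
- by rewrite (ltW k0).
- move=> z; have [zr|zr] := leP `|z - x| rho; first exact: ymax.
  apply: le_trans y1y; apply/ltW; apply: le_lt_trans y1m.
  have := bump_ge (ltW rho0) (ltW zr); rewrite -(ler_pM2l k0) => e1.
  by have := wphi z; rewrite /psi /perturb addr0; move: e1 tk t0; lra.
Qed.

Variables (I J : Type) (X : I -> J -> V -> R -> (V -> R) -> R).
Variables (F : V -> R -> (V -> R) -> \bar R) (Omega : set V) (g : V -> R).
Hypothesis oOmega : open Omega.
Hypothesis FE : forall x s phi, Omega x -> C2b phi ->
  F x s phi = ereal_sup [set ereal_inf [set (X i j x s phi)%:E | j in [set: J]]
                        | i in [set: I]].
Hypothesis X_continuous : forall phi x (s e : R), C2b phi -> Omega x -> 0 < e ->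
  exists2 d, 0 < d & forall y t k c, Omega y -> `|y - x| < d -> `|t - s| < d ->
    `|k| <= d -> forall i j,
    `|X i j y t (perturb phi x k c) - X i j x s phi| <= e.
Hypothesis X_elliptic : forall phi chi y s i j, C2b phi -> C2b chi -> Omega y ->
  (forall z, phi z - chi z <= phi y - chi y) -> X i j y s chi <= X i j y s phi.

(** A strict sign of the sup-inf is converted into a real margin uniform in [j], which the uniform
    modulus [X_continuous] can absorb at nearby points. *)
Lemma F_gt0 x s phi : Omega x -> C2b phi -> (0 < F x s phi)%E ->
  exists i e, 0 < e /\ forall j, e < X i j x s phi.
Proof.
move=> Ox C2; rewrite FE// => /ereal_sup_gt[_ [i _ <-]] h; exists i.
set E := ereal_inf _ in h.
have [e [e0 eE]] : exists e : R, 0 < e /\ (e%:E < E)%E.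
  case: E h => [r||//]; last by exists 1; rewrite ltry.
  by rewrite lte_fin => r0; exists (r / 2); rewrite lte_fin divr_gt0// ltr_pdivrMr// ltr_pMr// ltr1n.
exists e; split=> // j; rewrite -lte_fin; apply: lt_le_trans eE _.
by apply: ereal_inf_lbound; exists j.
Qed.

Lemma F_lt0 x s phi : Omega x -> C2b phi -> (F x s phi < 0)%E ->
  exists e, 0 < e /\ forall i, exists j, X i j x s phi < - e.
Proof.
move=> Ox C2; rewrite FE//; set E := ereal_sup _ => h.
have [e [e0 eE]] : exists e : R, 0 < e /\ (E < (- e)%:E)%E.
  case: E h => [r|//|]; last by exists 1; rewrite ltNyr.
  rewrite lte_fin => r0; exists (- r / 2); rewrite lte_fin; split; lra.
exists e; split=> // i.
have : (ereal_inf [set (X i j x s phi)%:E | j in [set: J]] < (- e)%:E)%E.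
  by apply: le_lt_trans eE; apply: ereal_sup_ubound; exists i.
by move=> /ereal_inf_lt[_ [j _ <-]]; rewrite lte_fin; exists j.
Qed.

Lemma F_le x s phi (r : R) : Omega x -> C2b phi ->
  (forall i, exists j, X i j x s phi <= r) -> (F x s phi <= r%:E)%E.
Proof.
move=> Ox C2 h; rewrite FE//; apply: ge_ereal_sup => _ [i _ <-].
have [j hj] := h i; apply: (@le_trans _ _ (X i j x s phi)%:E).
  by apply: ereal_inf_lbound; exists j.
by rewrite lee_fin.
Qed.

Lemma F_ge x s phi (r : R) i : Omega x -> C2b phi ->
  (forall j, r <= X i j x s phi) -> (r%:E <= F x s phi)%E.
Proof.
move=> Ox C2 h; rewrite FE//; apply: (@le_trans _ _
  (ereal_inf [set (X i j x s phi)%:E | j in [set: J]])).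
  by apply: le_ereal_inf_tmp => _ [j _ <-]; rewrite lee_fin.
by apply: ereal_sup_ubound; exists i.
Qed.

Definition subtest w := forall phi x, C2b phi -> Omega x ->
  (forall y, w y - phi y <= w x - phi x) -> (F x (w x) phi <= 0)%E.

Definition supertest w := forall phi x, C2b phi -> Omega x ->
  (forall y, w x - phi x <= w y - phi y) -> (0 <= F x (w x) phi)%E.

Definition bounded_by_norm w := exists M, forall x : V, `|w x| <= M.

Definition upper_barrier w :=
  [/\ continuous w, bounded_by_norm w, supertest w & forall x, g x <= w x].

Definition lower_barrier w :=
  [/\ continuous w, bounded_by_norm w, subtest w & forall x, w x <= g x].

Hypothesis upper_barriers : forall x (e : R), ~ Omega x -> 0 < e ->
  exists2 w, upper_barrier w & w x <= g x + e.
Hypothesis lower_barriers : forall x (e : R), ~ Omega x -> 0 < e ->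
  exists2 w, lower_barrier w & g x - e <= w x.
Hypothesis Omega_proper : exists x, ~ Omega x.

Definition admissible w := [/\ usc w, bounded_by_norm w, subtest w &
  forall w', upper_barrier w' -> forall x, w x <= w' x].

Definition perron_solution x : R := sup [set w x | w in admissible].

Local Notation u := perron_solution.

Lemma continuous_usc w : continuous w -> usc w.
Proof.
move=> /continuous_rVP cw x a wa; have e0 : 0 < a - w x by rewrite subr_gt0.
have [r r0 hr] := cw x _ e0; exists r => // y /hr.
by rewrite ltr_norml => /andP[_]; lra.
Qed.

Lemma lower_barrier_admissible w : lower_barrier w -> admissible w.
Proof.
move=> [cw bw sw wg]; split=> //; first exact: continuous_usc.
by move=> w' [_ _ _ gw'] x; exact: le_trans (gw' x).
Qed.

(** Barriers are supplied at points outside [Omega]; one such point gives both an admissible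
    function and an upper bound valid everywhere. *)
Lemma perron_has_sup x : has_sup [set w x | w in admissible].
Proof.
have [x0 Ox0] := Omega_proper; split.
  have [w /lower_barrier_admissible aw _] := lower_barriers Ox0 ltr01.
  by exists (w x), w.
have [w' uw' _] := upper_barriers Ox0 ltr01.
by exists (w' x) => _ [w [_ _ _ hw] <-]; exact: hw.
Qed.

Lemma admissible_le w x : admissible w -> w x <= u x.
Proof. by move=> aw; apply: (sup_upper_bound (perron_has_sup x)); exists w. Qed.

Lemma perron_le w x : upper_barrier w -> u x <= w x.
Proof.
move=> uw; apply: ge_sup; first by case: (perron_has_sup x).
by move=> _ [w' [_ _ _ hw'] <-]; exact: hw'.
Qed.

Lemma perron_bounded : bounded_by_norm u.
Proof.
have [x0 Ox0] := Omega_proper.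
have [w lw _] := lower_barriers Ox0 ltr01.
have [w' uw' _] := upper_barriers Ox0 ltr01.
have [_ [M hM] _ _] := lw; have [_ [M' hM'] _ _] := uw'.
exists (Num.max M M') => x; rewrite ler_norml; apply/andP; split.
  apply: (@le_trans _ _ (w x)).
    rewrite lerNl le_max (le_trans _ (hM x))// -normrN ler_norm//.
  exact: admissible_le (lower_barrier_admissible lw).
apply: (le_trans (perron_le x uw')).
by rewrite le_max (le_trans (ler_norm _) (hM' x)) orbT.
Qed.

Lemma Omega_ball x : Omega x -> exists2 r, 0 < r & forall y, `|y - x| < r -> Omega y.
Proof. by move=> Ox; apply/nbhs_rVP; exact: open_nbhs_nbhs. Qed.

(** If the operator were positive at a touching point, some admissible [w] nearly reaches the
    envelope at a nearby point. By [perturbed_max] it exactly touches a perturbation of [phi] close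
    to [x], where continuity keeps the operator positive, although [w] is a subsolution. *)
Lemma usc_envelope_subtest : subtest (usc_envelope u).
Proof.
have [M uM] := perron_bounded; set us := usc_envelope u.
move=> phi x C2 Ox touch; rewrite leNgt; apply/negP => F0.
have [i [e [e0 he]]] := F_gt0 Ox C2 F0.
have e2 : 0 < e / 2 by rewrite divr_gt0.
have [d d0 hd] := X_continuous (us x) C2 Ox e2.
have [r r0 hr] := Omega_ball Ox.
have m0 : 0 < Num.min d r by rewrite lt_min d0.
have [t [s [t0 s0 hts]]] := perturbed_max x (us x) C2 m0.
have t2 : 0 < t / 2 by rewrite divr_gt0.
have [y1 y1s hy1] := usc_envelope_approx x uM t2 s0.
have [_ [w aw <-] hw] := sup_adherent t2 (perron_has_sup y1).
have [uw bw sw _] := aw.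
have wtouch z : w z - phi z <= us x - phi x.
  apply: le_trans (touch z); rewrite lerD2r.
  by rewrite (le_trans (admissible_le z aw))// (le_usc_envelope z uM).
have close : us x - t < w y1.
  move: hy1 hw; rewrite -/(u y1) -/us; move: (us x) (u y1) => A B; lra.
have [y [k [yd wyd /andP[k0 kd] hmax]]] := hts w uw wtouch (ex_intro2 _ _ y1 y1s close).
have [yd' yr] : `|y - x| < d /\ `|y - x| < r by apply/andP; rewrite -lt_min.
have Oy := hr y yr; have C2p := C2b_perturb x k 0 C2.
have := sw _ y C2p Oy hmax; apply/negP; rewrite -ltNge.
apply: (@lt_le_trans _ _ (e / 2)%:E); first by rewrite lte_fin.
apply: (F_ge (i := i) Oy C2p) => j.
have := hd y (w y) k 0 Oy yd' (lt_le_trans wyd _) _ i j.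
rewrite ge_min lexx => /(_ isT); rewrite ger0_norm// (le_trans kd) ?ge_min ?lexx//.
by move=> /(_ isT); rewrite ler_norml => /andP[+ _]; have := he j; lra.
Qed.

Lemma usc_envelope_admissible : admissible (usc_envelope u).
Proof.
have [M uM] := perron_bounded; split.
- exact: usc_usc_envelope uM.
- by exists M; exact: usc_envelope_bounded.
- exact: usc_envelope_subtest.
- move=> w uw x; have [cw _ _ _] := uw.
  by apply: (usc_envelope_le_continuous uM cw) => y; exact: perron_le.
Qed.

(* If the lower envelope failed to be a supersolution at x, lifting a slightly
   lowered test function would produce an admissible function above u. *)
Lemma lsc_envelope_supertest : supertest (lsc_envelope u).
Proof.
have [M uM] := perron_bounded.
have NuM y : `|(\- u) y| <= M by rewrite /= normrN.
have lE x := lsc_envelopeE x uM.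
set ul := lsc_envelope u; set us := usc_envelope u.
have ul_le y : ul y <= u y.
  by rewrite /ul lE lerNl; exact: (le_usc_envelope y NuM).
move=> phi x C2 Ox touch; rewrite leNgt; apply/negP => F0.
have [e [e0 he]] := F_lt0 Ox C2 F0.
have e2 : 0 < e / 2 by rewrite divr_gt0.
have [d d0 hd] := X_continuous (ul x) C2 Ox e2.
have [r0 r00 hr0] := Omega_ball Ox.
set s := ul x in touch he hd *.
have m0 : 0 < Num.min d r0 by rewrite lt_min d0.
have [C2N _] := C2bN C2.
have [t [r [t0 rr0 htr]]] := perturbed_max x (- s) C2N m0.
(* Room for the lift: an upper barrier below [s + t] near [x] would, by [perturbed_max] for its
   negative, touch a perturbation of [phi] from above at a point where the operator is negative. *)
have above w y : upper_barrier w -> `|y - x| < r -> s + t <= w y.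
  move=> uw yr; rewrite leNgt; apply/negP => wy.
  have [cw bw sw gw] := uw.
  have cNw := continuousN_rV cw.
  have wN z : (\- w) z - (\- phi) z <= - s - (\- phi) x.
    have := touch z; have := le_trans (ul_le z) (perron_le z uw).
    by rewrite /= !opprK; move: (ul z) (phi z) (phi x) => A B C; lra.
  have wyN : - s - t < (\- w) y by rewrite /=; lra.
  have [y' [k [y'd wy'd /andP[k0 kd] hmax]]] :=
    htr (\- w) (continuous_usc cNw) wN (ex_intro2 _ _ y yr wyN).
  have [yd' yr'] : `|y' - x| < d /\ `|y' - x| < r0 by apply/andP; rewrite -lt_min.
  have Oy := hr0 y' yr'; have C2p := C2b_perturb x (- k) 0 C2.
  have : (0 <= F y' (w y') (perturb phi x (- k) 0))%E.
    apply: sw => // z; have := hmax z.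
    rewrite /perturb /= !mulNr; lra.
  apply/negP; rewrite -ltNge; apply: (@le_lt_trans _ _ (- (e / 2))%:E); last first.
    by rewrite lte_fin oppr_lt0.
  apply: (F_le Oy C2p) => i; have [j hj] := he i; exists j.
  have ws : `|w y' - s| < d.
    by move: wy'd; rewrite /= opprK addrC distrC lt_min => /andP[].
  have := hd y' (w y') (- k) 0 Oy yd' ws _ i j.
  rewrite normrN ger0_norm// (le_trans kd) ?ge_min ?lexx// => /(_ isT).
  by rewrite ler_norml => /andP[_]; lra.
have /continuous_rVP cphi := C2b_continuous C2.
have /continuous_rVP cb := C2b_continuous (C2b_bump x ltr01).
have a0 : 0 < Num.min (t / 2) (d / 2) by rewrite lt_min !divr_gt0.
have [r1 r10 h1] := cphi x _ a0.
pose rho := Num.min (Num.min r r1) (Num.min d r0).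
have rho0 : 0 < rho by rewrite !lt_min rr0 r10 d0.
pose k := Num.min d (d / 4 / n.+1%:R).
have k0 : 0 < k by rewrite lt_min d0 !divr_gt0.
have kd : k <= d by rewrite ge_min lexx.
have kn z : 0 <= k * bumpV x 1 z <= d / 4.
  rewrite mulr_ge0 ?bump_ge0 ?(ltW k0)//=.
  rewrite (@le_trans _ _ (k * n.+1%:R))//.
    by rewrite ler_wpM2l ?(ltW k0)// bump_le.
  by rewrite -ler_pdivlMr// ge_min lexx orbT.
(* The lift is at most [k * hump rho], so [psi] stays below [u] outside the [rho]-ball; at most
   [t / 2], so it stays below the barriers inside; at most [d / 4], so [X_continuous] applies to
   it. *)
pose tau := Num.min (k * hump rho) (Num.min (t / 2) (d / 4)).
have tau0 : 0 < tau by rewrite !lt_min !divr_gt0// mulr_gt0// hump_gt0.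
have tauk : tau <= k * hump rho by rewrite ge_min lexx.
have taut : tau <= t / 2 by rewrite !ge_min lexx orbT.
have taud : tau <= d / 4 by rewrite !ge_min lexx !orbT.
pose psi := perturb phi x (- k) (s - phi x + tau).
have C2psi : C2b psi by exact: C2b_perturb.
have psiE z : psi z = phi z - k * bumpV x 1 z + (s - phi x + tau).
  by rewrite /psi /perturb mulNr.
have far z : rho <= `|z - x| -> psi z <= u z.
  move=> zr; have := bump_ge (ltW rho0) zr; rewrite -(ler_pM2l k0) => e1.
  have e3 := touch z; have e4 := ul_le z; rewrite psiE.
  by move: e1 e3 e4 tauk; move: (ul z) (u z) => A B; lra.
have near_s z : `|z - x| < rho -> `|psi z - s| < d /\ psi z <= s + t.
  rewrite !lt_min => /andP[/andP[zr zr1] _].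
  have := h1 _ zr1; rewrite lt_min !ltr_norml => /andP[/andP[e1 e3] /andP[e4 e5]].
  have /andP[e6 e7] := kn z; rewrite psiE; split; last by lra.
  by apply/andP; split; lra.
pose w z := Num.max (us z) (psi z).
have adm : admissible w.
  have [uus [M1 bus] sus usw] := usc_envelope_admissible.
  have [M2 M20 bpsi] := C2b_bounded C2psi.
  split.
  - exact: (usc_max uus (continuous_usc (C2b_continuous C2psi))).
  - exists (Num.max M1 M2) => z; rewrite /w; case: (leP (us z) (psi z)) => _.
      by rewrite le_max bpsi orbT.
    by rewrite le_max bus.
  - move=> chi y C2c Oy wtouch.
    have [le|lt] := leP (psi y) (us y).
      have wy : w y = us y by rewrite /w max_l.
      rewrite wy; apply: (sus chi y C2c Oy) => z; rewrite -/us -wy.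
      by apply: le_trans (wtouch z); rewrite lerD2r /w le_max lexx.
    have wy : w y = psi y by rewrite /w max_r// ltW.
    have yrho : `|y - x| < rho.
      rewrite ltNge; apply/negP => /far h.
      have := le_trans h (le_usc_envelope y uM); rewrite -/us leNgt lt.
      by [].
    have yd : `|y - x| < d.
      by move: yrho; rewrite /rho !lt_min => /andP[_ /andP[]].
    rewrite wy; apply: F_le => // i; have [j hj] := he i; exists j.
    have E : X i j y (psi y) chi <= X i j y (psi y) psi.
      apply: X_elliptic => // z; rewrite -wy.
      by apply: le_trans (wtouch z); rewrite lerD2r /w le_max lexx orbT.
    apply: le_trans E _.
    have [ps _] := near_s y yrho.
    have := hd y (psi y) (- k) (s - phi x + tau) Oy yd ps _ i j.
    rewrite normrN ger0_norm ?(ltW k0)// kd => /(_ isT).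
    by rewrite -/psi ler_norml => /andP[_]; lra.
  - move=> w' uw' z; rewrite /w ge_max usw//=.
    have [zr|zr] := ltP `|z - x| rho.
      have [_ h] := near_s z zr; apply: le_trans h (above w' z uw' _).
      by move: zr; rewrite /rho !lt_min => /andP[/andP[]].
    exact: le_trans (far z zr) (perron_le z uw').
(* Arbitrarily close to [x] there are points with [u] below [s + tau / 4], while [psi] exceeds
   [s + tau / 2] near [x]. This contradicts [psi <= w <= u]. *)
have t4 : 0 < tau / 4 by rewrite divr_gt0.
have tk : 0 < tau / 4 / k by rewrite divr_gt0.
have [ra ra0 ha] := cphi x _ t4; have [rb rb0 hb] := cb x _ tk.
have mr : 0 < Num.min ra rb by rewrite lt_min ra0.
have [y] := usc_envelope_approx x NuM t4 mr.
rewrite lt_min => /andP[ya yb].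
have : w y <= u y by exact: admissible_le.
have psiw : psi y <= w y by rewrite /w le_max lexx orbT.
have := ha y ya; rewrite ltr_norml => /andP[e1 _].
have := hb y yb; rewrite bump_center subr0 ger0_norm ?bump_ge0//.
rewrite ltr_pdivlMr// mulrC => e3 e4 e5.
have sE : usc_envelope (\- u) x = - s by rewrite /s /ul lE opprK.
move: psiw; rewrite psiE; move: e5 e4; rewrite sE /=; move: (u y) (w y) => A B.
lra.
Qed.

Lemma perron_solution_correct : discontinuous_viscosity_solution F Omega g u.
Proof.
have [M uM] := perron_bounded.
have NuM y : `|(\- u) y| <= M by rewrite /= normrN.
have M0 : 0 < `|M| + 1 by rewrite ltr_wpDl.
have bnd w : (forall y, `|w y| <= M) -> [bounded w x | x in setT].
  move=> wM; apply/boundedP; exists (`|M| + 1) => // y.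
  by rewrite (le_trans (wM y))// (le_trans (ler_norm M))// lerDl.
have lE : lsc_envelope u = \- usc_envelope (\- u).
  by apply/funext => x; rewrite (lsc_envelopeE x uM).
split; first exact: bnd.
- have [uus [_ _] sus usw] := usc_envelope_admissible; split.
    split=> //; last exact/uscP.
    by apply: bnd; exact: usc_envelope_bounded.
  move=> x Ox; apply/ler_addgt0Pr => e e0; have [w uw wx] := upper_barriers Ox e0.
  exact: le_trans (usw w uw x) wx.
- split.
    split; last exact: lsc_envelope_supertest.
      by apply: bnd => y; rewrite lE /= normrN; exact: usc_envelope_bounded.
    have := (uscP _).1 (usc_usc_envelope NuM).
    by rewrite lE.
  move=> x Ox; apply/ler_addgt0Pl => e e0; have [w lw wx] := lower_barriers Ox e0.
  have [cw _ _ _] := lw.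
  have cNw := continuousN_rV cw.
  have := usc_envelope_le_continuous NuM cNw _ x.
  have h y : (\- u) y <= (\- w) y.
    by rewrite /= lerN2; exact: admissible_le (lower_barrier_admissible lw).
  move=> /(_ h); rewrite lE /=; move: wx; lra.
Qed.

End perron.

(** * The barrier at a boundary point *)

Section powers.
Context {R : realType}.
Implicit Types (a b x t : R).

(** Young's inequality for [x^a * 1] with exponents [1/a] and [1/(1-a)]; [a = 1] is separate because
    the dual exponent degenerates. *)
Lemma powR_bernoulli a x : 0 < a <= 1 -> 0 <= x -> x `^ a <= 1 + a * (x - 1).
Proof.
move=> /andP[a0]; rewrite le_eqVlt => /predU1P[->|a1] x0.
  by rewrite powRr1// mul1r addrC subrK.
have b0 : 0 < 1 - a by rewrite subr_gt0.
have := @conjugate_powR R (x `^ a) 1 a^-1 (1 - a)^-1 (powR_ge0 _ _) ler01.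
rewrite !invrK !invr_gt0 -powRrM mulfV ?gt_eqF// powRr1// pow1R mulr1 mul1r.
by move=> /(_ a0 b0); rewrite addrC subrK => /(_ erefl); lra.
Qed.

Lemma powR_tangent a x b : 0 < a <= 1 -> 0 <= x -> 0 < b ->
  x `^ a <= b `^ a + a * b `^ a / b * (x - b).
Proof.
move=> a01 x0 b0; have xb : 0 <= x / b by rewrite divr_ge0// ltW.
have := powR_bernoulli a01 xb; rewrite -(ler_pM2r (powR_gt0 a b0)) -powRM ?(ltW b0)//.
rewrite divfK ?gt_eqF// => /le_trans; apply.
by rewrite le_eqVlt; apply/orP; left; apply/eqP; field; rewrite gt_eqF.
Qed.

(** Bernoulli's inequality for [x^b] with exponent [a / b]. The factor [a] on the right is what
    makes the growth of the profile at infinity of order [a]. *)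
Lemma powR_sub1_le a b x : 0 < a <= b -> 1 <= x -> x `^ a - 1 <= a / b * x `^ b.
Proof.
move=> /andP[a0 ab] x1; have b0 : 0 < b by exact: lt_le_trans ab.
have ab01 : 0 < a / b <= 1 by rewrite divr_gt0//= ler_pdivrMr// mul1r.
have := powR_bernoulli ab01 (powR_ge0 x b).
rewrite -powRrM mulrCA mulfV ?gt_eqF// mulr1 => h.
have := ltW (divr_gt0 a0 b0); move: h; lra.
Qed.

(** The fractions [x/(x+t)] and [t/(x+t)] sum to 1 and lie in the unit interval, where taking the
    power [a] only increases them. *)
Lemma powR_subadditive a x t : 0 < a <= 1 -> 0 <= x -> 0 <= t ->
  (x + t) `^ a <= x `^ a + t `^ a.
Proof.
move=> /andP[a0 a1] x0 t0; have [xt0|xt0] := eqVneq (x + t) 0.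
  by rewrite xt0 powR0 ?gt_eqF// addr_ge0 ?powR_ge0.
have {}xt0 : 0 < x + t by rewrite lt_neqAle eq_sym xt0 addr_ge0.
have frac y : 0 <= y -> y <= x + t -> y / (x + t) <= y `^ a / (x + t) `^ a.
  rewrite le_eqVlt => /predU1P[<- _|y0 yxt].
    by rewrite mul0r divr_ge0 ?powR_ge0.
  have h : 0 < y / (x + t) <= 1 by rewrite divr_gt0//= ler_pdivrMr// mul1r.
  apply: le_trans (ger1_powR h a1) _.
  rewrite powRM ?invr_ge0 ?(ltW y0) ?(ltW xt0)//.
  by rewrite -[(x + t)^-1]powR_inv1 ?(ltW xt0)// powRAC powR_inv1 ?powR_ge0.
have h1 := frac x x0; have h2 := frac t t0.
rewrite lerDl in h1; rewrite lerDr in h2.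
have := lerD (h1 t0) (h2 x0).
by rewrite -mulrDl mulfV ?gt_eqF// -mulrDl ler_pdivlMr ?powR_gt0// mul1r.
Qed.

Lemma powR_holder a x t : 0 < a <= 1 -> 0 <= x -> 0 <= t ->
  `|x `^ a - t `^ a| <= `|x - t| `^ a.
Proof.
move=> a01; wlog : x t / t <= x.
  move=> h x0 t0; have [tx|/ltW xt] := leP t x; first exact: h.
  by rewrite distrC (distrC x); exact: h.
move=> tx x0 t0; have /andP[a0 _] := a01.
rewrite !ger0_norm ?subr_ge0//; last first.
  by rewrite ge0_ler_powR ?nnegrE// ltW.
by rewrite lerBlDl -[X in X `^ a <= _](subrKC t) powR_subadditive ?subr_ge0.
Qed.

End powers.

Section profile.
Context {R : realType} {n : nat}.
Local Notation V := 'rV[R]_n.+1.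
Local Notation L := (lebesgue_space R n).
Local Notation mu := (lebesgue_rV R n).
Implicit Types (v z p : V).

Definition profile (r a : R) v : R := (Num.max 0 (enorm v / r - 1)) `^ a.

Lemma profile_ge0 r a v : 0 <= profile r a v.
Proof. exact: powR_ge0. Qed.

Lemma continuous_profile (r a : R) (x : V) : 0 < r -> 0 < a <= 1 ->
  continuous (fun y : V => profile r a (y - x)).
Proof.
move=> r0 a01; have /andP[a0 _] := a01; apply/continuous_rVP => y e e0.
have /continuous_rVP := @continuous_enormB R n x.
have e1 : 0 < r * e `^ a^-1 by rewrite mulr_gt0// powR_gt0.
move=> /(_ y _ e1)[d d0 hd]; exists d => // z zd.
have mx (t : R) : 0 <= Num.max 0 t by rewrite le_max lexx.
apply: le_lt_trans (powR_holder a01 (mx _) (mx _)) _.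
have /(gt0_ltr_powR a0) : `|Num.max 0 (enorm (z - x) / r - 1) -
    Num.max 0 (enorm (y - x) / r - 1)| < e `^ a^-1.
  apply: (@le_lt_trans _ _ (`|enorm (z - x) - enorm (y - x)| / r)); last first.
    by rewrite ltr_pdivrMr// mulrC; exact: hd.
  have -> : `|enorm (z - x) - enorm (y - x)| / r =
      `|enorm (z - x) / r - 1 - (enorm (y - x) / r - 1)|.
    rewrite opprB addrA subrK -mulrBl normrM normfV (gtr0_norm r0)//.
  move: (_ / r - 1) (_ / r - 1) => s t.
  have h1 := ler_norm (t - s); have h2 := ler_norm (s - t); rewrite distrC in h2.
  by case: (leP 0 s) => hs; case: (leP 0 t) => ht; rewrite ler_norml; apply/andP;
    split; lra.
rewrite -powRrM mulVf ?gt_eqF// powRr1 ?(ltW e0)//; apply.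
  by rewrite nnegrE.
by rewrite nnegrE powR_ge0.
Qed.

(** Equivalent to [(|v+z| - |v|)^2 >= 0], hence valid for every [z], small or not. *)
Lemma enorm_taylor v z : 0 < enorm v ->
  enorm (v + z) <= enorm v + dotp v z / enorm v + enorm z ^+ 2 / (2 * enorm v).
Proof.
move=> v0; have := sqr_ge0 (enorm (v + z) - enorm v).
rewrite sqrrB sqr_enormD => h.
rewrite -(ler_pM2r (mulr_gt0 (ltr0Sn R 1) v0)).
have -> : (enorm v + dotp v z / enorm v + enorm z ^+ 2 / (2 * enorm v)) *
  (2 * enorm v) = 2 * enorm v ^+ 2 + 2 * dotp v z + enorm z ^+ 2.
  by field; rewrite gt_eqF.
move: h; rewrite mulr2n; lra.
Qed.

Variables (r a s0 : R) (v : V).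
Hypotheses (r0 : 0 < r) (a01 : 0 < a <= 1) (s00 : 0 < s0).
Hypothesis vE : enorm v = r + r * s0.
Local Notation d := (r * s0).
Local Notation P0 := (profile r a v).
Local Notation nu := ((enorm v)^-1 *: v).

Let d0 : 0 < d. Proof. exact: mulr_gt0. Qed.

Let v0 : 0 < enorm v. Proof. by rewrite vE addr_gt0. Qed.

Lemma profileE : P0 = s0 `^ a.
Proof.
rewrite /profile vE (_ : (r + d) / r - 1 = s0) ?max_r ?ltW//.
by field; rewrite gt_eqF.
Qed.

Lemma profile_gt0 : 0 < P0.
Proof. by rewrite profileE powR_gt0. Qed.

(** By concavity the power lies below its tangent, so the second-order term comes from the norm
    alone and everything carries the factor [a] of the slope. *)
Lemma profile_taylor z : enorm z < d -> profile r a (v + z) - P0 <=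
  dotp ((a * P0 / d) *: nu) z + a * P0 / (2 * d ^+ 2) * enorm z ^+ 2.
Proof.
move=> zd; have /andP[a0 _] := a01.
(* Since [|z| < d], the point [v + z] stays outside the ball and the maximum with 0 is inactive. *)
have h0 : 0 < enorm (v + z) / r - 1.
  rewrite subr_gt0 ltr_pdivlMr// mul1r.
  have := enorm_sub v (- z); rewrite enormN opprK; move: zd; rewrite vE; lra.
rewrite {1}/profile max_r ?(ltW h0)//.
have := powR_tangent a01 (ltW h0) s00; rewrite -profileE => h.
have h1 := enorm_taylor z v0.
have h2 : enorm (v + z) / r - 1 - s0 <= (dotp v z / enorm v + enorm z ^+ 2 / (2 * d)) / r.
  have -> : enorm (v + z) / r - 1 - s0 = (enorm (v + z) - enorm v) / r.
    by rewrite vE; field; rewrite gt_eqF.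
  rewrite ler_pM2r ?invr_gt0// lerBlDl addrA (le_trans h1)// lerD2l.
  rewrite ler_wpM2l ?sqr_ge0// lef_pV2 ?posrE ?mulr_gt0// ler_pM2l// vE lerDr.
  exact: ltW.
have c0 : 0 < a * P0 / s0 by rewrite divr_gt0// mulr_gt0// profile_gt0.
have := ler_wpM2l (ltW c0) h2; move=> h3.
rewrite dotpZl dotpZl; set T := dotp v z in h2 h3 *.
have -> : a * P0 / d * ((enorm v)^-1 * T) + a * P0 / (2 * d ^+ 2) * enorm z ^+ 2 =
  a * P0 / s0 * ((T / enorm v + enorm z ^+ 2 / (2 * d)) / r).
  by field; rewrite !gt_eqF.
move: h h3; lra.
Qed.

Lemma profile_far z : profile r a (v + z) <= P0 * (1 + enorm z / d) `^ a.
Proof.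
have /andP[a0 _] := a01; have zd : 0 <= enorm z / d by rewrite divr_ge0 ?enorm_ge0 ?ltW.
have h : 0 <= 1 + enorm z / d by rewrite addr_ge0.
rewrite profileE -powRM ?(ltW s00)//.
apply: (ge0_ler_powR (ltW a0)).
- by rewrite nnegrE le_max lexx.
- by rewrite nnegrE mulr_ge0 ?(ltW s00).
rewrite ge_max mulr_ge0 ?(ltW s00)//=.
have -> : s0 * (1 + enorm z / d) = (r + d + enorm z) / r - 1.
  by field; rewrite !gt_eqF.
by rewrite lerD2r ler_pM2r ?invr_gt0// -vE enormD.
Qed.

(** A radial step of more than [d] brings the radial coordinate of [v + z] into [[-r, r]], so only
    the tangential part can leave the ball, by at most [(C d)^2 / (2 r)]. This is quadratic in [d],
    whereas [P0] corresponds to the full distance [d]. *)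
Lemma profile_behind (C : R) z : enorm z < C * d -> C * s0 <= 2 ->
  dotp z nu < - d -> profile r a (v + z) <= P0 * (C ^+ 2 * s0 / 2) `^ a.
Proof.
move=> zC Cs znu; have /andP[a0 _] := a01.
have C0 : 0 < C by rewrite -(pmulr_lgt0 _ d0) (le_lt_trans (enorm_ge0 z)).
rewrite profileE -powRM ?(ltW s00)//; last first.
  by rewrite divr_ge0// mulr_ge0 ?sqr_ge0// ltW.
apply: (ge0_ler_powR (ltW a0)).
- by rewrite nnegrE le_max lexx.
- by rewrite nnegrE mulr_ge0 ?(ltW s00)// divr_ge0// mulr_ge0 ?sqr_ge0// ltW.
rewrite ge_max; apply/andP; split.
  by rewrite mulr_ge0 ?(ltW s00)// divr_ge0// mulr_ge0 ?sqr_ge0// ltW.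
rewrite lerBlDl ler_pdivrMr// -ler_sqr ?nnegrE ?enorm_ge0//; last first.
  by rewrite mulr_ge0 ?(ltW r0)// addr_ge0// mulr_ge0 ?(ltW s00)// divr_ge0// mulr_ge0 ?sqr_ge0// ltW.
have aE : dotp v z = enorm v * dotp z nu.
  by rewrite dotpZr mulrA mulfV ?gt_eqF// mul1r dotpC.
have sz : `|dotp z nu| <= enorm z.
  apply: le_trans (normr_dotp _ _) _; rewrite enormZ ger0_norm ?invr_ge0 ?enorm_ge0//.
  by rewrite mulVf ?gt_eqF// mulr1.
(* This prevents [v + z] from leaving the ball on its opposite side: the radial coordinate
   [r + d + A] stays above [-r]. *)
have zr : enorm z <= 2 * r.
  by apply: (le_trans (ltW zC)); rewrite mulrCA mulrC ler_wpM2r// ltW.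
rewrite sqr_enormD; rewrite aE; move: znu sz zr zC; set A := dotp z nu; set Z := enorm z.
rewrite ler_norml => znu /andP[zA _] zr zC.
have Z2 : Z ^+ 2 <= (C * d) ^+ 2 by rewrite lerXn2r ?nnegrE ?enorm_ge0// ?ltW// mulr_gt0.
have rA : (r + d + A) ^+ 2 <= r ^+ 2.
  by have := d0; set D := r * _ in znu *; nra.
have E : (1 + s0 * (C ^+ 2 * s0 / 2)) * r = r + (C * d) ^+ 2 / (2 * r).
  by field; rewrite gt_eqF.
rewrite E vE; apply: (@le_trans _ _ (r ^+ 2 + (C * d) ^+ 2)).
  have := sqr_ge0 A; move: Z2 rA; set D := r * _; rewrite mulr2n; nra.
have : 0 <= ((C * d) ^+ 2 / (2 * r)) ^+ 2 by exact: sqr_ge0.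
have : r * ((C * d) ^+ 2 / (2 * r)) = (C * d) ^+ 2 / 2 by field; rewrite gt_eqF.
by set Q := _ / (2 * r); rewrite sqrrD; move=> h1 h2; rewrite mulr2n h1; lra.
Qed.

Section bounds.
Variables (sigma : R) (S : set L) (C : R) (m : nat).
Hypothesis s02 : 0 < sigma < 2.
Hypothesis aq : a <= far_exponent sigma.
Hypothesis s01 : s0 < 1.
Hypothesis r1 : r <= 1.
Hypothesis Cs : C * s0 <= 2.
Hypothesis Ca : (C ^+ 2 * s0 / 2) `^ a <= 2^-1.
Hypothesis Ssub : forall z, S z -> dotp z nu < - d /\ (d <= enorm z < C * d).
Hypothesis dm : 2^-1 ^+ m.+1 <= d < 2^-1 ^+ m.

Let a0 : 0 < a. Proof. by case/andP: a01. Qed.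
Let q0 := far_exponent_gt0 s02.
Let d1 : d < 1.
Proof. by rewrite (le_lt_trans _ s01)// ler_piMl// ltW. Qed.

Definition profile_grad : V := (a * P0 / d) *: nu.

(** The 2 accounts for the near field and for the gradient term, the second summand for the growth
    of the profile beyond distance [d]. *)
Definition profile_const : R := 2 + 2 `^ far_exponent sigma / far_exponent sigma.

Definition dyadic_shell (k : nat) : set L :=
  eball (0 : V) 1 `\` eball (0 : V) (2^-1 ^+ k).

(* For sigma = 1 the part of the gradient term between the dyadic scale of d
   and 1 is not absorbed by the weight: its integral vanishes by symmetry. *)
Definition shell_term z : R :=
  if sigma == 1 then - (\1_(dyadic_shell m) z * dotp profile_grad z) else 0.

(** The compensator of [increment] as a function of the gradient vector alone, which makes its
    linearity usable. *)
Definition gradient_term p z : R :=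
  if sigma < 1 then 0
  else if sigma == 1 then \1_(eball (0 : V) 1) z * dotp p z else dotp p z.

Let enorm_nu : enorm nu = 1.
Proof. by rewrite enormZ ger0_norm ?invr_ge0 ?enorm_ge0// mulVf// gt_eqF. Qed.

Lemma enorm_profile_grad : enorm profile_grad = a * P0 / d.
Proof.
rewrite enormZ enorm_nu mulr1 ger0_norm// divr_ge0 ?(ltW d0)// mulr_ge0 ?(ltW a0)//.
exact: profile_ge0.
Qed.

(** For [|z| < d] the Taylor bound applies, its linear part being cancelled by the compensator when
    [sigma >= 1]. For [|z| >= d] the profile grows by a multiple of [a], drops by half on [S], and
    the gradient is absorbed by the weight or left in [shell_term]. *)
Lemma profile_increment_le z :
  profile r a (v + z) - P0 - gradient_term profile_grad z <=
    a * P0 * profile_const * weight sigma d z - P0 / 2 * \1_S z + shell_term z.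
Proof.
have P00 : 0 < P0 := profile_gt0.
have aP : 0 < a * P0 by rewrite mulr_gt0.
have qc : 0 < 2 `^ far_exponent sigma / far_exponent sigma by rewrite divr_gt0 ?powR_gt0.
have grad_le : `|dotp profile_grad z| <= a * P0 * (enorm z / d).
  apply: le_trans (normr_dotp _ _) _.
  by rewrite enorm_profile_grad -!mulrA (mulrC d^-1) mulrA.
have w0 := weight_ge0 sigma d z.
have /andP[dm1 dm2] := dm.
have [zd|dz] := ltP (enorm z) d.
- have nS : \1_S z = 0 :> R.
    rewrite indicE memNset// => /Ssub[_ /andP[]]; rewrite leNgt zd//.
  have z1 : enorm z < 1 by exact: lt_trans d1.
  have sh0 : shell_term z = 0.
    rewrite /shell_term; case: ifP => // _; rewrite indicE memNset ?mul0r ?oppr0//.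
    by move=> [_ /=]; rewrite /eball /= subr0; apply; rewrite (lt_trans zd).
  rewrite nS sh0 mulr0 subr0 addr0.
  have := profile_taylor zd; rewrite -/profile_grad => h.
  have z0 : 0 <= enorm z / d by rewrite divr_ge0 ?enorm_ge0 ?ltW.
  have zd1 : enorm z / d < 1 by rewrite ltr_pdivrMr// mul1r.
  have E : a * P0 / (2 * d ^+ 2) * enorm z ^+ 2 = a * P0 * ((enorm z / d) ^+ 2 / 2).
    by field; rewrite !gt_eqF.
  rewrite E in h; rewrite /weight /rweight zd1 /near_exponent /gradient_term.
  case: ifP => s1.
    rewrite powRr1// subr0; move: grad_le h; rewrite ler_norml => /andP[_].
    have : (enorm z / d) ^+ 2 <= enorm z / d by rewrite expr2 ler_piMl// ltW.
    move: z0; set t := enorm z / d => t0 tt g1 g2.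
    apply: le_trans g2 _; apply: (@le_trans _ _ (a * P0 * (2 * t))).
      have := ler_wpM2l (ltW aP) tt; have := mulr_ge0 (ltW aP) t0; lra.
    by rewrite -[leRHS]mulrA ler_wpM2l ?(ltW aP)// ler_wpM2r// lerDl ltW.
  rewrite powR_mulrn// indicE mem_set ?mul1r; last by rewrite /eball/= subr0.
  have -> : (if sigma == 1 then dotp profile_grad z else dotp profile_grad z) =
    dotp profile_grad z by case: ifP.
  rewrite lerBlDl (le_trans h)// lerD2l -[leRHS]mulrA ler_wpM2l ?(ltW aP)//.
  rewrite mulrC ler_wpM2r ?sqr_ge0//; move: qc; rewrite /profile_const.
  move: (_ / far_exponent sigma) => Q Q0.
  by rewrite (@le_trans _ _ 1) ?invf_le1 ?ler1n// ler_wpDr ?ler1n// ltW.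
- have t1 : 1 <= enorm z / d by rewrite ler_pdivlMr// mul1r.
  have wE : weight sigma d z = (enorm z / d) `^ far_exponent sigma.
    by rewrite /weight /rweight ltNge t1.
  have w1 : 1 <= weight sigma d z by exact: weight_ge1.
  have main : profile r a (v + z) - P0 <=
      a * P0 * (2 `^ far_exponent sigma / far_exponent sigma) * weight sigma d z -
      P0 / 2 * \1_S z.
    have [zS|zS] := boolP (z \in S).
      rewrite indicE zS mulr1; have [znu /andP[_ zC]] := Ssub (set_mem zS).
      have h := profile_behind zC Cs znu.
      have h1 : P0 * (C ^+ 2 * s0 / 2) `^ a <= P0 / 2 by rewrite ler_wpM2l ?(ltW P00).
      have h2 : 0 <= a * P0 * (2 `^ far_exponent sigma / far_exponent sigma) *
        weight sigma d z by apply: mulr_ge0 w0; apply: mulr_ge0; exact: ltW.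
      by move: h h1 h2; lra.
    rewrite indicE (negbTE zS) mulr0 subr0.
    have t11 : 1 <= 1 + enorm z / d by rewrite lerDl (le_trans ler01).
    have h := profile_far z; have aq' : 0 < a <= far_exponent sigma by rewrite a0.
    have h1 := powR_sub1_le aq' t11.
    have h2 : (1 + enorm z / d) `^ far_exponent sigma <=
        2 `^ far_exponent sigma * weight sigma d z.
      have t0 : 0 <= enorm z / d := le_trans ler01 t1.
      rewrite wE -powRM//; apply: (ge0_ler_powR (ltW q0)).
      - by rewrite nnegrE (le_trans ler01).
      - by rewrite nnegrE mulr_ge0.
      - by rewrite mulr2n mulrDl mul1r lerD2r.
    have h3 := ler_wpM2l (ltW (divr_gt0 a0 q0)) h2.
    have h4 := ler_wpM2l (ltW P00) (le_trans h1 h3).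
    have E : P0 * (a / far_exponent sigma * (2 `^ far_exponent sigma * weight sigma d z)) =
      a * P0 * (2 `^ far_exponent sigma / far_exponent sigma) * weight sigma d z by ring.
    by move: h h4; rewrite E mulrBr mulr1; lra.
  have gbound : - gradient_term profile_grad z <=
      a * P0 * 2 * weight sigma d z + shell_term z.
    have aw : 0 <= a * P0 * 2 * weight sigma d z.
      by apply: mulr_ge0 w0; apply: mulr_ge0 => //; exact: ltW.
    rewrite /gradient_term /shell_term; case: (ltgtP sigma 1) => s1.
    + by rewrite oppr0 addr0.
    + rewrite addr0; move: grad_le; rewrite ler_norml => /andP[g1 _].
      have : enorm z / d <= weight sigma d z.
        rewrite wE le1r_powR// /far_exponent [sigma <= 1]leNgt s1/=.
        by rewrite ler_pdivlMr// mul1r mulr2n lerD2l ltW.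
      move=> /(ler_wpM2l (ltW aP)); move: g1; lra.
    (* For [sigma = 1], points with [d <= |z| < 2^-m] satisfy [|z| / d <= 2] and are absorbed by the
       weight; from [2^-m] up to 1 the term is exactly [shell_term]. *)
    + rewrite indicE; have [z1|z1] := ltP (enorm z) 1; last first.
        rewrite memNset; last by rewrite /eball/= subr0 => /lt_geF; rewrite z1.
        rewrite mul0r oppr0 indicE memNset ?mul0r ?oppr0 ?addr0//.
        by move=> [+ _]; rewrite /eball/= subr0 => /lt_geF; rewrite z1.
      rewrite mem_set ?mul1r; last by rewrite /eball/= subr0.
      rewrite indicE; have [zm|zm] := ltP (enorm z) (2^-1 ^+ m).
        rewrite memNset ?mul0r ?oppr0 ?addr0; last first.
          by move=> [_]; apply; rewrite /eball/= subr0.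
        move: grad_le; rewrite ler_norml => /andP[g1 _].
        have : enorm z / d <= 2.
          rewrite ler_pdivrMr// (le_trans (ltW zm))//.
          by move: dm1; rewrite exprS; lra.
        move=> /(ler_wpM2l (ltW aP)) g2.
        have := ler_wpM2l (mulr_ge0 (ltW aP) (ler0n R 2)) w1; move: g1; lra.
      rewrite mem_set ?mul1r ?lerDr//; split; rewrite /eball /= subr0//.
      by apply/negP; rewrite -leNgt.
  have := lerD main gbound; rewrite /profile_const mulrDr mulrDl; lra.
Qed.

End bounds.

End profile.

Section barrier_integral.
Context {R : realType} {n : nat}.
Variables (sigma Lambda : R).
Hypothesis s02 : 0 < sigma < 2.
Hypothesis Lambda0 : 0 < Lambda.
Local Notation V := 'rV[R]_n.+1.
Local Notation L := (lebesgue_space R n).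
Local Notation mu := (lebesgue_rV R n).
Local Notation CK := (kernel_const sigma Lambda).
Implicit Types (phi : V -> R) (x y z p : V).

Lemma ball_volume_ge (d : R) : 0 <= d ->
  (((d / n.+1%:R) ^+ n.+1)%:E <= mu (eball (0 : V) d))%E.
Proof.
move=> d0; have dn : 0 <= d / n.+1%:R by rewrite divr_ge0.
apply: le_trans (lebesgue_outer_cube (n := n) dn) _.
apply: (@le_outer_measure _ _ (@lebesgue_outer R n)) => z zb.
rewrite /eball /= subr0 (le_lt_trans (enorm_le_norm z))// mulrC -ltr_pdivlMr//.
have z0 i : 0 <= z ord0 i < d / n.+1%:R by have := zb i; rewrite !mxE.
rewrite [ltLHS]mx_normrE; apply: bigmax_lt => /=.
  by have /andP[h1 h2] := z0 ord0; exact: le_lt_trans h2.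
by move=> [i j] _ /=; rewrite (ord1 i); have /andP[h1 h2] := z0 j; rewrite ger0_norm.
Qed.

(** Integrability is bundled with the vanishing of the integral so that linear combinations preserve
    the pair. *)
Definition int_zero (f : V -> R) :=
  mu.-integrable [set: L] (EFin \o f) /\ \int[mu]_z (f z) = 0.

Lemma integrable_add (f h : V -> R) : mu.-integrable [set: L] (EFin \o f) ->
  mu.-integrable [set: L] (EFin \o h) ->
  mu.-integrable [set: L] (EFin \o (fun z => f z + h z)).
Proof. by move=> i1 i2; have := integrableD measurableT i1 i2; apply: eq_integrable. Qed.

Lemma integrable_scale (c : R) (f : V -> R) : mu.-integrable [set: L] (EFin \o f) ->
  mu.-integrable [set: L] (EFin \o (fun z => c * f z)).
Proof. by move=> i1; have := integrableZl measurableT c i1; apply: eq_integrable. Qed.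

Lemma int_zeroD (f h : V -> R) : int_zero f -> int_zero h ->
  int_zero (fun z => f z + h z).
Proof.
move=> [i1 e1] [i2 e2]; split; first exact: integrable_add.
by rewrite RintegralD// e1 e2 addr0.
Qed.

Lemma int_zeroZ (c : R) (f : V -> R) : int_zero f -> int_zero (fun z => c * f z).
Proof.
move=> [i1 e1]; split; first exact: integrable_scale.
by rewrite RintegralZl// e1 mulr0.
Qed.

Lemma int_zero0 : int_zero (fun=> 0).
Proof.
by split; [exact: integrable0|rewrite /Rintegral integral0].
Qed.

Lemma int_zero_sum (s : seq 'I_n.+1) (f : 'I_n.+1 -> V -> R) :
  (forall i, int_zero (f i)) -> int_zero (fun z => \sum_(i <- s) f i z).
Proof.
move=> h; elim: s => [|i s IH].
  by under eq_fun do rewrite big_nil; exact: int_zero0.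
by under eq_fun do rewrite big_cons; exact: int_zeroD.
Qed.

Variable k : V -> R.
Hypothesis ubk : upper_bounds sigma Lambda k.

(** At [sigma = 1] the factor [|1 - sigma|] makes the first-moment bound zero, so each coordinate
    moment vanishes exactly. *)
Lemma annulus_moment_zero (d : R) p : sigma = 1 -> 0 < d ->
  int_zero (fun z => \1_(annulus d : set L) z * dotp p z * k z).
Proof.
move=> s1 d0; have [_ _ _ /(_ d d0)] := ubk.
rewrite s1 subrr normr0 mulr0 mul0r => h.
have comp i : \int[mu]_(z in annulus d) ((z : V) ord0 i * k z) = 0.
  apply/eqP; rewrite -normr_le0; apply: le_trans h.
  set rw := \row_ _ _; have -> : \int[mu]_(z in annulus d) ((z : V) ord0 i * k z) = rw ord0 i.
    by rewrite mxE.
  exact: coord_le_enorm.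
have -> : (fun z => \1_(annulus d : set L) z * dotp p z * k z) =
    (fun z => \sum_i (p ord0 i * (\1_(annulus d : set L) z * z ord0 i * k z))).
  apply/funext => z; rewrite /dotp mulr_sumr mulr_suml; apply: eq_bigr => i _; ring.
apply: int_zero_sum => i; apply: int_zeroZ; split; last first.
  rewrite -[RHS](comp i) [RHS]Rintegral_mkcond; apply: eq_Rintegral => z _.
  by rewrite patchE indicE; case: (_ \in _); rewrite ?mul1r ?mul0r.
apply: (kernel_integrable s02 Lambda0 ubk (C := 2 * d) d0).
  apply: measurable_funM; first exact/measurable_indic/measurable_annulus.
  by apply: continuous_measurable_rV; exact: coord_continuous.
move=> z; rewrite indicE; have [za|za] := boolP (z \in _); last first.
  by rewrite mul0r normr0 mulr_ge0 ?weight_ge0// mulr_ge0// ltW.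
rewrite mul1r; have [z2 zd] := set_mem za.
have zd' : d <= enorm z by move/negP: zd; rewrite /eball/= subr0 -leNgt.
apply: (le_trans (coord_le_enorm z i)); apply: (@le_trans _ _ (2 * d)).
  by move: z2; rewrite /eball/= subr0 => /ltW.
by rewrite ler_peMr ?weight_ge1// mulr_ge0// ltW.
Qed.

Lemma shell_moment_zero (m : nat) p : sigma = 1 ->
  int_zero (fun z => \1_(dyadic_shell m : set L) z * dotp p z * k z).
Proof.
move=> s1; elim: m => [|m IH].
  have -> : (fun z => \1_(dyadic_shell 0 : set L) z * dotp p z * k z) = fun=> 0.
    by apply/funext => z; rewrite /dyadic_shell expr0 setDv indicE memNset ?mul0r.
  exact: int_zero0.
have pm : 0 < 2^-1 ^+ m.+1 :> R by rewrite exprn_gt0// invr_gt0.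
have := int_zeroD IH (annulus_moment_zero p s1 pm).
congr int_zero; apply/funext => z; rewrite -mulrDl -mulrDl; congr (_ * _ * _).
rewrite !indicE /dyadic_shell /annulus exprS mulrA mulfV// mul1r.
have e1 : 2^-1 * 2^-1 ^+ m <= 2^-1 ^+ m :> R.
  by rewrite ler_piMl ?exprn_ge0 ?invr_ge0// invf_le1 ?ler1n.
have e2 : 2^-1 ^+ m <= 1 :> R by rewrite exprn_ile1 ?invr_ge0// invf_le1 ?ler1n.
rewrite /eball; have [h1|h1] := ltP (enorm z) (2^-1 * 2^-1 ^+ m).
  by rewrite !memNset ?addr0// => -[/= + h]; rewrite subr0 in h *; move=> h2; apply: h;
    rewrite ?(lt_le_trans h1).
have [h2|h2] := ltP (enorm z) (2^-1 ^+ m).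
  rewrite memNset; last by move=> [_]; apply; rewrite /= subr0.
  rewrite mem_set; last by split; rewrite /= subr0//; apply/negP; rewrite -leNgt.
  rewrite mem_set ?add0r//; split; rewrite /= subr0; first exact: lt_le_trans h2 e2.
  by apply/negP; rewrite -leNgt.
rewrite [X in _ + X](_ : _ = 0) ?addr0; last first.
  by rewrite memNset// => -[/=]; rewrite subr0 ltNge h2.
have [h3|h3] := ltP (enorm z) 1.
  by rewrite !mem_set//; split; rewrite /= subr0//; apply/negP; rewrite -leNgt.
by rewrite !memNset// => -[/=]; rewrite subr0 ltNge h3.
Qed.

End barrier_integral.

Lemma gradient_term_linear {R : realType} {n : nat} (sigma M N : R)
    (p q z : 'rV[R]_n.+1) :
  gradient_term sigma (M *: p + N *: q) z =
  M * gradient_term sigma p z + N * gradient_term sigma q z.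
Proof.
by rewrite /gradient_term dotpDl !dotpZl; case: ifP => _; [|case: ifP => _]; ring.
Qed.

Lemma incrementE {R : realType} {n : nat} (sigma : R) phi (y z : 'rV[R]_n.+1) :
  increment sigma phi y z = phi (y + z) - phi y - gradient_term sigma (grad phi y) z.
Proof.
by rewrite /increment /gradient_term; case: ifP => _; [rewrite subr0|case: ifP].
Qed.

Section profile_operator.
Context {R : realType} {n : nat}.
Variables (sigma Lambda : R).
Hypothesis s02 : 0 < sigma < 2.
Hypothesis Lambda0 : 0 < Lambda.
Local Notation V := 'rV[R]_n.+1.
Local Notation L := (lebesgue_space R n).
Local Notation mu := (lebesgue_rV R n).
Local Notation CK := (kernel_const sigma Lambda).
Variables (r a s0 : R) (v : V).
Hypotheses (r0 : 0 < r) (a01 : 0 < a <= 1) (s00 : 0 < s0).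
Hypothesis vE : enorm v = r + r * s0.
Local Notation d := (r * s0).
Local Notation P0 := (profile r a v).
Local Notation p := (profile_grad r a s0 v).
Variables (phi : V -> R) (y x : V) (eta M N : R).
Hypotheses (C2 : C2b phi) (eta0 : 0 < eta) (M0 : 0 <= M) (N0 : 0 <= N).
Local Notation b := (bumpV x eta).
Hypothesis touch : forall z, phi (y + z) - phi y <=
  M * (profile r a (v + z) - P0) + N * (b (y + z) - b y).

Let d0 : 0 < d. Proof. exact: mulr_gt0. Qed.

(** The increment of [phi] is bounded above by that of profile and bump, which have quadratic upper
    bounds with these slopes; [grad_of_upper_bound] then applies. *)
Lemma profile_touching_grad : grad phi y = M *: p + N *: grad b y.
Proof.
have n0 : 0 < n.+1%:R :> R by [].
apply: (@grad_of_upper_bound _ _ phi y _ (d / n.+1%:R)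
  (M * (a * P0 / (2 * d ^+ 2) * n.+1%:R ^+ 2) + N * (n.+1%:R * (10 / eta ^+ 2)))) => //.
  exact: divr_gt0.
move=> z; rewrite ltr_pdivlMr// mulrC => zd.
have ez : enorm z <= n.+1%:R * `|z| := enorm_le_norm z.
have h1 := profile_taylor r0 a01 s00 vE (le_lt_trans ez zd).
have h2 := le_trans (ler_norm _) (bump_taylor x y z eta0).
have c0 : 0 <= a * P0 / (2 * d ^+ 2).
  have /andP[a0 _] := a01.
  by apply: divr_ge0; [exact: mulr_ge0 (ltW a0) (profile_ge0 _ _ _)|rewrite mulr_ge0 ?sqr_ge0].
have ez2 : enorm z ^+ 2 <= n.+1%:R ^+ 2 * `|z| ^+ 2.
  by rewrite -exprMn lerXn2r ?nnegrE ?enorm_ge0// mulr_ge0.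
apply: le_trans (touch z) _; rewrite dotpDl (dotpZl _ p) dotpZl.
have h3 := ler_wpM2l c0 ez2.
have h4 : profile r a (v + z) - P0 <= dotp p z + a * P0 / (2 * d ^+ 2) * (n.+1%:R ^+ 2 * `|z| ^+ 2).
  by apply: le_trans h1 _; rewrite lerD2l.
have h5 := ler_wpM2l M0 h4; have := ler_wpM2l N0 h2; move: h5.
move: (profile r a (v + z) - P0) (b (y + z) - b y) (dotp p z) (dotp (grad b y) z) => T1 T2 T3 T4.
move: (a * P0 / _) (`|z| ^+ 2 : R) (10 / _ : R) (n.+1%:R : R) => T5 T6 T7 T8.
rewrite [N * (_ - _)]mulrBr lerBlDl => g1 g2; apply: le_trans (lerD g1 g2) _.
by rewrite le_eqVlt; apply/orP; left; apply/eqP; ring.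
Qed.

Variables (S : set L) (C : R) (m : nat).
Hypothesis aq : a <= far_exponent sigma.
Hypothesis s01 : s0 < 1.
Hypothesis r1 : r <= 1.
Hypothesis Cs : C * s0 <= 2.
Hypothesis Ca : (C ^+ 2 * s0 / 2) `^ a <= 2^-1.
Hypothesis Ssub : forall z, S z ->
  dotp z ((enorm v)^-1 *: v) < - d /\ (d <= enorm z < C * d).
Hypothesis dm : 2^-1 ^+ m.+1 <= d < 2^-1 ^+ m.
Variables (k : V -> R) (lambda theta : R).
Hypothesis lambda0 : 0 < lambda.
Hypothesis ubk : upper_bounds sigma Lambda k.
Hypothesis mS : measurable S.
Hypothesis Svol : ((theta * d ^+ n.+1)%:E <= mu S)%E.
Hypothesis kS : forall z, S z ->
  (2 - sigma) * lambda * d `^ (- n.+1%:R - sigma) <= k z.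

Let indic_weight z : `|\1_S z : R| <= 1 * weight sigma d z.
Proof.
rewrite mul1r indicE; have [zS|zS] := boolP (z \in S); last first.
  by rewrite normr0 weight_ge0.
by rewrite normr1; have [_ /andP[dz _]] := Ssub (set_mem zS); exact: weight_ge1.
Qed.

Let iS : mu.-integrable [set: L] (EFin \o (fun z => \1_S z * k z)).
Proof.
exact: (kernel_integrable s02 Lambda0 ubk d0 (measurable_indic mS) indic_weight).
Qed.

(** The kernel bound [d^(-n-1-sigma)] times the volume [theta d^(n+1)] gives [d^(-sigma)], the same
    power as in [integral_weight_le]; gain and error therefore compete through constants only. *)
Lemma kernel_mass_ge :
  (2 - sigma) * lambda * theta * d `^ (- sigma) <= \int[mu]_z (\1_S z * k z).
Proof.
have kS' := kS; set kappa := (2 - sigma) * lambda * d `^ (- n.+1%:R - sigma) in kS'.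
have [_ s2] := andP s02.
have kap0 : 0 <= kappa by rewrite !mulr_ge0 ?powR_ge0 ?(ltW lambda0)// subr_ge0 ltW.
have -> : (2 - sigma) * lambda * theta * d `^ (- sigma) = kappa * (theta * d ^+ n.+1).
  rewrite /kappa powRD; last by rewrite (gt_eqF d0) implybT.
  have -> : d `^ (- n.+1%:R) = (d ^+ n.+1)^-1 by rewrite powRN powR_mulrn// ltW.
  by field; rewrite gt_eqF// exprn_gt0.
rewrite -lee_fin /Rintegral fineK; last exact: integrable_fin_num iS.
apply: (@le_trans _ _ (\int[mu]_(z in S) kappa%:E)%E).
  rewrite integral_cst// EFinM lee_wpmul2l// lee_fin//.
rewrite [leLHS](_ : _ = \int[mu]_z (kappa * \1_S z)%:E)%E; last first.
  rewrite [LHS]integral_mkcond; apply: eq_integral => z _.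
  by rewrite patchE indicE; case: ifP => _; rewrite ?mulr1 ?mulr0.
apply: ge0_le_integral.
- exact: measurableT.
- by move=> z _; rewrite lee_fin mulr_ge0.
- apply/measurable_EFinP; apply: measurable_funM; first exact: measurable_cst.
  exact: measurable_indic.
- apply/measurable_EFinP; apply: measurable_funM; first exact: measurable_indic.
  by have [mk _ _ _] := ubk; exact: mk.
- move=> z _; rewrite lee_fin mulrC indicE; have [zS|zS] := boolP (z \in S).
    by rewrite !mul1r; apply: kS'; exact: set_mem.
  by rewrite !mul0r.
Qed.

Lemma nonlocalR_profile_le :
  nonlocalR sigma k phi y <=
    M * P0 * d `^ (- sigma) *
      (a * (profile_const sigma * CK) - (2 - sigma) * lambda * theta / 2) +
    N * nonlocalR sigma k b y.
Proof.
have iw := integrable_weight s02 Lambda0 ubk d0.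
have Cb := C2b_bump x eta0.
have ib := integrable_increment s02 Lambda0 (phi := b) y ubk Cb.
have ip := integrable_increment s02 Lambda0 (phi := phi) y ubk C2.
have [ish esh] : int_zero (fun z => shell_term r a s0 v sigma m z * k z).
  rewrite /shell_term; case: (eqVneq sigma 1) => s1; last first.
    by under eq_fun do rewrite mul0r; exact: int_zero0.
  have := int_zeroZ (-1) (shell_moment_zero s02 Lambda0 ubk m p s1).
  by congr int_zero; apply/funext => z; ring.
have W1 : \int[mu]_z (weight sigma d z * k z) <= CK * d `^ (- sigma).
  rewrite -[leRHS]mul1r; apply: (kernel_Rintegral_le s02 Lambda0 ubk d0 ler01 iw).
  by move=> z; rewrite mul1r.
have W2 := kernel_mass_ge.
pose H z := M * (a * P0 * profile_const sigma) * (weight sigma d z * k z) +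
  (- (M * (P0 / 2))) * (\1_S z * k z) + M * (shell_term r a s0 v sigma m z * k z) +
  N * (increment sigma b y z * k z).
have i1 := integrable_scale (M * (a * P0 * profile_const sigma)) iw.
have i2 := integrable_scale (- (M * (P0 / 2))) iS.
have i3 := integrable_scale M ish.
have i4 := integrable_scale N ib.
have i12 := integrable_add i1 i2.
have i123 := integrable_add i12 i3.
have iH := integrable_add i123 i4.
have step : nonlocalR sigma k phi y <= \int[mu]_z (H z).
  rewrite /nonlocalR; apply: le_Rintegral => //.
  move=> z _; have k0 := kernel_ge0 ubk z.
  have h : increment sigma phi y z <=
      M * (a * P0 * profile_const sigma * weight sigma d z - P0 / 2 * \1_S z +
        shell_term r a s0 v sigma m z) + N * increment sigma b y z.
    rewrite !incrementE profile_touching_grad gradient_term_linear.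
    have h1 := ler_wpM2l M0 (profile_increment_le r0 a01 s00 vE s02 aq s01 r1 Cs Ca Ssub dm z).
    have h2 := touch z; move: h1 h2.
    move: (gradient_term sigma p z) (gradient_term sigma (grad b y) z) => G1 G2.
    move: (_ + shell_term _ _ _ _ _ _ _) (phi (y + z) - phi y) (b (y + z) - b y) => T1 T2 T3.
    by move: (profile r a (v + z) - P0) => T4; lra.
  apply: (le_trans (ler_wpM2r k0 h)); rewrite /H.
  by move: (weight _ _ _) (shell_term _ _ _ _ _ _ _) (increment _ _ _ _) (k z) (\1_S z : R) => *; lra.
apply: (le_trans step).
rewrite RintegralD// RintegralD// RintegralD//.
rewrite RintegralZl// RintegralZl// RintegralZl// RintegralZl// esh mulr0 addr0 -/(nonlocalR sigma k b y).
rewrite lerD2r.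
have P00 : 0 <= M * P0 by rewrite mulr_ge0// profile_ge0.
have pc0 : 0 <= profile_const sigma.
  by rewrite addr_ge0// divr_ge0 ?powR_ge0// ltW// far_exponent_gt0.
have /andP[a0 _] := a01.
have A1 := ler_wpM2l (mulr_ge0 (mulr_ge0 P00 (ltW a0)) pc0) W1.
have A2 := ler_wpM2l P00 W2.
move: A1 A2; move: (\int[mu]_z _) (\int[mu]_z (weight _ _ _ * _)) => I1 I2.
move: (d `^ _) (kernel_const _ _) (profile_const _) P0 => D1 D2 D3 D4; lra.
Qed.

End profile_operator.

(** * The Isaacs operator *)

Section isaacs_family.
Context {R : realType} {n : nat}.
Variables (sigma Lambda : R).
Hypothesis s02 : 0 < sigma < 2.
Hypothesis Lambda0 : 0 < Lambda.
Local Notation V := 'rV[R]_n.+1.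
Local Notation L := (lebesgue_space R n).
Local Notation mu := (lebesgue_rV R n).
Local Notation CK := (kernel_const sigma Lambda).
Local Notation n1 := (n.+1%:R : R).
Implicit Types (phi psi chi k : V -> R) (x y z p q : V).

Lemma nonlocalR_lincomb k phi psi (a c : R) y : upper_bounds sigma Lambda k ->
  C2b phi -> C2b psi -> nonlocalR sigma k (fun x => phi x + a * psi x + c) y =
    nonlocalR sigma k phi y + a * nonlocalR sigma k psi y.
Proof.
move=> ubk C1 C2; have [C3 gE] := C2b_lincomb a c C1 C2.
have i1 := integrable_increment s02 Lambda0 y ubk C1.
have i2 := integrable_increment s02 Lambda0 y ubk C2.
have i3 := integrable_scale a i2.
rewrite /nonlocalR -RintegralZl// -RintegralD//; apply: eq_Rintegral => z _.
rewrite !incrementE gE -{1}[grad phi y]scale1r gradient_term_linear; ring.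
Qed.

(** Used for the constant part of a barrier and, applied to [phi - chi], for ellipticity. *)
Lemma max_point phi y : C2b phi -> (forall z, phi z <= phi y) ->
  grad phi y = 0 /\
  forall k, upper_bounds sigma Lambda k -> nonlocalR sigma k phi y <= 0.
Proof.
move=> C2 hm; have g0 : grad phi y = 0.
  apply: (@grad_of_upper_bound _ _ phi y 0 1 0) => // z _.
  by rewrite dotp0l mul0r addr0 subr_le0.
split=> // k ubk; have i1 := integrable_increment s02 Lambda0 y ubk C2.
have := kernel_Rintegral_le s02 Lambda0 ubk (ltr01 : 0 < 1 :> R) (lexx 0) i1.
rewrite mul0r; apply => z; rewrite mul0r incrementE g0.
have -> : gradient_term sigma (0 : V) z = 0.
  by rewrite /gradient_term dotp0l mulr0; case: ifP => // _; case: ifP.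
by rewrite subr0 subr_le0.
Qed.

(** The constant [C + G + 2 M + G] of [increment_le_weight] at [r = 1], with the Taylor, gradient
    and sup bounds of the bump. *)
Definition bump_weight (eta : R) : R :=
  n1 * (10 / eta ^+ 2) + n1 * (2 / eta) + (2 * n1 + n1 * (2 / eta)).

Definition bump_const (eta : R) : R := bump_weight eta * CK.

Lemma bump_weight_ge0 (eta : R) : 0 < eta -> 0 <= bump_weight eta.
Proof.
move=> e0; have h1 : 0 <= n1 * (10 / eta ^+ 2).
  by rewrite mulr_ge0// divr_ge0// exprn_ge0// ltW.
have h2 : 0 <= n1 * (2 / eta) by rewrite mulr_ge0// divr_ge0// ltW.
by apply: addr_ge0; apply: addr_ge0 => //; exact: mulr_ge0.
Qed.

Lemma bump_const_ge0 (eta : R) : 0 < eta -> 0 <= bump_const eta.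
Proof.
by move=> e0; rewrite mulr_ge0 ?bump_weight_ge0// ltW// kernel_const_gt0.
Qed.

Lemma nonlocalR_bump_le k x (eta : R) y : upper_bounds sigma Lambda k -> 0 < eta ->
  `|nonlocalR sigma k (bumpV x eta) y| <= bump_const eta.
Proof.
move=> ubk e0; have Cb := C2b_bump x e0.
have nn : 0 <= n1 by [].
have h z : `|increment sigma (bumpV x eta) y z| <=
    bump_weight eta * weight sigma 1 z.
  have := @increment_le_weight _ _ sigma s02 (bumpV x eta) y 1 (n1 * (10 / eta ^+ 2)) (n1 * (2 / eta)) n1.
  rewrite pow1R divr1; apply.
  - by rewrite ltr01 lexx.
  - by rewrite mulr_ge0// divr_ge0// exprn_ge0// ltW.
  - by rewrite mulr_ge0// divr_ge0// ltW.
  - by [].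
  - move=> z' _; apply: le_trans (bump_taylor _ _ _ e0) _.
    rewrite ler_wpM2l//; first by rewrite mulr_ge0// divr_ge0// exprn_ge0// ltW.
    by rewrite lerXn2r ?nnegrE ?enorm_ge0// norm_le_enorm.
  - by rewrite (le_trans (enorm_le_norm _))// ler_wpM2l// grad_bump_le.
  - by move=> z'; rewrite ger0_norm ?bump_ge0// bump_le.
have i1 := integrable_increment s02 Lambda0 y ubk Cb.
move: h (bump_weight_ge0 e0); rewrite /bump_const; move: (bump_weight eta) => C h C0.
rewrite ler_norml; apply/andP; split.
  have i2 := integrable_scale (-1) i1; rewrite lerNl.
  have -> : - nonlocalR sigma k (bumpV x eta) y =
      \int[mu]_z ((-1 * increment sigma (bumpV x eta) y z) * k z).
    rewrite -[LHS]mulN1r /nonlocalR -[LHS]RintegralZl//.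
    by apply: eq_Rintegral => z _; rewrite mulrA.
  have := @kernel_Rintegral_le _ _ _ _ s02 Lambda0 k ubk
    (fun z => -1 * increment sigma (bumpV x eta) y z) C 1 ltr01 C0.
  rewrite pow1R mulr1; apply.
    by move: i2; apply: eq_integrable => // z _ /=; rewrite mulrA.
  by move=> z; move: (h z); rewrite ler_norml mulN1r lerNl => /andP[].
have := kernel_Rintegral_le s02 Lambda0 ubk (ltr01 : 0 < 1 :> R) C0 i1.
rewrite pow1R mulr1; apply=> z.
by move: (h z); rewrite ler_norml => /andP[].
Qed.

Variables (A B : Type) (K : A -> B -> V -> V -> R) (b : A -> B -> V -> V).
Variables (c : A -> B -> V -> R).
Variable (Omega : set V).
Hypothesis ubK : forall i j y, Omega y -> upper_bounds sigma Lambda (K i j y).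

Definition isaacs_term (f : A -> B -> V -> R) i j y (t : R) phi : R :=
  - nonlocalR sigma (K i j y) phi y +
  (dotp (b i j y) (grad phi y) + c i j y * t + f i j y).

Lemma isaacsE f y (t : R) phi : Omega y -> C2b phi -> isaacs sigma K b c f y t phi =
  ereal_sup [set ereal_inf [set (isaacs_term f i j y t phi)%:E | j in [set: B]]
            | i in [set: A]].
Proof.
move=> Oy C2; rewrite /isaacs; congr ereal_sup; apply/seteqP.
have E i j : (- nonlocal sigma (K i j y) phi y +
    (dotp (b i j y) (grad phi y) + c i j y * t + f i j y)%:E)%E =
    (isaacs_term f i j y t phi)%:E.
  by rewrite (nonlocalE s02 Lambda0 y (ubK i j Oy) C2).
split=> _ [i _ <-]; exists i => //; congr ereal_inf; apply/seteqP;
  by split=> _ [j _ <-]; exists j => //; rewrite E.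
Qed.

Lemma isaacs_term_elliptic f phi chi y (s : R) i j : C2b phi -> C2b chi -> Omega y ->
  (forall z, phi z - chi z <= phi y - chi y) ->
  isaacs_term f i j y s chi <= isaacs_term f i j y s phi.
Proof.
move=> C1 C2 Oy h; have [C3 gE] := C2b_lincomb (-1) 0 C1 C2.
have [|g0 /(_ _ (ubK i j Oy))] := max_point (y := y) C3.
  by move=> z; rewrite !addr0 !mulN1r.
rewrite (nonlocalR_lincomb _ _ _ (ubK i j Oy) C1 C2) => h1.
move: g0; rewrite gE scaleN1r => /subr0_eq gg.
by rewrite /isaacs_term gg; move: h1; move: (nonlocalR _ _ _ _) (nonlocalR _ _ _ _) => *; lra.
Qed.

End isaacs_family.

Lemma unif_bound {R : realType} {n : nat} {I : Type} {W : normedModType R}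
    (Omega : set 'rV[R]_n.+1) (h : I -> 'rV[R]_n.+1 -> W) :
  unif_bounded_continuous Omega setT h ->
  exists2 M : R, 0 <= M & forall i x, Omega x -> `|h i x| <= M.
Proof.
move=> [[M hM] _]; exists `|M| => // i x Ox.
by apply: (le_trans (hM i _ x Ox)) => //; exact: ler_norm.
Qed.

Lemma unif_modulus {R : realType} {n : nat} {I : Type} {W : normedModType R}
    (Omega : set 'rV[R]_n.+1) (D : set I) (h : I -> 'rV[R]_n.+1 -> W) x (e : R) :
  unif_bounded_continuous Omega D h -> Omega x -> 0 < e ->
  exists2 d : R, 0 < d & forall y, Omega y -> `|y - x| < d ->
    forall i, D i -> `|h i y - h i x| <= e.
Proof.
move=> [_ hc] Ox e0; have /nbhs_rVP[d d0 hd] := hc x Ox e e0.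
by exists d => // y Oy yx i Di; rewrite ltW// hd.
Qed.

Section isaacs_continuity.
Context {R : realType} {n : nat}.
Variables (sigma Lambda : R).
Hypothesis s02 : 0 < sigma < 2.
Hypothesis Lambda0 : 0 < Lambda.
Local Notation V := 'rV[R]_n.+1.
Local Notation n1 := (n.+1%:R : R).
Variables (A B : Type) (K : A -> B -> V -> V -> R) (b : A -> B -> V -> V).
Variables (c f : A -> B -> V -> R).
Variable (Omega : set V).
Hypothesis ubK : forall i j y, Omega y -> upper_bounds sigma Lambda (K i j y).
Hypothesis Kc : unif_bounded_continuous_kernels Omega K.
Hypothesis bc : unif_bounded_continuous Omega setT (fun ij : A * B => b ij.1 ij.2).
Hypothesis cc : unif_bounded_continuous Omega setT (fun ij : A * B => c ij.1 ij.2).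
Hypothesis fc : unif_bounded_continuous Omega setT (fun ij : A * B => f ij.1 ij.2).

Lemma normr_dotp_norm (p q : V) : `|dotp p q| <= n1 ^+ 2 * (`|p| * `|q|).
Proof.
apply: le_trans (normr_dotp _ _) _.
have -> : n1 ^+ 2 * (`|p| * `|q|) = (n1 * `|p|) * (n1 * `|q|) by ring.
by apply: ler_pM; rewrite ?enorm_ge0// enorm_le_norm.
Qed.

Lemma isaacs_term_continuous phi x (s e : R) : C2b phi -> Omega x -> 0 < e ->
  exists2 d, 0 < d & forall y t k l, Omega y -> `|y - x| < d -> `|t - s| < d ->
    `|k| <= d -> forall i j,
    `|isaacs_term sigma K b c f i j y t (perturb phi x k l) -
      isaacs_term sigma K b c f i j x s phi| <= e.
Proof.
move=> C2 Ox e0.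
have [Mb Mb0 hb] := unif_bound bc; have [Mc Mc0 hc] := unif_bound cc.
have [r3 [C [r30 C0 _ hg]]] := C2b_local x C2.
have e2 : 0 < e / 2 by rewrite divr_gt0.
have [d1 d10 h1] : exists2 r, 0 < r & forall y, Omega y -> `|y - x| < r ->
    forall i : A * B, `|nonlocalR sigma (K i.1 i.2 y) phi y -
                        nonlocalR sigma (K i.1 i.2 x) phi x| <= e / 2.
  apply: (nonlocalR_equicontinuous s02 Lambda0 (K := fun i : A * B => K i.1 i.2)) => //.
    by move=> i y; exact: ubK.
  move=> rho d rho0 d0; have [r r0 hr] := unif_modulus (Kc rho0) Ox d0.
  by exists r => // y Oy yx [i j] z hz; exact: (hr y Oy yx (i, j, z)).
pose G := `|grad phi x| + C * r3.
have G0 : 0 <= G by rewrite addr_ge0// mulr_ge0// ltW.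
pose Q := bump_const (n := n) sigma Lambda 1.
have Q0 : 0 <= Q by rewrite bump_const_ge0.
(* [T] collects the coefficients of [d] in the bounds [t1] to [t6] and in the difference of [f]; the
   nonlocal difference of [phi] has its own share [e / 2]. *)
pose T := Q + n1 ^+ 2 * G + n1 ^+ 2 * (Mb * C) + n1 ^+ 2 * (Mb * 2) + Mc + `|s| + 1.
have T0 : 0 < T by rewrite /T ltr_wpDl// !addr_ge0// !mulr_ge0// sqr_ge0.
pose d := e / 2 / T; have d0 : 0 < d by rewrite divr_gt0.
have dT : T * d = e / 2 by rewrite /d mulrC divfK// gt_eqF.
have [d2 d20 h2] := unif_modulus bc Ox d0.
have [d3 d30 h3] := unif_modulus cc Ox d0.
have [d4 d40 h4] := unif_modulus fc Ox d0.
exists (Num.min d1 (Num.min d2 (Num.min d3 (Num.min d4 (Num.min r3 d))))).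
  by rewrite !lt_min d10 d20 d30 d40 r30.
move=> y t k l Oy; rewrite !lt_min => /and5P[y1 y2 y3 y4 /andP[yr yd]].
move=> /and5P[_ _ _ _ /andP[_ td]].
rewrite !le_min => /and5P[_ _ _ _ /andP[_ kd]] i j.
have Cb := C2b_bump x (ltr01 : 0 < 1 :> R).
have [C3 gE] := C2b_lincomb k l C2 Cb.
rewrite /isaacs_term /perturb (nonlocalR_lincomb s02 Lambda0 _ _ _ (ubK i j Oy) C2 Cb) gE.
have {}h1 := h1 y Oy y1 (i, j); have {}h2 := h2 y Oy y2 (i, j) I.
have {}h3 := h3 y Oy y3 (i, j) I; have {}h4 := h4 y Oy y4 (i, j) I.
have {}hb := hb (i, j) _ _; have {}hc := hc (i, j).
rewrite /= in h1 h2 h3 h4 hb hc.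
have hgy := hg y yr; have gy : `|grad phi y| <= G.
  have -> : grad phi y = grad phi x + (grad phi y - grad phi x) by rewrite addrC subrK.
  by rewrite (le_trans (ler_normD _ _))// lerD2l (le_trans hgy)// ler_wpM2l// ltW.
have n20 : 0 <= n1 ^+ 2 by rewrite sqr_ge0.
have dn0 := ltW d0.
have t1 : `|k * nonlocalR sigma (K i j y) (bumpV x 1) y| <= d * Q.
  by rewrite normrM ler_pM// nonlocalR_bump_le//; exact: ubK.
have t2 : `|dotp (b i j y - b i j x) (grad phi y)| <= n1 ^+ 2 * (d * G).
  apply: le_trans (normr_dotp_norm _ _) _; rewrite ler_wpM2l//.
  by apply: ler_pM; [exact: normr_ge0|exact: normr_ge0|exact: h2|exact: gy].
have t3 : `|dotp (b i j x) (grad phi y - grad phi x)| <= n1 ^+ 2 * (Mb * (C * d)).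
  rewrite (le_trans (normr_dotp_norm _ _))// ler_wpM2l// ler_pM//; first exact: hb.
  by rewrite (le_trans hgy)// ler_wpM2l// ltW.
have t4 : `|k * dotp (b i j y) (grad (bumpV x 1) y)| <= d * (n1 ^+ 2 * (Mb * 2)).
  rewrite normrM ler_pM// (le_trans (normr_dotp_norm _ _))// ler_wpM2l// ler_pM//.
    exact: hb.
  by have := grad_bump_le x y (ltr01 : 0 < 1 :> R); rewrite divr1.
have t5 : `|c i j y * (t - s)| <= Mc * d.
  by rewrite normrM ler_pM// ?hc// ltW.
have t6 : `|(c i j y - c i j x) * s| <= d * `|s|.
  by rewrite normrM ler_wpM2r.
have E : - (nonlocalR sigma (K i j y) phi y + k * nonlocalR sigma (K i j y) (bumpV x 1) y) +
  (dotp (b i j y) (grad phi y + k *: grad (bumpV x 1) y) + c i j y * t + f i j y) -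
  (- nonlocalR sigma (K i j x) phi x + (dotp (b i j x) (grad phi x) + c i j x * s + f i j x)) =
  - (nonlocalR sigma (K i j y) phi y - nonlocalR sigma (K i j x) phi x) -
  k * nonlocalR sigma (K i j y) (bumpV x 1) y + dotp (b i j y - b i j x) (grad phi y) +
  dotp (b i j x) (grad phi y - grad phi x) + k * dotp (b i j y) (grad (bumpV x 1) y) +
  c i j y * (t - s) + (c i j y - c i j x) * s + (f i j y - f i j x).
  rewrite dotpDr dotpZr dotpBl dotpBr; clear.
  move: (nonlocalR sigma (K i j y) phi y) (nonlocalR sigma (K i j x) phi x).
  move: (nonlocalR sigma (K i j y) _ y).
  move: (dotp (b i j y) (grad phi y)) (dotp (b i j x) (grad phi y)).
  move: (dotp (b i j x) (grad phi x)) (dotp (b i j y) (grad (bumpV x 1) y)).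
  by move: (c i j y) (c i j x) (f i j y) (f i j x) => *; ring.
rewrite E {E}.
apply: (@le_trans _ _ (e / 2 + T * d)); last by rewrite dT -splitr.
apply: (@le_trans _ _ (e / 2 + d * Q + n1 ^+ 2 * (d * G) + n1 ^+ 2 * (Mb * (C * d)) +
   d * (n1 ^+ 2 * (Mb * 2)) + Mc * d + d * `|s| + d)); last first.
  by rewrite le_eqVlt; apply/orP; left; apply/eqP; rewrite /T; ring.
do ! [apply: le_trans (ler_normD _ _) _; apply: lerD => //].
  by rewrite normrN.
by rewrite normrN.
Qed.

End isaacs_continuity.

(** The relative distance below which [profile_behind] applies and at least halves the profile. *)
Lemma small_threshold {R : realType} (C a : R) : 0 < C -> 0 < a ->
  exists2 s : R, 0 < s <= 1 &
    forall t, 0 < t < s -> C * t <= 2 /\ (C ^+ 2 * t / 2) `^ a <= 2^-1.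
Proof.
move=> C0 a0; pose h : R := 2^-1 `^ a^-1; have h0 : 0 < h by rewrite powR_gt0.
have C20 : 0 < C ^+ 2 by rewrite exprn_gt0.
exists (Num.min 1 (Num.min (2 / C) (2 * h / C ^+ 2))).
  by rewrite ge_min lexx !lt_min ltr01 divr_gt0// divr_gt0// mulr_gt0.
move=> t; rewrite !lt_min => /andP[t0 /and3P[_ t1 t2]]; split.
  by rewrite mulrC -ler_pdivlMr// ltW.
have {}t2 : C ^+ 2 * t / 2 <= h.
  by rewrite ler_pdivrMr// mulrC -ler_pdivlMr// [h * 2]mulrC ltW.
rewrite [leRHS](_ : _ = h `^ a); last by rewrite -powRrM mulVf ?gt_eqF// powRr1// invr_ge0.
apply: (ge0_ler_powR (ltW a0)) => //; rewrite nnegrE ?(ltW h0)//.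
by rewrite divr_ge0// mulr_ge0// ltW.
Qed.

Lemma continuous_affine_rV {R : realType} {n : nat} (k s : R) (u v : 'rV[R]_n.+1 -> R) :
  continuous u -> continuous v -> continuous (fun y => k + s * u y + v y).
Proof.
move=> /continuous_rVP cu /continuous_rVP cv; apply/continuous_rVP => x e e0.
have s1 : 0 < `|s| + 1 by rewrite ltr_wpDl.
have e2 : 0 < e / 2 by rewrite divr_gt0.
have [r1 r10 h1] := cu x _ (divr_gt0 e2 s1); have [r2 r20 h2] := cv x _ e2.
exists (Num.min r1 r2) => [|z]; first by rewrite lt_min r10.
rewrite lt_min => /andP[/h1 {}h1 /h2 {}h2].
have -> : k + s * u z + v z - (k + s * u x + v x) = s * (u z - u x) + (v z - v x) by ring.
rewrite (splitr e) (le_lt_trans (ler_normD _ _))// ler_ltD// normrM.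
move: h1; rewrite ltr_pdivlMr// => /ltW; rewrite mulrDr mulr1 mulrC.
by apply: le_trans; rewrite lerDl.
Qed.

(** The quantity is the profile times [d^(-sigma)]. Being at least 1, it lets the negative nonlocal
    term outweigh bounded terms all the way to the boundary. *)
Lemma powR_scale_ge1 {R : realType} (r s a sigma : R) : 0 < r <= 1 -> 0 < s <= 1 ->
  0 < a <= sigma -> 1 <= s `^ a * (r * s) `^ (- sigma).
Proof.
move=> /andP[r0 r1] /andP[s0 s1] /andP[a0 asg].
have d0 : 0 < r * s by rewrite mulr_gt0.
rewrite powRN -(ler_pM2r (powR_gt0 sigma d0)) mul1r divfK ?gt_eqF ?powR_gt0//.
apply: (@le_trans _ _ (s `^ sigma)); last by apply: ger_powR => //; rewrite s0.
apply: ge0_ler_powR; rewrite ?nnegrE ?(ltW s0) ?(ltW d0)//.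
  by rewrite (le_trans (ltW a0)).
by rewrite ler_piMl// ltW.
Qed.

(** * Barriers at points outside the domain *)

Section barriers.
Context {R : realType} {n : nat}.
Variables (sigma Lambda gamma : R).
Hypothesis s02 : 0 < sigma < 2.
Hypothesis Lambda0 : 0 < Lambda.
Hypothesis gamma0 : 0 < gamma.
Local Notation V := 'rV[R]_n.+1.
Local Notation L := (lebesgue_space R n).
Local Notation mu := (lebesgue_rV R n).
Local Notation CK := (kernel_const sigma Lambda).
Local Notation n1 := (n.+1%:R : R).
Variables (A B : Type) (K : A -> B -> V -> V -> R) (b : A -> B -> V -> V).
Variables (c f : A -> B -> V -> R) (g : V -> R).
Variable (Omega : set V).
Hypothesis ubK : forall i j y, Omega y -> upper_bounds sigma Lambda (K i j y).
Variables (Mb Mc Mf Mg : R).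
Hypotheses (Mb0 : 0 <= Mb) (Mc0 : 0 <= Mc) (Mf0 : 0 <= Mf) (Mg0 : 0 <= Mg).
Hypothesis b_le : forall i j y, Omega y -> `|b i j y| <= Mb.
Hypothesis c_le : forall i j y, Omega y -> `|c i j y| <= Mc.
Hypothesis f_le : forall i j y, Omega y -> `|f i j y| <= Mf.
Hypothesis c_ge : forall i j y, Omega y -> gamma <= c i j y.
Hypothesis b0 : sigma < 1 -> forall i j y, Omega y -> b i j y = 0.
Hypothesis g_le : forall y, `|g y| <= Mg.
Hypothesis cg : continuous g.
Local Notation X := (isaacs_term sigma K b c f).

(** The inequality for all pairs of indices is stronger than the sup-inf one and is not affected by
    the exchange of sup and inf under a change of sign. *)
Definition strict_upper_barrier (w : V -> R) :=
  [/\ continuous w, bounded_by_norm w, forall y, g y <= w y &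
    forall phi y, C2b phi -> Omega y ->
      (forall z, w y - phi y <= w z - phi z) -> forall i j, 0 <= X i j y (w y) phi].

(** At this height [c * cap >= gamma * cap >= Mf], so the constant is a supersolution, and it
    dominates [g]. *)
Definition cap : R := Mg + Mf / gamma.

(** The bump is at least 1/2 at distance [eta], so it contributes at least [Mg + cap] there and
    lifts the barrier from [g x >= - Mg] above [cap]. *)
Definition spread : R := 2 * Mg + 2 * cap.

Definition barrier_at x (e eta : R) (P : V -> R) y : R :=
  g x + e + spread * bumpV x eta y + P y.

Let cap0 : 0 <= cap. Proof. by rewrite addr_ge0// divr_ge0// ltW. Qed.

Let gcap y : g y <= cap.
Proof.
rewrite (le_trans (ler_norm _))// (le_trans (g_le y))// lerDl divr_ge0//.
exact: ltW.
Qed.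

Let gN y : - cap <= g y.
Proof.
have := g_le y; rewrite ler_norml => /andP[h _]; apply: le_trans h.
by rewrite lerN2 lerDl divr_ge0// ltW.
Qed.

Let spread0 : 0 <= spread.
Proof. by rewrite addr_ge0// mulr_ge0. Qed.

(** Below the cap, touching the minimum bounds the increments of [phi] by those of the uncapped
    barrier. Where the cap is active, [phi] has a global maximum at [y], so its gradient vanishes,
    its nonlocal term is nonpositive and the zero-order term dominates [f]. *)
Lemma barrier_correct (x : V) (e eta : R) (P : V -> R) : 0 < e -> 0 < eta ->
  (forall y, `|y - x| < eta -> g y <= g x + e) ->
  (forall y, 0 <= P y) -> continuous P ->
  (forall phi y, C2b phi -> Omega y -> barrier_at x e eta P y < cap ->
     (forall z, phi (y + z) - phi y <=
        (P (y + z) - P y) + spread * (bumpV x eta (y + z) - bumpV x eta y)) ->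
     forall i j, 0 <= X i j y (barrier_at x e eta P y) phi) ->
  strict_upper_barrier (fun y => Num.min cap (barrier_at x e eta P y)).
Proof.
move=> e0 eta0 geta P0 cP hU; set U := barrier_at x e eta P.
have cb := C2b_continuous (C2b_bump x eta0).
have cU : continuous U.
  exact: continuous_affine_rV.
have gU y : g y <= U y.
  rewrite /U /barrier_at; have [yx|yx] := ltP `|y - x| eta.
    apply: (le_trans (geta y yx)); rewrite -addrA lerDl addr_ge0// mulr_ge0//.
    exact: bump_ge0.
  have h := ler_wpM2l spread0 (bump_ge_half eta0 yx).
  have h1 := gcap y; have h2 := g_le x; have h3 := P0 y.
  move: h2; rewrite ler_norml => /andP[h2 _].
  move: h h3 e0; rewrite {1}/spread; move: (spread * bumpV _ _ _) (P y) => *; lra.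
have gW y : g y <= Num.min cap (U y) by rewrite le_min gcap gU.
split=> //.
- apply/continuous_rVP => y d /((continuous_rVP U).1 cU y)[r r0 hr].
  exists r => // z /hr; apply: le_lt_trans.
  have h1 := ler_norm (U z - U y); have h2 := ler_norm (U y - U z).
  rewrite distrC in h2; rewrite ler_norml.
  by case: (leP cap (U z)) => hz; case: (leP cap (U y)) => hy; apply/andP; split; lra.
- exists cap => y; rewrite ler_norml ge_min lexx andbT.
  exact: le_trans (gN y) (gW y).
move=> phi y C2 Oy hm i j.
have [yc|yc] := ltP (U y) cap.
  apply: hU => // z.
  have := hm (y + z); rewrite [Num.min cap (U y)]min_r ?(ltW yc)//.
  have : Num.min cap (U (y + z)) <= U (y + z) by rewrite ge_min lexx orbT.
  rewrite /U /barrier_at; move: (Num.min _ _) => T h1 h2.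
  by rewrite mulrBr; move: h1 h2; move: (spread * _) (spread * _) (P _) (P _) => *; lra.
have hmax z : phi z <= phi y.
  have := hm z; have : Num.min cap (U z) <= cap by rewrite ge_min lexx.
  by rewrite (min_l yc); lra.
have [g0 /(_ _ (ubK i j Oy)) hN] := max_point s02 Lambda0 C2 hmax.
rewrite /isaacs_term g0 dotpC dotp0l add0r addr_ge0 ?oppr_ge0//.
have h1 := ler_wpM2r cap0 (c_ge i j Oy).
have := f_le i j Oy; rewrite ler_norml => /andP[h2 _].
have h3 : Mf <= gamma * cap.
  rewrite /cap mulrDr [gamma * (_ / _)]mulrC divfK ?gt_eqF// lerDr.
  by rewrite mulr_ge0// ltW.
by move: h1 h2 h3; move: (c i j y * cap) (gamma * cap) => *; lra.
Qed.

Lemma barrier_center (x : V) (e eta : R) (P : V -> R) : P x = 0 ->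
  Num.min cap (barrier_at x e eta P x) <= g x + e.
Proof.
by move=> Px; rewrite ge_min /barrier_at bump_center mulr0 Px !addr0 lexx orbT.
Qed.

Lemma g_near (x : V) (e : R) : 0 < e -> exists2 eta, 0 < eta &
  forall y, `|y - x| < eta -> g y <= g x + e.
Proof.
move=> e0; have [r r0 hr] := (continuous_rVP g).1 cg x e e0.
exists r => // y /hr; rewrite ltr_norml => /andP[_ h]; lra.
Qed.

(** With [eta] so small that the ball misses [Omega], the bump alone puts the barrier above the cap
    throughout [Omega]; no profile is required. *)
Lemma exterior_barrier (x : V) (e : R) : ~ closure Omega x -> 0 < e ->
  exists2 w, strict_upper_barrier w & w x <= g x + e.
Proof.
move=> nx e0; have [eta1 eta10 geta] := g_near x e0.
have [eta2 eta20 Oeta] : exists2 r, 0 < r & forall y, `|y - x| < r -> ~ Omega y.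
  have : nbhs x (~` closure Omega).
    by apply: open_nbhs_nbhs; split => //; apply: closed_openC; exact: closed_closure.
  move=> /nbhs_rVP[r r0 hr]; exists r => // y yr Oy; apply: (hr _ yr).
  exact: subset_closure.
pose eta := Num.min eta1 eta2; have eta0 : 0 < eta by rewrite lt_min eta10.
exists (fun y => Num.min cap (barrier_at x e eta (fun=> 0) y)); last exact: barrier_center.
apply: barrier_correct => //.
- by move=> y; rewrite lt_min => /andP[yx _]; exact: geta.
- exact: cst_continuous.
move=> phi y _ Oy + _ i j; rewrite ltNge => /negP[]; rewrite /barrier_at addr0.
have yx : eta <= `|y - x| by rewrite ge_min orbC leNgt; apply/orP; left; apply/negP => /Oeta.
have h := ler_wpM2l spread0 (bump_ge_half eta0 yx).
have := g_le x; rewrite ler_norml => /andP[h2 _].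
by move: h e0; rewrite {1}/spread; move: (spread * bumpV _ _ _) => *; lra.
Qed.

Variables (r_Omega : R) (ctr : V -> R -> V).
Hypothesis extb : exterior_balls Omega r_Omega ctr.
Hypothesis nondeg : boundary_nondegenerate Omega r_Omega ctr sigma K.

Lemma boundary_barrier (x : V) (e : R) : boundary Omega x -> ~ Omega x -> 0 < e ->
  exists2 w, strict_upper_barrier w & w x <= g x + e.
Proof.
move=> bx nOx e0; have [eta eta0 geta] := g_near x e0.
have [s0 s2] := andP s02.
have [C4 [rr [lambda [mu0 [[C40 /andP[rr0 rrO] lam0 mu00] nd]]]]] := nondeg.
have [/andP[rO0 rO1] eb] := extb.
pose r := rr / 2; have r0 : 0 < r by rewrite divr_gt0.
have rrr : r < rr by rewrite ltr_pdivrMr// mulr2n mulrDr mulr1 ltrDl.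
have r1 : r <= 1 by rewrite (le_trans (ltW rrr))// (le_trans (ltW rrO))// ltW.
have [_ qx] : ~ Omega (ctr x r) /\ ecball (ctr x r) r `&` closure Omega = [set x].
  by apply: eb => //; rewrite r0 (le_trans (ltW rrr))// ltW.
(* The nondegeneracy ratio times the constant of [ball_volume_ge]. *)
pose theta := mu0 * (n1^-1) ^+ n.+1.
have theta0 : 0 < theta by rewrite mulr_gt0// exprn_gt0// invr_gt0.
pose G := (2 - sigma) * lambda * theta / 2.
have G0 : 0 < G by rewrite divr_gt0// !mulr_gt0// subr_gt0.
(* [a * Q] gathers both errors of order [a]: that of the nonlocal term and that of the drift acting
   on the profile gradient. *)
pose Q := profile_const sigma * CK + n1 * Mb.
have q0 := far_exponent_gt0 s02.
have Q0 : 0 <= Q.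
  apply: addr_ge0; last exact: mulr_ge0.
  rewrite mulr_ge0 ?(ltW (kernel_const_gt0 s02 Lambda0))// addr_ge0//.
  by rewrite divr_ge0 ?powR_ge0// ltW.
have Q1 : 0 < Q + 1 by rewrite ltr_wpDl.
(* The four bounds serve concavity of the power, [powR_scale_ge1], growth below the far exponent,
   and [a * Q <= G / 2]. *)
pose a := Num.min (Num.min 1 sigma) (Num.min (far_exponent sigma) (G / 2 / (Q + 1))).
have a0 : 0 < a by rewrite !lt_min ltr01 s0 q0 divr_gt0// divr_gt0.
have [a1 asg aq aG] : [/\ a <= 1, a <= sigma, a <= far_exponent sigma & a <= G / 2 / (Q + 1)].
  by split; rewrite /a !ge_min lexx ?orbT.
have a01 : 0 < a <= 1 by rewrite a0.
have aQ : a * Q <= G / 2.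
  apply: (@le_trans _ _ (a * (Q + 1))); first by rewrite ler_wpM2l ?(ltW a0)// lerDl.
  by rewrite -ler_pdivlMr.
have [st /andP[st0 st1] hst] := small_threshold C40 a0.
(* [D] bounds the terms that do not grow with [M]: bump, drift on the bump, zero-order term and
   [f]. *)
pose D := spread * bump_const (n := n) sigma Lambda eta +
  spread * (n1 ^+ 2 * (Mb * (2 / eta))) + Mc * cap + Mf.
have D0 : 0 <= D.
  have k1 := mulr_ge0 spread0 (bump_const_ge0 (n := n) s02 Lambda0 eta0).
  have k2 : 0 <= n1 ^+ 2 * (Mb * (2 / eta)).
    by rewrite mulr_ge0 ?sqr_ge0// mulr_ge0// divr_ge0// ltW.
  have k3 := mulr_ge0 spread0 k2; have k4 := mulr_ge0 Mc0 cap0.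
  by rewrite /D; apply: addr_ge0 Mf0; apply: addr_ge0 k4; exact: addr_ge0.
have sta : 0 < st `^ a by rewrite powR_gt0.
(* [M1] makes the remaining gain [M * G / 2] exceed [D]; [M2] pushes the barrier above the cap at
   relative distance [st] and beyond, so only points closer to the ball remain. *)
pose M1 := 2 * D / G; pose M2 := 2 * cap / st `^ a; pose M := 1 + M1 + M2.
have M10 : 0 <= M1 by apply: divr_ge0 (ltW G0); exact: mulr_ge0.
have M20 : 0 <= M2 by apply: divr_ge0 (ltW sta); exact: mulr_ge0.
have M0 : 0 < M by rewrite /M -addrA ltr_wpDr// addr_ge0.
have MG : D <= M * (G / 2).
  have h : M1 <= M by rewrite /M addrAC lerDr addr_ge0.
  have {h} : 2 * D <= M * G by rewrite -ler_pdivrMr.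
  by move: (D) (M) (G) => D' M' G'; lra.
have Mst : 2 * cap <= M * st `^ a by rewrite -ler_pdivrMr// /M lerDr addr_ge0.
pose P y := M * profile r a (y - ctr x r).
have Px : P x = 0.
  have : [set x] x by []; rewrite -qx => -[xq _].
  rewrite /P /profile max_l ?powR0 ?mulr0 ?gt_eqF// subr_le0 ler_pdivrMr// mul1r.
  exact: xq.
exists (fun y => Num.min cap (barrier_at x e eta P y)); last exact: barrier_center.
apply: barrier_correct => //.
- by move=> y; rewrite mulr_ge0 ?profile_ge0// ltW.
- have -> : P = (fun y => 0 + M * profile r a (y - ctr x r) + cst 0 y).
    by apply/funext => y; rewrite add0r addr0.
  by apply: continuous_affine_rV; [exact: continuous_profile|exact: cst_continuous].
move=> phi y C2 Oy; set t := barrier_at _ _ _ _ _ => tc touch i j.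
pose v := y - ctr x r; pose ss := enorm v / r - 1.
have ss0 : 0 < ss.
  rewrite subr_gt0 ltr_pdivlMr// mul1r ltNge; apply/negP => vr.
  have : (ecball (ctr x r) r `&` closure Omega) y by split=> //; exact: subset_closure.
  by rewrite qx => yx; apply: nOx; rewrite -yx.
have vE : enorm v = r + r * ss by rewrite /ss; field; rewrite gt_eqF.
have PE := profileE a r0 ss0 vE.
have P0 := profile_gt0 a r0 ss0 vE.
have tN : - cap <= t.
  have h := gN x; rewrite /t /barrier_at.
  have h1 := mulr_ge0 spread0 (bump_ge0 x eta y).
  have h2 : 0 <= P y by rewrite mulr_ge0 ?profile_ge0// ltW.
  by move: h1 h2; move: (spread * _) (P y) => *; lra.
have ssst : ss < st.
  rewrite ltNge; apply/negP => sts.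
  have h : st `^ a <= ss `^ a.
    by apply: (ge0_ler_powR (ltW a0)); rewrite ?nnegrE ?(ltW st0)// ltW.
  have h1 : 2 * cap <= P y by rewrite (le_trans Mst)// /P -/v PE ler_wpM2l// ltW.
  move: tc; rewrite ltNge => /negP; apply; rewrite /t /barrier_at.
  have h2 := mulr_ge0 spread0 (bump_ge0 x eta y); have h3 := gN x.
  by move: h1 h2; move: (spread * _) (P y) => *; lra.
have ss1 : ss < 1 by exact: lt_le_trans st1.
have [Cs Ca] : C4 * ss <= 2 /\ (C4 ^+ 2 * ss / 2) `^ a <= 2^-1 by apply: hst; rewrite ss0.
pose d := r * ss; have d0 : 0 < d by rewrite mulr_gt0.
have d1 : d < 1 by rewrite (le_lt_trans _ ss1)// ler_piMl// ltW.
have [m dm] : exists m, 2^-1 ^+ m.+1 <= d < 2^-1 ^+ m by apply: dyadic_near; rewrite d0.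
have [||S [mS SS SV SK]] := nd i j x r y bx _ Oy; first by rewrite r0.
  rewrite /eball /= -/v vE mulr_natl mulr2n ltrD2l -[ltRHS]mulr1 ltr_pM2l//.
rewrite -/v -/ss -/d in SS SV SK.
have Ssub z : S z -> dotp z ((enorm v)^-1 *: v) < - d /\ (d <= enorm z < C4 * d).
  move=> /SS[h1 [h2 h3]]; split=> //; move: h2 h3; rewrite /eball /= subr0 => -> /negP.
  by rewrite -leNgt => ->.
have Svol : ((theta * d ^+ n.+1)%:E <= mu S)%E.
  have mu0e : (0 <= mu0%:E)%E by rewrite lee_fin ltW.
  have BV := lee_wpmul2l mu0e (@ball_volume_ge R n d (ltW d0)).
  apply: le_trans SV; apply: le_trans BV.
  by rewrite -EFinM lee_fin /theta -mulrA ler_wpM2l ?(ltW mu00)// -exprMn mulrC.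
have touch' z : phi (y + z) - phi y <= M * (profile r a (v + z) - profile r a v) +
    spread * (bumpV x eta (y + z) - bumpV x eta y).
  have -> : v + z = y + z - ctr x r by rewrite /v addrAC.
  by apply: le_trans (touch z) _; rewrite /P [M * (_ - _)]mulrBr.
have gE := profile_touching_grad r0 a01 ss0 vE C2 eta0 (ltW M0) spread0 touch'.
have NL := nonlocalR_profile_le s02 Lambda0 r0 a01 ss0 vE C2 eta0 (ltW M0) spread0 touch'
  aq ss1 r1 Cs Ca Ssub dm lam0 (ubK i j Oy) mS Svol SK.
have NB := nonlocalR_bump_le s02 Lambda0 x y (ubK i j Oy) eta0.
(* All terms are measured against [E]: the gain is [M * E * G], the errors of order [a] take at most
   half of it, and [E >= 1] lets the other half cover [D]. *)
set E := profile r a v * d `^ (- sigma).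
have E1 : 1 <= E.
  by rewrite /E PE powR_scale_ge1 ?r0 ?r1 ?ss0 ?(ltW ss1) ?a0.
(* The gradient has size [a P / d], which [P d^(-sigma)] controls when [sigma >= 1]; for [sigma < 1]
   the drift vanishes. *)
have bp : `|dotp (b i j y) (profile_grad r a ss v)| <= a * (n1 * Mb) * E.
  have [sg1|sg1] := ltP sigma 1.
    rewrite (b0 sg1 i j Oy) dotp0l normr0; apply: mulr_ge0 (le_trans ler01 E1).
    by apply: mulr_ge0 (ltW a0) _; exact: mulr_ge0.
  apply: le_trans (normr_dotp _ _) _; rewrite enorm_profile_grad// -/d.
  have h1 : enorm (b i j y) <= n1 * Mb.
    by rewrite (le_trans (enorm_le_norm _))// ler_wpM2l// b_le.
  have h2 : d^-1 <= d `^ (- sigma).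
    rewrite -(powR_inv1 (ltW d0)); apply: ger_powR; first by rewrite d0 ltW.
    by rewrite lerN2.
  have aP : 0 <= a * profile r a v by rewrite mulr_ge0 ?(ltW a0)// ltW.
  apply: (@le_trans _ _ (n1 * Mb * (a * profile r a v * d `^ (- sigma)))).
    apply: ler_pM => //; first exact: enorm_ge0.
      by rewrite mulr_ge0// invr_ge0 ltW.
    by rewrite ler_wpM2l.
  by rewrite /E le_eqVlt; apply/orP; left; apply/eqP; ring.
have bb : `|dotp (b i j y) (grad (bumpV x eta) y)| <= n1 ^+ 2 * (Mb * (2 / eta)).
  rewrite (le_trans (normr_dotp_norm _ _))// ler_wpM2l ?sqr_ge0//.
  apply: ler_pM; [exact: normr_ge0|exact: normr_ge0|exact: b_le|exact: grad_bump_le].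
have ct : - (Mc * cap) <= c i j y * t.
  have : `|c i j y * t| <= Mc * cap.
    by rewrite normrM ler_pM// ?c_le// ler_norml tN ltW.
  by rewrite ler_norml => /andP[].
have := f_le i j Oy; rewrite ler_norml => /andP[fl _].
have E2 : M * profile r a v * d `^ (- sigma) *
    (a * (profile_const sigma * CK) - (2 - sigma) * lambda * theta / 2) =
  M * E * (a * (profile_const sigma * CK) - G) by rewrite /E /G; ring.
rewrite -/d E2 in NL.
rewrite /isaacs_term gE dotpDr (dotpZr M) (dotpZr spread).
have ME : 0 <= M * E by rewrite mulr_ge0 ?(ltW M0)// (le_trans ler01).
have k1 := ler_wpM2l ME aQ.
have k2 : M * (G / 2) <= M * E * (G / 2).
  by rewrite -[M * E * _]mulrA ler_wpM2l ?(ltW M0)// ler_peMl// divr_ge0// ltW.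
move: bp; rewrite ler_norml => /andP[bp _].
move: bb; rewrite ler_norml => /andP[bb _].
move: NB; rewrite ler_norml => /andP[_ NB].
have k3 := ler_wpM2l (ltW M0) bp; have k4 := ler_wpM2l spread0 bb.
have k5 := ler_wpM2l spread0 NB.
move: NL k1 k2 k3 k4 k5 ct fl MG; rewrite /D /Q; clear.
move: (nonlocalR _ _ _ _) => N1; move: (nonlocalR _ _ _ _) => N2.
move: (dotp _ _) => D1; move: (dotp _ _) => D2; move: (c i j y * t) => ct.
move: (f i j y) (bump_const _ _ _) (2 / eta) CK (profile_const sigma) spread n1 => *; lra.
Qed.

End barriers.

(** This symmetry turns an upper barrier for [-f] and [-g] into a lower barrier for [f] and [g]. *)
Lemma isaacs_termN {R : realType} {n : nat} (sigma Lambda : R) {A B : Type}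
    (K : A -> B -> 'rV[R]_n.+1 -> 'rV[R]_n.+1 -> R) (b : A -> B -> 'rV[R]_n.+1 -> 'rV[R]_n.+1)
    (c f : A -> B -> 'rV[R]_n.+1 -> R) i j y (t : R) phi :
  0 < sigma < 2 -> 0 < Lambda -> upper_bounds sigma Lambda (K i j y) -> C2b phi ->
  isaacs_term sigma K b c f i j y (- t) (\- phi) =
    - isaacs_term sigma K b c (fun i j y => - f i j y) i j y t phi.
Proof.
move=> s02 L0 ubk C2; have [_ gE] := C2bN C2.
have NE : nonlocalR sigma (K i j y) (\- phi) y = - nonlocalR sigma (K i j y) phi y.
  have -> : \- phi = (fun x => phi x + (-2) * phi x + 0) by apply/funext => x /=; ring.
  by rewrite (nonlocalR_lincomb s02 L0 _ _ _ ubk C2 C2); ring.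
by rewrite /isaacs_term NE gE dotpNr; ring.
Qed.

Lemma bounded_set_proper {R : realType} {n : nat} (Omega : set 'rV[R]_n.+1) :
  bounded_set Omega -> exists x, ~ Omega x.
Proof.
move=> [M [_ hM]]; exists (const_mx (`|M| + 2)) => Ox.
have M1 : M < `|M| + 1 by rewrite (le_lt_trans (ler_norm M))// ltrDl.
have := hM _ M1 _ Ox; apply/negP; rewrite -ltNge.
have M2 : 0 <= `|M| + 2 by rewrite addr_ge0.
apply: lt_le_trans (coord_le_norm _ ord0); rewrite mxE (ger0_norm M2).
by rewrite ltrD2l ltr1n.
Qed.

Theorem theorem5p13 (R : realType) (n : nat) (Omega : set 'rV[R]_n.+1)
    (r_Omega : R) (y : 'rV[R]_n.+1 -> R -> 'rV[R]_n.+1)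
    (A B : Type) (sigma Lambda gamma : R)
    (K : A -> B -> 'rV[R]_n.+1 -> 'rV[R]_n.+1 -> R)
    (b : A -> B -> 'rV[R]_n.+1 -> 'rV[R]_n.+1)
    (c f : A -> B -> 'rV[R]_n.+1 -> R)
    (g : 'rV[R]_n.+1 -> R) :
  bounded_domain Omega ->
  exterior_balls Omega r_Omega y ->
  inhabited A -> inhabited B ->
  0 < sigma < 2 ->
  (sigma < 1 -> forall i j x, Omega x -> b i j x = 0) ->
  0 < gamma ->
  (forall i j x, Omega x -> gamma <= c i j x) ->
  [bounded g x | x in setT] -> continuous g ->
  unif_bounded_continuous_kernels Omega K ->
  unif_bounded_continuous Omega setT (fun ij : A * B => b ij.1 ij.2) ->
  unif_bounded_continuous Omega setT (fun ij : A * B => c ij.1 ij.2) ->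
  unif_bounded_continuous Omega setT (fun ij : A * B => f ij.1 ij.2) ->
  0 < Lambda ->
  (forall i j x, Omega x -> upper_bounds sigma Lambda (K i j x)) ->
  boundary_nondegenerate Omega r_Omega y sigma K ->
  exists u : 'rV[R]_n.+1 -> R,
    discontinuous_viscosity_solution (isaacs sigma K b c f) Omega g u.
Proof.
move=> [oO _ _ bO] extb [i0] [j0] s02 b0 gam0 c_ge bg cg Kc bc cc fc L0 ubK nondeg.
have [Mb Mb0 hb] := unif_bound bc; have [Mc Mc0 hc] := unif_bound cc.
have [Mf Mf0 hf] := unif_bound fc; have [Mg Mg0 hg] := (boundedP g).1 bg.
have hb' i j := hb (i, j); have hc' i j := hc (i, j); have hf' i j := hf (i, j).
rewrite /= in hb' hc' hf'.
(* Stated for general data [h], [k] because it is used for [f], [g] and for their negatives. *)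
have barrier (h : A -> B -> 'rV[R]_n.+1 -> R) (k : 'rV[R]_n.+1 -> R) x (e : R) :
    (forall i j x, Omega x -> `|h i j x| <= Mf) -> (forall x, `|k x| <= Mg) ->
    continuous k -> ~ Omega x -> 0 < e ->
    exists2 w, strict_upper_barrier sigma K b c h k Omega w & w x <= k x + e.
  move=> hh hk ck nOx e0; have [cx|ncx] := pselect (closure Omega x).
    apply: (boundary_barrier s02 L0 gam0 ubK Mb0 Mc0 Mf0 (ltW Mg0) hb' hc' hh c_ge
      b0 hk ck extb nondeg) => //.
    by split=> // /interior_subset.
  exact: (exterior_barrier s02 L0 gam0 b ubK Mf0 (ltW Mg0) hh c_ge hk ck ncx).
have FE x s phi : Omega x -> C2b phi -> _ := isaacsE s02 L0 b c ubK f (y := x) s (phi := phi).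
exists (perron_solution (isaacs sigma K b c f) Omega g).
apply: (perron_solution_correct oO FE).
- by move=> phi x s e C2 Ox e0; exact: (isaacs_term_continuous s02 L0 ubK Kc bc cc fc s C2 Ox e0).
- by move=> phi chi x s i j C1 C2 Ox h; exact: (isaacs_term_elliptic s02 L0 b c ubK f s i j C1 C2 Ox h).
- move=> x e nOx e0; have [w [cw bw gw sw] wx] := barrier f g x e hf' hg cg nOx e0.
  exists w => //; split=> // phi z C2 Oz touch.
  by apply: (F_ge FE (i := i0)) => // j; exact: sw.
- move=> x e nOx e0.
  have hN i j z : Omega z -> `|- f i j z| <= Mf by rewrite normrN; exact: hf'.
  have gN z : `|(\- g) z| <= Mg by rewrite normrN.
  have [w [cw [M hM] gw sw] wx] :=
    barrier (fun i j z => - f i j z) (\- g) x e hN gN (continuousN_rV cg) nOx e0.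
  exists (\- w); last by rewrite /= lerNr opprD opprK.
  split; [exact: continuousN_rV|by exists M => z; rewrite normrN| |].
    (* An upper bound on the sup-inf asks for some [j] for each [i], hence [j0]; the lower bound
       above asked for one [i] against all [j], hence [i0]. *)
    move=> phi z C2 Oz touch; apply: (F_le FE) => // i; exists j0.
    have [CN _] := C2bN C2.
    have -> : phi = \- (\- phi) by apply/funext => v; rewrite /= opprK.
    rewrite (isaacs_termN _ _ _ _ s02 L0 (ubK i j0 z Oz) CN) oppr_le0.
    apply: sw => // v; have := touch v; rewrite /=; lra.
  by move=> z; rewrite /= lerNl; exact: gw.
- exact: bounded_set_proper.
Qed.
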